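(* Let $A=(a_{ij})\in\mathbb{R}^{2\times 2}$ and, for $q_1,q_2\in(0,1]$, consider the system $${}^cD^{q_1}x(t)=a_{11}x(t)+a_{12}y(t),\qquad {}^cD^{q_2}y(t)=a_{21}x(t)+a_{22}y(t).$$ (i) If $\det(A)<0$, then the system is unstable, regardless of the fractional orders (i.e. for every $q_1,q_2\in(0,1]$). (ii) If $\det(A)>0$, then the system is unstable regardless of the fractional orders (i.e. for every $q_1,q_2\in(0,1]$) if and only if at least one of the following conditions holds: $$a_{11}+a_{22}\geq \det(A)+1,\qquad\text{or}\qquad a_{11}>0,\ a_{22}>0,\ a_{11}a_{22}\geq\det(A).$$
   Context: ${}^cD^{q}$ denotes the Caputo fractional derivative of order $q$ (with starting point $0$): for $q\in(0,1)$, ${}^cD^q x(t)=\frac{1}{\Gamma(1-q)}\int_0^t (t-\tau)^{-q}x'(\tau)\,d\tau$, where $\Gamma(\cdot)$ is Euler's Gamma function; for $q=1$ it is the ordinary derivative $x'(t)$. For $\mathbf{x}_0\in\mathbb{R}^2$, let $\varphi(t,\mathbf{x}_0)$ denote the unique solution $(x(t),y(t))$, $t\ge 0$, of the system with $(x(0),y(0))=\mathbf{x}_0$. The system is called stable if its trivial solution is stable: for every $\varepsilon>0$ there is $\eta>0$ such that $\|\mathbf{x}_0\|<\eta$ implies $\|\varphi(t,\mathbf{x}_0)\|\le\varepsilon$ for all $t\ge 0$. It is called unstable if it is not stable. *)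

(* Defs.v *)
From HB Require Import structures.
From mathcomp Require Import all_boot all_order all_algebra.
From mathcomp Require Import all_classical all_reals all_analysis.

Set Implicit Arguments.
Unset Strict Implicit.
Unset Printing Implicit Defensive.

Import Order.TTheory GRing.Theory Num.Theory.
Import numFieldNormedType.Exports.

Local Open Scope classical_set_scope.
Local Open Scope ring_scope.

Definition Gamma {R : realType} (z : R) : R :=
  \int[lebesgue_measure]_(s in `]0, +oo[) (s `^ (z - 1) * expR (- s)).

(* Meant for q in ]0, 1]. *)
Definition caputo {R : realType} (q : R) (x : R -> R) (t : R) : R :=
  if q == 1 then derive1 x t
  else (Gamma (1 - q))^-1 *
       \int[lebesgue_measure]_(s in `]0, t[) ((t - s) `^ (- q) * derive1 x s).

(* The class in which solutions are sought.  A solution of an equation of order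
   q < 1 generally has a derivative of size t^(q-1) at 0, so x' is only required
   to be continuous on ]0, +oo[ and integrable near 0; the integral in [caputo]
   then converges absolutely for every t > 0.  Values at negative times are
   irrelevant. *)
Definition caputo_regular {R : realType} (x : R -> R) : Prop :=
  [/\ {within `[0, +oo[, continuous x},
      forall t, 0 < t -> derivable x t 1,
      forall t, 0 < t -> {for t, continuous (derive1 x)}
    & forall T, 0 < T ->
        lebesgue_measure.-integrable `]0, T[ (EFin \o derive1 x)].

(* The equations are imposed for t > 0: at t = 0 the integral defining the Caputo
   derivative is over an empty interval. *)
Definition is_solution {R : realType} (A : 'M[R]_2) (q1 q2 : R) (x0 y0 : R)
    (x y : R -> R) : Prop :=
  [/\ caputo_regular x, caputo_regular y, x 0 = x0, y 0 = y0
    & forall t, 0 < t ->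
        caputo q1 x t = A 0 0 * x t + A 0 1 * y t /\
        caputo q2 y t = A 1 0 * x t + A 1 1 * y t].

Definition norm2 {R : realType} (x y : R) : R := Num.sqrt (x ^+ 2 + y ^+ 2).

(* The solution with a given initial value exists and is unique; it is referred
   to here by quantifying over all (x, y) satisfying [is_solution]. *)
Definition stable {R : realType} (A : 'M[R]_2) (q1 q2 : R) : Prop :=
  forall eps : R, 0 < eps -> exists2 eta : R, 0 < eta &
    forall (x0 y0 : R) (x y : R -> R),
      is_solution A q1 q2 x0 y0 x y -> norm2 x0 y0 < eta ->
      forall t, 0 <= t -> norm2 (x t) (y t) <= eps.

Definition unstable {R : realType} (A : 'M[R]_2) (q1 q2 : R) : Prop :=
  ~ stable A q1 q2.

(* Main.v *)
(* A solution of the system is a solution of the Volterra equations obtained by applying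
   the Riemann-Liouville integrals of orders q1 and q2.  If the characteristic function
   (l^q1 - a11)(l^q2 - a22) - a12 a21 has a positive root, the Laplace transform at this
   root shows that bounded solutions have constrained initial values; as solutions exist
   for all initial values, the system is unstable.  When det A < 0, or under one of the
   two conditions of (ii), such a root exists for all orders.

   Otherwise there are positive integers m, n such that
   p(z) = z^(m+n) - a11 z^n - a22 z^m + det A is positive on [0, +oo[.  Take the orders
   m 2^-r and n 2^-r and let J be the fractional integral of order 2^-r.  Eliminating one
   unknown shows that the product of the operators 1 - s J, over the roots s of p, maps
   each component of the solution to a combination of iterates of J on bounded functions.
   For r large each 1 - s J has an inverse bounded uniformly in time: when Re s < 0 this
   follows from the maximum principle for 1 + c J, c > 0; the case of s at the order
   2^-(r+1) reduces to the case of s^2 at the order 2^-r; and since s is not in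
   [0, +oo[, some s^(2^j) has negative real part. *)

(* Explicit solutions are of Mittag-Leffler type, and bounding them directly would call for contour
   integrals. Halving the order takes their place: with order [2^-r], a factor [1 - s J] should be
   harmless once |arg s| > 2^-r pi / 2, and refining r brings every s off [0, +oo[ into that region,
   so that only roots on [0, +oo[ matter. What remains is a comparison argument on the real line.
   The operator J is not bounded uniformly in time, so the right-hand side cannot be estimated
   before inversion. It is kept as a polynomial in J with bounded coefficients, and each inverted
   factor lowers its degree by one. Existence has to be proved because [stable] quantifies over
   solutions and would hold vacuously without any. As [caputo_regular] concerns the derivative, the
   iteration builds the derivatives; the growth of Gamma that makes it converge comes from one
   elementary lower bound. The exponents m, n come either from weighted arithmetic-geometric means
   or from a common zero t of z^m - t^m and z^n - t^n. *)
Require Import Defs.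
From HB Require Import structures.
From mathcomp Require Import all_boot all_order all_algebra.
From mathcomp Require Import all_classical all_reals all_analysis.
From mathcomp Require Import measurable_realfun.
From mathcomp Require Import complex.
From mathcomp Require Import ring lra.

Set Implicit Arguments.
Unset Strict Implicit.
Unset Printing Implicit Defensive.

Import Order.TTheory GRing.Theory Num.Theory.
Import numFieldNormedType.Exports.
Import ComplexField.Normc.
Local Open Scope classical_set_scope.
Local Open Scope ring_scope.

(** * Affine changes of variable and convolution *)

Section affine.
Context {R : realType}.
Notation mu := (@lebesgue_measure R).
Implicit Type f : R -> \bar R.

Let addm (c : R) : measurableTypeR R -> measurableTypeR R := fun x => x + c.
Let mulm (c : R) : measurableTypeR R -> measurableTypeR R := fun x => c * x.

(** Pushing Lebesgue measure forward along the translation gives a measure that agrees with it on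
    half-open intervals, and these determine it. The scaling lemma rests on the same uniqueness. *)
Lemma ge0_integral_shift f (c : R) : measurable_fun [set: R] f ->
  (forall x, 0 <= f x)%E -> (\int[mu]_x f (x + c)%R = \int[mu]_x f x)%E.
Proof.
move=> mf f0.
have mc : measurable_fun setT (addm c) by exact: measurable_funD.
rewrite -[LHS]/(\int[mu]_(x in addm c @^-1` setT) f (addm c x))%E.
rewrite -(@ge0_integral_pushforward _ _ (measurableTypeR R) (measurableTypeR R) R _ mc mu)//.
apply: eq_measure_integral => A mA _; apply/esym.
apply: lebesgue_measure_unique => //= _ [[a b]] _ <-; rewrite /pushforward.
rewrite (_ : addm c @^-1` _ = `](a - c), (b - c)]%classic); last first.
  by apply/seteqP; split=> x /=; rewrite !in_itv/= /addm ltrBlDr lerBrDr.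
rewrite !lebesgue_measure_itv/= !lte_fin ltrD2r.
by case: ifP => // _; rewrite -!EFinB; congr EFin; ring.
Qed.

Lemma ge0_integral_scale f (c : R) : 0 < c -> measurable_fun [set: R] f ->
  (forall x, 0 <= f x)%E ->
  (c%:E * \int[mu]_x f (c * x)%R = \int[mu]_x f x)%E.
Proof.
move=> c0 mf f0.
have mc : measurable_fun setT (mulm c) by exact: measurable_funM.
rewrite -[X in (_ * X)%E]/(\int[mu]_(x in mulm c @^-1` setT) f (mulm c x))%E.
rewrite -(@ge0_integral_pushforward _ _ (measurableTypeR R) (measurableTypeR R) R _ mc mu)//.
have c0' : 0 <= c by exact: ltW.
rewrite -(ge0_integral_mscale _ _ (NngNum c0'))//.
apply: eq_measure_integral => A mA _; apply/esym.
apply: lebesgue_measure_unique => //= _ [[a b]] _ <-.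
rewrite /mscale/= /pushforward.
rewrite (_ : mulm c @^-1` _ = `](a / c), (b / c)]%classic); last first.
  apply/seteqP; split=> x /=; rewrite !in_itv/= /mulm ltr_pdivrMr// ler_pdivlMr//;
  by rewrite ![x * c]mulrC.
rewrite !lebesgue_measure_itv/= !lte_fin ltr_pM2r ?invr_gt0//.
case: ifPn => _; last by rewrite mule0.
by rewrite -!EFinB -EFinM; congr EFin; field; rewrite gt_eqF.
Qed.

Lemma ge0_integral_reflect f (c : R) : measurable_fun [set: R] f ->
  (forall x, 0 <= f x)%E -> (\int[mu]_x f (c - x)%R = \int[mu]_x f x)%E.
Proof.
move=> mf f0.
have mN : measurable_fun setT (-%R : measurableTypeR R -> measurableTypeR R).
  exact: measurable_funN.
transitivity (\int[mu]_x f (- x)%R)%E.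
  rewrite -(@ge0_integral_shift (fun x => f (- x)) (- c))//; last first.
    exact: measurableT_comp.
  by apply: eq_integral => x _; rewrite opprB addrC.
rewrite -[LHS]/(\int[mu]_(x in -%R @^-1` setT) f (- x)%R)%E.
rewrite -(@ge0_integral_pushforward _ _ (measurableTypeR R) (measurableTypeR R) R _ mN mu)//.
by apply: eq_measure_integral => A mA _; exact: lebesgue_measureN.
Qed.

End affine.

Section convolution.
Context {R : realType}.
Notation mu := (@lebesgue_measure R).

(** The integral runs over the whole line: kernels and functions are extended by zero to the
    negative axis, which cuts it down to the usual range and spares Fubini's theorem any moving
    domain. *)
Definition conv (k f : R -> R) (t : R) : R := \int[mu]_s (k (t - s) * f s).

Lemma measurable_fun_reflect (c : R) (k : R -> R) : measurable_fun [set: R] k ->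
  measurable_fun [set: R] (fun s : R => k (c - s)).
Proof.
by move=> mk; apply: measurableT_comp => //; exact: measurable_funB.
Qed.

Lemma measurable_fun_convM (k f : R -> R) : measurable_fun [set: R] k ->
  measurable_fun [set: R] f ->
  measurable_fun [set: R * R] (fun z : R * R => k (z.1 - z.2) * f z.2).
Proof.
move=> mk mf; apply: measurable_funM; last exact: measurableT_comp.
by apply: measurableT_comp => //; exact: measurable_funB.
Qed.

Lemma measurable_conv (k f : R -> R) : measurable_fun [set: R] k ->
  measurable_fun [set: R] f -> measurable_fun [set: R] (conv k f).
Proof.
move=> mk mf; apply: measurableT_comp; first exact: fine_measurable.
pose F (z : R * R) := (k (z.1 - z.2) * f z.2)%:E.
have mF : measurable_fun [set: R * R] F.
  by apply/measurable_EFinP; exact: measurable_fun_convM.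
rewrite (_ : (fun t => _) = (fun t => \int[mu]_s F^\+ (t, s) -
    \int[mu]_s F^\- (t, s)))%E; last first.
  apply/funext => t.
  rewrite -[LHS]/(\int[mu]_x (F \o (fun s => (t, s))) x)%E [LHS]integralE.
  by rewrite funepos_comp funeneg_comp.
apply: emeasurable_funB.
  have mFp := measurable_funepos mF.
  exact: (measurable_fun_fubini_tonelli_F (m2 := mu) _ mFp).
have mFn := measurable_funeneg mF.
exact: (measurable_fun_fubini_tonelli_F (m2 := mu) _ mFn).
Qed.

(** Fubini's theorem for the integrand [F] below, whose integrability follows by Tonelli from that
    of [K (t - u) * f u]. Stating the hypothesis on [K] in the extended reals also gives finiteness
    of the convolution of the kernels. *)
Lemma conv_assoc (k1 k2 K f : R -> R) (t : R) :
  measurable_fun [set: R] k1 -> (forall u, 0 <= k1 u) ->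
  measurable_fun [set: R] k2 -> (forall u, 0 <= k2 u) ->
  measurable_fun [set: R] f ->
  (forall u, \int[mu]_s (k1 (u - s) * k2 s)%:E = (K u)%:E)%E ->
  mu.-integrable setT (EFin \o (fun u => K (t - u) * f u)) ->
  conv k1 (conv k2 f) t = conv K f t.
Proof.
move=> mk1 k10 mk2 k20 mf KE iK.
pose F (z : R * R) := (k1 (t - z.1) * (k2 (z.1 - z.2) * f z.2))%:E.
have mF : measurable_fun [set: R * R] F.
  apply/measurable_EFinP; apply: measurable_funM.
    by apply: measurableT_comp => //; exact: measurable_funB.
  exact: measurable_fun_convM.
have mkk u : measurable_fun [set: R] (fun s => k1 (t - s) * k2 (s - u)).
  apply: measurable_funM; first exact: measurable_fun_reflect.
  by apply: measurableT_comp => //; exact: measurable_funB.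
have KEs u : (\int[mu]_s (k1 (t - s) * k2 (s - u))%:E = (K (t - u))%:E)%E.
  rewrite -KE -[LHS](@ge0_integral_shift _ _ u).
  - by apply: eq_integral => x _; rewrite addrK opprD addrA addrAC.
  - exact/measurable_EFinP.
  - by move=> x; rewrite lee_fin mulr_ge0.
have K0 u : 0 <= K u.
  by rewrite -lee_fin -KE integral_ge0// => s _; rewrite lee_fin mulr_ge0.
have iKs u : mu.-integrable setT (fun s => (k1 (t - s) * k2 (s - u))%:E).
  apply/integrableP; split; first by apply/measurable_EFinP; exact: (mkk u).
  under eq_integral do rewrite gee0_abs ?lee_fin ?mulr_ge0//.
  by rewrite KEs ltry.
have iF : (mu \x mu)%E.-integrable setT F.
  apply/integrable21ltyP => //; case/integrableP: (iK) => _; apply: le_lt_trans.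
  rewrite le_eqVlt; apply/orP; left; apply/eqP; apply: eq_integral => u _ /=.
  rewrite normrM ger0_norm// EFinM -KEs -ge0_integralZr//.
  - by apply: eq_integral => s _; rewrite mulrA normrM ger0_norm// mulr_ge0.
  - by apply/measurable_EFinP; exact: (mkk u).
  - by move=> s _; rewrite lee_fin mulr_ge0.
have E1 : (\int[mu]_s \int[mu]_u F (s, u) =
   \int[mu]_s (k1 (t - s) * conv k2 f s)%:E)%E.
  apply: ae_eq_integral => //.
  - exact: (measurable_fubini_F iF).
  - have mc : measurable_fun [set: R] (fun s => k1 (t - s) * conv k2 f s).
      apply: measurable_funM; first exact: measurable_fun_reflect.
      exact: measurable_conv.
    by apply/measurable_EFinP; exact: mc.
  - have := ae_integrable1 iF; apply: filterS => s iFs _.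
    (* Integrability of [F (s, u)] in [u] gives that of [k2 (s - u) * f u] only after division by
       [k1 (t - s)]; where this vanishes, both sides are 0. *)
    have [k1s|k1s] := eqVneq (k1 (t - s)) 0.
      rewrite k1s mul0r; under eq_integral do rewrite /F/= k1s mul0r.
      exact: integral0.
    have ik2 : mu.-integrable setT (EFin \o (fun u => k2 (s - u) * f u)).
      have := integrableZl measurableT (k1 (t - s))^-1 iFs.
      by apply: eq_integrable => // u _; rewrite -EFinM /F/= mulKf.
    rewrite /F/=; under eq_integral do rewrite EFinM.
    by rewrite integralZl//= /conv /Rintegral EFinM fineK//; exact: integrable_fin_num.
rewrite [LHS]/conv /Rintegral -E1 (Fubini iF); congr fine; apply: eq_integral => u _; rewrite /F/=.
under eq_integral do rewrite mulrA EFinM.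
by rewrite integralZr// KEs.
Qed.

(** The Tonelli form, in which values may be infinite: [fker_conv] needs it for a convolution of
    kernels not yet known to be finite. *)
Lemma ge0_conv_assoc (k1 k2 f : R -> R) (t : R) :
  measurable_fun [set: R] k1 -> (forall u, 0 <= k1 u) ->
  measurable_fun [set: R] k2 -> (forall u, 0 <= k2 u) ->
  measurable_fun [set: R] f -> (forall u, 0 <= f u) ->
  (\int[mu]_s ((k1 (t - s))%:E * \int[mu]_u (k2 (s - u) * f u)%:E) =
   \int[mu]_u ((\int[mu]_s (k1 (t - u - s) * k2 s)%:E) * (f u)%:E))%E.
Proof.
move=> mk1 k10 mk2 k20 mf f0.
pose F (z : R * R) := (k1 (t - z.1) * (k2 (z.1 - z.2) * f z.2))%:E.
have mF : measurable_fun [set: R * R] F.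
  apply/measurable_EFinP; apply: measurable_funM.
    by apply: measurableT_comp => //; exact: measurable_funB.
  exact: measurable_fun_convM.
have mkk u : measurable_fun [set: R] (fun s => k1 (t - s) * k2 (s - u)).
  apply: measurable_funM; first exact: measurable_fun_reflect.
  by apply: measurableT_comp => //; exact: measurable_funB.
transitivity (\int[mu]_s \int[mu]_u F (s, u))%E.
  apply: eq_integral => s _; rewrite -ge0_integralZl//.
  - apply/measurable_EFinP/measurable_funM; first exact: measurable_fun_reflect.
    by [].
  - by move=> u _; rewrite lee_fin mulr_ge0.
  - by rewrite lee_fin.
rewrite fubini_tonelli//; last by move=> z; rewrite lee_fin !mulr_ge0.
apply: eq_integral => u _.
have m1 : measurable_fun [set: R] (fun s => k1 (t - u - s) * k2 s).
  by apply: measurable_funM => //; exact: measurable_fun_reflect.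
have m2 : measurable_fun [set: R] (fun s => k1 (t - u - (s - u)) * k2 (s - u)).
  by apply: (measurableT_comp m1); exact: measurable_funB.
rewrite -[X in (X * _)%E](@ge0_integral_shift _ _ (- u)); last 2 first.
- by apply/measurable_EFinP; exact: m1.
- by move=> s; rewrite lee_fin mulr_ge0.
rewrite -ge0_integralZr//.
- by apply: eq_integral => s _; rewrite /F/= -EFinM mulrA opprB addrA subrK.
- by apply/measurable_EFinP; exact: m2.
- by move=> s _; rewrite lee_fin mulr_ge0.
- by rewrite lee_fin.
Qed.
End convolution.

(** * The fundamental theorem of calculus on an interval open at 0 *)

Section FTC_at0.
Context {R : realType}.
Notation mu := (@lebesgue_measure R).
Variables (f F : R -> R).
Hypothesis cf : forall s : R, 0 < s -> {for s, continuous f}.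
Hypothesis dF : forall s : R, 0 < s -> derivable F s 1 /\ derive1 F s = f s.

Let FTC_cc (c b : R) : 0 < c -> c < b ->
  (\int[mu]_(x in `[c, b]) (f x)%:E = (F b)%:E - (F c)%:E)%E.
Proof.
move=> c0 cb; apply: continuous_FTC2 => //.
- apply: continuous_in_subspaceT => x /[!inE]/=; rewrite in_itv/= => /andP[cx _].
  by apply: cf; exact: lt_le_trans c0 cx.
- have cF (s : R) : 0 < s -> {for s, continuous F}.
    by move=> /dF[/derivable1_diffP/differentiable_continuous].
  split.
  + move=> x; rewrite in_itv/= => /andP[cx _].
    by have [] := dF (lt_trans c0 cx).
  + exact/cvg_at_right_filter/cF.
  + exact/cvg_at_left_filter/cF/(lt_trans c0 cb).
- move=> x; rewrite in_itv/= => /andP[cx _].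
  by have [] := dF (lt_trans c0 cx).
Qed.

Hypothesis F0 : F x @[x --> 0^'+] --> F 0.

(** Monotone convergence along compact intervals exhausting []0, b]]. The sign replaces
    integrability, which for powers is precisely what is to be derived from this lemma. *)
Lemma ge0_integral_FTC_at0 (b : R) : 0 < b -> (forall s : R, 0 < s -> 0 <= f s) ->
  (\int[mu]_(x in `]0%R, b[) (f x)%:E = (F b - F 0)%:E)%E.
Proof.
move=> b0 f0.
have mf : measurable_fun (`]0, +oo[%classic : set R) f.
  apply: open_continuous_measurable_fun => //.
  by move=> x /[!inE]/=; rewrite in_itv/= andbT; exact: cf.
have mfb : measurable_fun (`]0, b]%classic : set R) f.
  by apply: measurable_funS mf => //; apply: subset_itvl.
rewrite integral_itv_bndo_bndc; last first.
  by apply/measurable_EFinP; apply: measurable_funS mfb => //; exact: subset_itvW.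
(* The shift by 2 keeps the left endpoint strictly below [b] already for [n = 0]. *)
pose G (n : nat) : set R := `[b / n.+2%:R, b]%classic.
have GU : \bigcup_n G n = `]0, b]%classic.
  apply/seteqP; split => x /=.
    move=> [n _]; rewrite /G/= !in_itv/= => /andP[bx ->]; rewrite andbT.
    by apply: lt_le_trans bx; rewrite divr_gt0.
  rewrite in_itv/= => /andP[x0 xb].
  exists (Num.truncn (b / x)) => //; rewrite /G/= in_itv/= xb andbT.
  rewrite ler_pdivrMr// mulrC -ler_pdivrMr//.
  by apply: (le_trans (ltW (Num.Theory.truncnS_gt _))); rewrite ler_nat.
have H : (\int[mu]_(x in G i) (f x)%:E @[i --> \oo] --> \int[mu]_(x in `]0%R, b]) (f x)%:E)%E.
  rewrite -GU; apply: ge0_nondecreasing_set_cvg_integral.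
  - move=> m n mn; rewrite subsetEset => x; rewrite /G/= !in_itv/= => /andP[bx ->].
    rewrite andbT (le_trans _ bx)// ler_pM2l// lef_pV2 ?posrE//.
    by rewrite ler_nat.
  - by move=> i; exact: measurable_itv.
  - move=> i; apply/measurable_EFinP; apply: measurable_funS mfb => //.
    by move=> x; rewrite -GU => ?; exists i.
  - move=> i x Gx; rewrite lee_fin f0//.
    have : (\bigcup_n G n) x by exists i.
    by rewrite GU/= in_itv/= => /andP[].
have GE i : (\int[mu]_(x in G i) (f x)%:E = (F b - F (b / i.+2%:R))%:E)%E.
  rewrite FTC_cc ?divr_gt0// ltr_pdivrMr// ltr_pMr//.
  by rewrite (ltr_nat R 1 i.+2).
rewrite -(cvg_lim _ H)//; under eq_fun do rewrite GE.
apply/cvg_lim => //; apply: cvg_EFin; first by near=> i.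
apply: cvgB; first exact: cvg_cst.
move/cvg_at_rightP : F0; apply; split; first by move=> n; rewrite divr_gt0.
rewrite -(mulr0 b); apply: cvgM; first exact: cvg_cst.
by rewrite (cvg_shiftS (fun n => n.+1%:R^-1 : R)); exact: cvg_harmonic.
Unshelve. all: by end_near. Qed.

(** Integrability makes the integral over [[0, c]] tend to 0 as [c] decreases to 0, while [F c]
    tends to [F 0]. *)
Lemma Rintegral_FTC_at0 (b : R) : 0 < b ->
  mu.-integrable `]0, b[ (EFin \o f) -> \int[mu]_(x in `]0, b[) f x = F b - F 0.
Proof.
move=> b0 iof.
have mfo : measurable_fun (`]0, b[%classic : set R) f.
  by apply/measurable_EFinP; exact: measurable_int iof.
have ic : mu.-integrable `[0, b] (EFin \o f).
  have mc : measurable_fun (`[0, b]%classic : set R) f by apply: measurable_fun_itv_cc mfo.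
  apply/integrableP; split; first exact/measurable_EFinP.
  rewrite integral_itv_bndoo; first by case/integrableP : iof.
  by apply: measurableT_comp => //; exact/measurable_EFinP.
have E c : 0 < c -> c < b ->
    \int[mu]_(x in `]0, b[) f x - (F b - F c) = parameterized_integral mu 0 c f.
  move=> c0 cb; rewrite Rintegral_itv_bndo_bndc// Rintegral_itv_obnd_cbnd; last first.
    by apply: integrableS ic => //; apply: subset_itv; rewrite bnd_simp.
  have := @Rintegral_itvB _ f (BLeft 0) (BRight b) c ic.
  rewrite !bnd_simp => /(_ (ltW c0) (ltW cb)) E.
  rewrite (_ : F b - F c = \int[mu]_(x in `]c, b]) f x).
    by rewrite -E opprB addrC subrK.
  rewrite Rintegral_itv_obnd_cbnd; last first.
    apply: integrableS ic => //; apply: subset_itv; rewrite bnd_simp//; exact: ltW.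
  by rewrite /Rintegral FTC_cc.
have L : parameterized_integral mu 0 c f @[c --> 0^'+] --> (0:R).
  apply: cvg_at_right_filter.
  exact: parameterized_integral_cvg_left ic.
have L2 : \int[mu]_(x in `]0, b[) f x - (F b - F c) @[c --> 0^'+] -->
  \int[mu]_(x in `]0, b[) f x - (F b - F 0).
  by apply: cvgB; [exact: cvg_cst|apply: cvgB => //; exact: cvg_cst].
apply/eqP; rewrite -subr_eq0; apply/eqP.
apply: (cvg_unique _ L2) => //.
apply: cvg_trans L; apply: near_eq_cvg; near=> c.
by rewrite E.
Unshelve. all: by end_near. Qed.
End FTC_at0.

(** * The Gamma function and the Riemann-Liouville kernels *)

Section gamma.
Context {R : realType}.
Notation mu := (@lebesgue_measure R).

Lemma integral_powR (a b : R) : 0 < a -> 0 < b ->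
  (\int[mu]_(s in `]0%R, b[) (s `^ (a - 1))%:E = (b `^ a / a)%:E)%E.
Proof.
move=> a0 b0; have an0 : a != 0 by rewrite gt_eqF.
rewrite (@ge0_integral_FTC_at0 _ _ (fun s => s `^ a / a))//.
- by rewrite powR0// mul0r subr0.
- move=> s s0; apply: differentiable_continuous; apply/derivable1_diffP.
  by apply: derivable_powR; rewrite in_itv/= s0.
- move=> s s0; have ds := @is_derive1_powR R a s s0.
  have ds' : is_derive s 1 (fun s => s `^ a / a) (s `^ (a - 1)).
    have -> : s `^ (a - 1) = a^-1 *: (a * s `^ (a - 1)) by rewrite /GRing.scale/= mulKf.
    have -> : (fun s => s `^ a / a) = a^-1 \*: (fun s => s `^ a).
      by apply/funext => x; rewrite /GRing.scale/= mulrC.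
    exact: is_deriveZ.
  by rewrite derive1E; case: ds'.
- rewrite powR0//; apply: cvgM; last exact: cvg_cst.
  exact: powR_cvg0.
- by move=> s s0; exact: powR_ge0.
Qed.

Lemma measurable_gamma_integrand (a : R) :
  measurable_fun [set: R] (fun s => s `^ (a - 1) * expR (- s)).
Proof.
apply: measurable_funM; first exact: measurable_powR.
by apply: measurableT_comp => //; exact: measurable_expR.
Qed.

Lemma gamma_integrand_bound (a : R) : exists2 C : R, 0 <= C &
  forall s, 1 <= s -> s `^ (a - 1) * expR (- s) <= C * expR (- (s / 2)).
Proof.
(* With this [K] the ratio [|a - 1| / K] is at most 1/2, so [ln s <= s / K + ln K] lets half of the
   exponential absorb the power. *)
pose K := 2 * `|a - 1| + 1.
have K1 : 1 <= K by rewrite lerDr mulr_ge0.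
have K0 : 0 < K by exact: lt_le_trans K1.
exists (expR (`|a - 1| * ln K)); first exact: expR_ge0.
move=> s s1; have s0 : 0 < s by exact: lt_le_trans s1.
rewrite /powR gt_eqF// -!expRD ler_expR.
have lns : ln s <= s / K + ln K.
  have -> : ln s = ln (s / K) + ln K.
    by rewrite -lnM ?posrE ?divr_gt0// divfK// gt_eqF.
  rewrite lerD2r; apply: ltW; exact: ln_sublinear (divr_gt0 s0 K0).
have lns0 : 0 <= ln s by exact: ln_ge0.
have H1 : (a - 1) * ln s <= `|a - 1| * (s / K + ln K).
  apply: (le_trans (ler_wpM2r lns0 (ler_norm _))).
  by rewrite ler_wpM2l.
have H2 : `|a - 1| * (s / K) <= s / 2.
  rewrite mulrCA; apply: ler_wpM2l; first exact: ltW.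
  by rewrite ler_pdivrMr// mulrC /K; lra.
rewrite mulrDr in H1; lra.
Qed.

Lemma Gamma_fin (a : R) : 0 < a ->
  mu.-integrable `]0, +oo[ (EFin \o (fun s => s `^ (a - 1) * expR (- s))).
Proof.
move=> a0; have [C C0 HC] := gamma_integrand_bound a.
(* The majorant is the bare power on []0, 1[] plus a multiple of the exponential density of rate
   1/2. *)
pose g1 := (fun s : R => s `^ (a - 1)) \_ `]0, 1[.
pose g2 := exponential_pdf (2^-1 : R).
have ig1 : mu.-integrable setT (EFin \o g1).
  rewrite /g1 -restrict_EFin; apply/integrable_restrict => //; rewrite setTI.
  apply/integrableP; split.
    by apply/measurable_EFinP; apply: measurable_funTS; exact: measurable_powR.
  under eq_integral do rewrite gee0_abs ?lee_fin ?powR_ge0//.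
  by rewrite integral_powR// ltry.
have ig2 : mu.-integrable setT (EFin \o g2) by exact: integrable_exponential_pdf.
have ig : mu.-integrable setT (EFin \o (fun s => g1 s + (2 * C) * g2 s)).
  have := integrableD measurableT ig1 (integrableZl measurableT (2 * C) ig2).
  by apply: eq_integrable.
apply: (@le_integrable _ _ _ mu _ _ _ (EFin \o (fun s => g1 s + (2 * C) * g2 s))) => //.
- by apply/measurable_EFinP; apply: measurable_funTS; exact: measurable_gamma_integrand.
- move=> s; rewrite /= in_itv/= andbT => s0.
  rewrite lee_fin ger0_norm ?mulr_ge0 ?powR_ge0 ?expR_ge0//.
  rewrite ger0_norm; last first.
    apply: addr_ge0; last by rewrite !mulr_ge0// exponential_pdf_ge0.
    by apply: restrict_ge0 => x _; exact: powR_ge0.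
  have [s1|s1] := ltP s 1.
    rewrite (le_trans (y := g1 s))//.
      rewrite /g1 patchE mem_set ?ler_piMr ?powR_ge0// ?expR_le1 ?oppr_le0 ?ltW//.
      by rewrite /= in_itv/= s0.
    by rewrite lerDl !mulr_ge0// exponential_pdf_ge0.
  rewrite (le_trans (HC _ s1))//.
  have -> : g2 s = 2^-1 * expR (- 2^-1 * s) by rewrite /g2 exponential_pdfE// ltW.
  rewrite (_ : 2 * C * _ = C * expR (- (s / 2))); last first.
    by rewrite mulNr [2^-1 * s]mulrC; field.
  by rewrite lerDr; apply: restrict_ge0 => x _; exact: powR_ge0.
- by apply: integrableS ig.
Qed.

Lemma EFin_Gamma (a : R) : 0 < a ->
  (\int[mu]_(s in `]0%R, +oo[) (s `^ (a - 1) * expR (- s))%:E = (Gamma a)%:E)%E.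
Proof. by move=> a0; rewrite /Gamma /Rintegral fineK//; exact/integrable_fin_num/Gamma_fin. Qed.

(** Only the part of the integral over [[B, 2 B]] is kept. Since [B] is free, Gamma outgrows every
    geometric sequence, which is all that the convergence of the Picard series requires. *)
Lemma Gamma_ge (a B : R) : 0 < a -> 0 < B -> B `^ a * expR (- (2 * B)) / 2 <= Gamma a.
Proof.
move=> a0 B0; rewrite -lee_fin -EFin_Gamma//.
apply: (@le_trans _ _ (\int[mu]_(s in `[B, (2 * B)%R]) (s `^ (a - 1) * expR (- s))%:E)%E); last first.
  apply: ge0_subset_integral => //=.
  - by apply/measurable_EFinP; apply: measurable_funTS; exact: measurable_gamma_integrand.
  - by move=> s _; rewrite lee_fin mulr_ge0 ?powR_ge0 ?expR_ge0.
  - by move=> s/=; rewrite !in_itv/= andbT => /andP[Bs _]; exact: lt_le_trans Bs.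
apply: (@le_trans _ _ (\int[mu]_(s in `[B, (2 * B)%R]) (B `^ a / (2 * B) * expR (- (2 * B)))%:E)%E).
  rewrite integral_cst//= lebesgue_measure_itv/= lte_fin ltr_pMl// ltr1n/=.
  rewrite -EFinB -EFinM lee_fin le_eqVlt; apply/orP; left; apply/eqP; field.
  by rewrite gt_eqF.
apply: ge0_le_integral => //=.
- by move=> s _; rewrite lee_fin !mulr_ge0 ?powR_ge0 ?expR_ge0 ?invr_ge0//; lra.
- by apply/measurable_EFinP; apply: measurable_funTS; exact: measurable_gamma_integrand.
- move=> s; rewrite in_itv/= => /andP[Bs sB]; rewrite lee_fin.
  have s0 : 0 < s by exact: lt_le_trans Bs.
  apply: ler_pM; last by rewrite ler_expR lerN2.
  + by rewrite mulr_ge0 ?powR_ge0// invr_ge0; lra.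
  + exact: expR_ge0.
  + rewrite powRB; last by rewrite (lt0r_neq0 s0) implybT.
    rewrite (powRr1 (ltW s0)).
    apply: ler_pM.
    * exact: powR_ge0.
    * by rewrite invr_ge0; lra.
    * by apply: (@ge0_ler_powR R a (ltW a0) B s) => //; rewrite nnegrE ltW.
    * by rewrite lef_pV2 ?posrE ?mulr_gt0.
Qed.

Lemma Gamma_gt0 (a : R) : 0 < a -> 0 < Gamma a.
Proof.
move=> a0; apply: lt_le_trans (Gamma_ge a0 (ltr01 : 0 < 1 :> R)).
by rewrite divr_gt0// mulr_gt0 ?expR_gt0 ?powR_gt0.
Qed.
End gamma.

Section fker.
Context {R : realType}.
Notation mu := (@lebesgue_measure R).

(* [conv (fker a)] is the Riemann-Liouville integral of order [a]. *)
Definition fker (a : R) : R -> R :=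
  (fun u => (Gamma a)^-1 * u `^ (a - 1)) \_ `]0, +oo[.

Lemma fkerE (a u : R) : 0 < u -> fker a u = (Gamma a)^-1 * u `^ (a - 1).
Proof. by move=> u0; rewrite /fker patchE mem_set//= in_itv/= u0. Qed.

Lemma fker_le0 (a u : R) : u <= 0 -> fker a u = 0.
Proof.
by move=> u0; rewrite /fker patchE memNset//= in_itv/= andbT; apply/negP; rewrite -leNgt.
Qed.

Lemma fker_gt0 (a u : R) : 0 < a -> 0 < u -> 0 < fker a u.
Proof. by move=> a0 u0; rewrite fkerE// mulr_gt0 ?invr_gt0 ?Gamma_gt0 ?powR_gt0. Qed.

Lemma fker_ge0 (a u : R) : 0 < a -> 0 <= fker a u.
Proof.
move=> a0; have [u0|u0] := ltP 0 u; first exact/ltW/fker_gt0.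
by rewrite fker_le0.
Qed.

Lemma measurable_fker (a : R) : measurable_fun [set: R] (fker a).
Proof.
apply/(measurable_restrictT _ _).1 => //; apply: measurable_funTS.
by apply: measurable_funM => //; exact: measurable_powR.
Qed.

Lemma fker_scale (a c u : R) : 0 < c -> fker a (c * u) = c `^ (a - 1) * fker a u.
Proof.
move=> c0; have [u0|u0] := ltP 0 u; last first.
  by rewrite !fker_le0 ?mulr0// mulr_ge0_le0// ltW.
by rewrite !fkerE ?mulr_gt0// powRM ?ltW// mulrCA.
Qed.

Lemma integral_fkerM (a : R) (h : R -> R) :
  (\int[mu]_u (fker a u * h u)%:E =
   \int[mu]_(u in `]0%R, +oo[) ((Gamma a)^-1 * u `^ (a - 1) * h u)%:E)%E.
Proof.
rewrite [RHS]integral_mkcond; apply: eq_integral => u _.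
rewrite /fker !patchE; case: ifPn => //; by rewrite mul0r.
Qed.

Lemma measurable_fker_expR (a l : R) :
  measurable_fun [set: R] (fun u => fker a u * expR (- (l * u))).
Proof.
apply: measurable_funM; first exact: measurable_fker.
apply: measurableT_comp; first exact: measurable_expR.
by apply: measurableT_comp => //; exact: measurable_funM.
Qed.

Lemma laplace_fker (a l : R) : 0 < a -> 0 < l ->
  (\int[mu]_u (fker a u * expR (- (l * u)))%:E = (l `^ (- a))%:E)%E.
Proof.
move=> a0 l0.
have E1 : (\int[mu]_u (fker a u * expR (- u))%:E = 1%:E)%E.
  rewrite integral_fkerM; under eq_integral do rewrite -mulrA EFinM.
  rewrite ge0_integralZl//.
  - by rewrite EFin_Gamma// -EFinM mulVf// gt_eqF ?Gamma_gt0.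
  - by apply/measurable_EFinP/measurable_funTS; exact: measurable_gamma_integrand.
  - by move=> u _; rewrite lee_fin mulr_ge0 ?powR_ge0 ?expR_ge0.
  - by rewrite lee_fin invr_ge0 ltW// Gamma_gt0.
have mf : measurable_fun [set: R] (fun u => fker a u * expR (- u)).
  have := @measurable_fker_expR a 1.
  by apply: eq_measurable_fun => u _; rewrite mul1r.
rewrite -(@ge0_integral_scale _ _ l) in E1; last 3 first.
- by [].
- by apply/measurable_EFinP; exact: mf.
- by move=> u; rewrite lee_fin mulr_ge0 ?fker_ge0 ?expR_ge0.
have mfl := measurable_fker_expR a l.
have {}E1 : ((l `^ a)%:E * \int[mu]_u (fker a u * expR (- (l * u)))%:E = 1%:E)%E.
  rewrite -E1 -(mulr_powRB1 (ltW l0) a0) EFinM -muleA; congr (_ * _)%E.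
  rewrite -ge0_integralZl//.
  - by apply: eq_integral => u _; rewrite fker_scale// -EFinM mulrA.
  - by apply/measurable_EFinP; exact: mfl.
  - by move=> u _; rewrite lee_fin mulr_ge0 ?fker_ge0 ?expR_ge0.
  - by rewrite lee_fin powR_ge0.
move: E1; set X := integral _ _ _ => E1.
have la : l `^ a != 0 by rewrite gt_eqF// powR_gt0.
(* The integral is not known to be finite; its product with a positive number being 1 excludes
   infinite values. *)
case: X E1 => [r [E1]||].
- by rewrite powRN -[r](mulKf la) E1 mulr1.
- by rewrite mulry gtr0_sg ?powR_gt0// mul1e.
- by rewrite mulrNy gtr0_sg ?powR_gt0// mul1e.
Qed.

(* By scaling the convolution is a multiple of [fker (a + b)]; comparing Laplace
   transforms shows that the factor is 1, so the Beta function is not needed. *)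
Lemma fker_conv (a b t : R) : 0 < a -> 0 < b ->
  (\int[mu]_s (fker a (t - s) * fker b s)%:E = (fker (a + b) t)%:E)%E.
Proof.
move=> a0 b0; have ab0 : 0 < a + b by exact: addr_gt0.
pose h (t : R) : \bar R := (\int[mu]_s (fker a (t - s) * fker b s)%:E)%E.
have mab u : measurable_fun [set: R] (fun s => fker a (u - s) * fker b s).
  apply: measurable_funM; last exact: measurable_fker.
  by apply: measurable_fun_reflect; exact: measurable_fker.
have ab_ge0 u s : 0 <= fker a (u - s) * fker b s by rewrite mulr_ge0 ?fker_ge0.
have h_le0 u : u <= 0 -> h u = 0%E.
  move=> u0; rewrite /h (eq_integral (fun=> 0%E)) ?integral0// => s _.
  have [s0|s0] := ltP 0 s; last by rewrite (fker_le0 _ s0) mulr0.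
  by rewrite fker_le0 ?mul0r// subr_le0; lra.
have h_ge0 u : (0 <= h u)%E by apply: integral_ge0 => s _; rewrite lee_fin.
have hE u : h u = ((Gamma (a + b))%:E * h 1%R * (fker (a + b) u)%:E)%E.
  have [u0|u0] := ltP 0 u; last by rewrite h_le0// fker_le0// mule0.
  rewrite {1}/h -(@ge0_integral_scale _ _ u)//; last 2 first.
    by apply/measurable_EFinP; exact: mab.
    by move=> s; rewrite lee_fin.
  have -> : (\int[mu]_x (fker a (u - u * x) * fker b (u * x))%:E =
      (u `^ (a - 1) * u `^ (b - 1))%:E * h 1%R)%E.
    rewrite -ge0_integralZl//.
    - apply: eq_integral => s _; rewrite -[X in fker a (X - _)](mulr1 u) -mulrBr.
      by rewrite !fker_scale// -EFinM mulrACA.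
    - by apply/measurable_EFinP; exact: mab.
    - by move=> s _; rewrite lee_fin.
    - by rewrite lee_fin mulr_ge0 ?powR_ge0.
  rewrite muleA -EFinM [RHS]muleAC -EFinM; congr (_%:E * _)%E.
  rewrite fkerE// mulVKf ?gt_eqF ?Gamma_gt0// mulrA mulr_powRB1 ?ltW//.
  by rewrite -powRD ?(lt0r_neq0 u0) ?implybT// addrA.
(* With the constant kernel 1, [ge0_conv_assoc] says that the total integral of a convolution is the
   product of the total integrals. It is applied to kernels damped by [expR (- s)], whose total
   integrals are 1. *)
pose e (f : R -> R) (s : R) := f s * expR (- (1 * s)).
have := @ge0_conv_assoc R (fun=> 1) (e (fker a)) (e (fker b)) 0 _ _ _ _ _ _.
have me c : measurable_fun [set: R] (e (fker c)) by exact: measurable_fker_expR.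
have e0 c u : 0 < c -> 0 <= e (fker c) u.
  by move=> c0; rewrite mulr_ge0 ?fker_ge0 ?expR_ge0.
move=> /(_ _ _ (me a) (fun u => e0 a u a0) (me b) (fun u => e0 b u b0)).
move=> /(_ (measurable_cst _) (fun=> ler01)).
have -> : (\int[mu]_s (1%:E * \int[mu]_u (e (fker a) (s - u) * e (fker b) u)%:E) =
   (Gamma (a + b))%:E * h 1%R)%E.
  transitivity (\int[mu]_s ((Gamma (a + b))%:E * h 1%R * (e (fker (a + b)) s)%:E))%E.
    apply: eq_integral => s _; rewrite mul1e /e EFinM muleA -hE /h -ge0_integralZr//.
    - apply: eq_integral => u _; rewrite -EFinM mulrACA -expRD; congr (_ * expR _)%:E.
      ring.
    - by apply/measurable_EFinP; exact: mab.
    - by move=> u _; rewrite lee_fin.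
  rewrite ge0_integralZl//.
  - by rewrite laplace_fker// powR1 mule1.
  - by apply/measurable_EFinP; exact: me.
  - by move=> u _; rewrite lee_fin e0.
  - by rewrite mule_ge0// lee_fin ltW// Gamma_gt0.
under eq_integral do under eq_integral do rewrite mul1r.
rewrite laplace_fker// powR1; under eq_integral do rewrite mul1e.
rewrite laplace_fker// powR1 => E1.
by rewrite -/(h t) hE E1 mul1e.
Qed.

End fker.

(** * Convolution of causal locally bounded functions *)

Section causal.
Context {R : realType}.
Notation mu := (@lebesgue_measure R).
Implicit Types (k f g : R -> R) (t T M : R).

(** Bounds on each half-line []-oo, T]] are preserved by convolution with the kernels below, unlike
    global bounds. The value at 0 is left free, so that [heaviside] can carry the initial data. *)
Definition causal_bounded f := [/\ measurable_fun [set: R] f,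
  forall s, s < 0 -> f s = 0 &
  forall T, exists M, forall s, s <= T -> `|f s| <= M].

(** A kernel may be singular at 0 but is given the value 0 there, so [conv k f t] involves only
    values of [f] before [t]; its sign makes the convolution monotone. *)
Definition causal_kernel k := [/\ measurable_fun [set: R] k,
  forall u, 0 <= k u, forall u, u <= 0 -> k u = 0 &
  forall T, (\int[mu]_(u in `]0%R, T[) (k u)%:E < +oo)%E].

Lemma fker_kernel (a : R) : 0 < a -> causal_kernel (fker a).
Proof.
move=> a0; split; first exact: measurable_fker.
- by move=> u; exact: fker_ge0.
- by move=> u; exact: fker_le0.
move=> T; have [T0|T0] := ltP 0 T; last first.
  by rewrite set_itv_ge ?integral_set0 ?ltry// bnd_simp -leNgt.
have -> : (\int[mu]_(u in `]0%R, T[) (fker a u)%:E =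
    \int[mu]_(u in `]0%R, T[) ((Gamma a)^-1%:E * (u `^ (a - 1))%:E))%E.
  apply: eq_integral => u; rewrite inE/= in_itv/= => /andP[u0 _].
  by rewrite fkerE// EFinM.
rewrite ge0_integralZl_EFin//.
- by rewrite integral_powR// ltry.
- by move=> u _; rewrite lee_fin powR_ge0.
- by apply/measurable_EFinP/measurable_funTS; exact: measurable_powR.
- by rewrite invr_ge0 ltW// Gamma_gt0.
Qed.

Lemma causal_boundedD f g : causal_bounded f -> causal_bounded g ->
  causal_bounded (fun t => f t + g t).
Proof.
move=> [mf f0 bf] [mg g0 bg]; split; first exact: measurable_funD.
- by move=> s s0; rewrite f0// g0// addr0.
- move=> T; have [M1 H1] := bf T; have [M2 H2] := bg T; exists (M1 + M2) => s sT.
  by rewrite (le_trans (ler_normD _ _))// lerD// ?H1 ?H2.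
Qed.

Lemma causal_boundedZ c f : causal_bounded f -> causal_bounded (fun t => c * f t).
Proof.
move=> [mf f0 bf]; split; first exact: measurable_funM.
- by move=> s s0; rewrite f0// mulr0.
- move=> T; have [M HM] := bf T; exists (`|c| * M) => s sT.
  by rewrite normrM ler_wpM2l// HM.
Qed.

Lemma causal_boundedB f g : causal_bounded f -> causal_bounded g ->
  causal_bounded (fun t => f t - g t).
Proof.
move=> cf cg; have := causal_boundedD cf (causal_boundedZ (-1) cg).
by under [X in causal_bounded X -> _]eq_fun do rewrite mulN1r.
Qed.

Lemma causal_bounded_restrict f (D : set R) : measurable D -> causal_bounded f ->
  causal_bounded (f \_ D).
Proof.
move=> mD [mf f0 bf]; split.
- by apply/(measurable_restrictT _ _).1 => //; exact: measurable_funTS.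
- by move=> s s0; rewrite patchE f0//; case: ifP.
- move=> T; have [M HM] := bf T; exists M => s sT; rewrite patchE; case: ifP => _.
    exact: HM.
  by rewrite normr0; exact: le_trans (HM _ sT).
Qed.

Definition heaviside : R -> R := (cst (1 : R)) \_ (`[0, +oo[%classic : set R).

Lemma heavisideE t : 0 <= t -> heaviside t = 1.
Proof. by move=> t0; rewrite /heaviside patchE mem_set//= in_itv/= t0. Qed.

Lemma heaviside_lt0 t : t < 0 -> heaviside t = 0.
Proof.
by move=> t0; rewrite /heaviside patchE memNset//= in_itv/= andbT; apply/negP; rewrite -ltNge.
Qed.

Lemma causal_bounded_heaviside : causal_bounded heaviside.
Proof.
split.
- by apply/(measurable_restrictT _ _).1.
- exact: heaviside_lt0.
- move=> T; exists 1 => s _; have [s0|s0] := leP 0 s.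
    by rewrite heavisideE// normr1.
  by rewrite heaviside_lt0// normr0.
Qed.

Lemma conv_itv k f t : (forall u, u <= 0 -> k u = 0) ->
  (forall s, s < 0 -> f s = 0) ->
  conv k f t = \int[mu]_(s in `[0, t[) (k (t - s) * f s).
Proof.
move=> k0 f0; rewrite [RHS]Rintegral_mkcond; apply: eq_Rintegral => s _.
rewrite patchE; case: ifPn => // /negP; rewrite inE/= in_itv/= => /negP.
rewrite negb_and -!ltNge -leNgt => /orP[s0|ts]; first by rewrite f0// mulr0.
by rewrite k0 ?mul0r// subr_le0.
Qed.

Lemma kernel_reflect k t : causal_kernel k ->
  (\int[mu]_(s in `[0%R, t[) (k (t - s)%R)%:E = \int[mu]_(u in `]0%R, t[) (k u)%:E)%E.
Proof.
move=> [mk k_ge0 k0 _].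
rewrite -integral_itv_obnd_cbnd; last first.
  by apply/measurable_EFinP/measurable_funTS; exact: measurable_fun_reflect.
pose g : R -> R := k \_ (`]0, t[%classic : set R).
have mg : measurable_fun [set: R] g.
  by apply/(measurable_restrictT _ _).1 => //; exact: measurable_funTS.
have g0 u : 0 <= g u by apply: restrict_ge0 => ? _; exact: k_ge0.
rewrite integral_mkcond [RHS]integral_mkcond.
transitivity (\int[mu]_s (g (t - s))%:E)%E.
  apply: eq_integral => s _; rewrite /g !patchE.
  have -> : (s \in (`]0, t[%classic : set R)) = (t - s \in (`]0, t[%classic : set R)).
    by apply/idP/idP; rewrite !inE/= !in_itv/= => /andP[? ?]; apply/andP; split; lra.
  by case: ifP.
rewrite (@ge0_integral_reflect _ (EFin \o g))//.
- by apply: eq_integral => s _; rewrite /g /= !patchE; case: ifP.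
- by apply/measurable_EFinP; exact: mg.
Qed.

Lemma conv_integrable k f t : causal_kernel k -> causal_bounded f ->
  mu.-integrable setT (EFin \o (fun s => k (t - s) * f s)).
Proof.
move=> kk cf; have [mk k_ge0 k0 _] := kk; have [mf f0 bf] := cf.
have [M HM] := bf t.
have mkt : measurable_fun [set: R] (fun s => k (t - s)) by exact: measurable_fun_reflect.
have mkf : measurable_fun [set: R] (fun s => k (t - s) * f s) by exact: measurable_funM.
have ik : mu.-integrable setT (EFin \o ((fun s => k (t - s)) \_ `[0, t[)).
  rewrite -restrict_EFin; apply/integrable_restrict => //; rewrite setTI.
  apply/integrableP; split.
    by apply/measurable_EFinP/measurable_funTS; exact: mkt.
  under eq_integral do rewrite gee0_abs ?lee_fin//.
  by rewrite kernel_reflect//; have [_ _ _] := kk; exact.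
apply: le_integrable (integrableZl measurableT M ik) => //.
- by apply/measurable_EFinP; exact: mkf.
- move=> s _; rewrite /= lee_fin !normrM patchE.
  case: ifPn => [|/negP]; rewrite inE/= in_itv/=.
    move=> /andP[s0 st]; rewrite mulrC ler_wpM2r//.
    by rewrite (le_trans (HM _ (ltW st)))// ler_norm.
  move=> /negP; rewrite negb_and -!ltNge -leNgt => /orP[s0|ts].
    by rewrite f0// normr0 mulr0.
  by rewrite k0 ?subr_le0// normr0 mul0r !mulr0.
Qed.

Lemma convD k f g t : causal_kernel k -> causal_bounded f -> causal_bounded g ->
  conv k (fun s => f s + g s) t = conv k f t + conv k g t.
Proof.
move=> kk cf cg; rewrite -RintegralD//; try exact: conv_integrable.
by apply: eq_Rintegral => s _; rewrite mulrDr.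
Qed.

Lemma convZ k c f t : causal_kernel k -> causal_bounded f ->
  conv k (fun s => c * f s) t = c * conv k f t.
Proof.
move=> kk cf; rewrite -RintegralZl//; last exact: conv_integrable.
by apply: eq_Rintegral => s _; rewrite mulrCA.
Qed.

Lemma convB k f g t : causal_kernel k -> causal_bounded f -> causal_bounded g ->
  conv k (fun s => f s - g s) t = conv k f t - conv k g t.
Proof.
move=> kk cf cg; rewrite -RintegralB//; try exact: conv_integrable.
by apply: eq_Rintegral => s _; rewrite mulrBr.
Qed.

Lemma conv_ge0 k f t : causal_kernel k -> (forall s, s < t -> 0 <= f s) ->
  0 <= conv k f t.
Proof.
move=> [_ k_ge0 k0 _] f0; apply: Rintegral_ge0 => s _.
have [st|ts] := ltP s t; first by rewrite mulr_ge0 ?f0.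
by rewrite k0 ?mul0r// subr_le0.
Qed.

Lemma conv_eq k f g t : (forall u, u <= 0 -> k u = 0) ->
  (forall s, s < t -> f s = g s) -> conv k f t = conv k g t.
Proof.
move=> k0 fg; apply: eq_Rintegral => s _.
have [st|ts] := ltP s t; first by rewrite fg.
by rewrite k0 ?mul0r// subr_le0.
Qed.

Lemma conv_le k f g t : causal_kernel k -> causal_bounded f -> causal_bounded g ->
  (forall s, s < t -> f s <= g s) -> conv k f t <= conv k g t.
Proof.
move=> kk cf cg fg; rewrite -subr_ge0 -convB//; apply: conv_ge0 => // s st.
by rewrite subr_ge0 fg.
Qed.

Lemma conv_lt0 k f t : causal_kernel k -> (forall s, s < 0 -> f s = 0) -> t <= 0 ->
  conv k f t = 0.
Proof.
move=> [_ _ k0 _] f0 t0; rewrite conv_itv// set_itv_ge ?Rintegral_set0// bnd_simp.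
by rewrite -leNgt.
Qed.

Lemma conv_norm_le k f M t : causal_kernel k -> causal_bounded f ->
  (forall s, s < t -> `|f s| <= M) -> `|conv k f t| <= M * conv k heaviside t.
Proof.
move=> kk cf fM; have ch := causal_bounded_heaviside.
have hM s : s < t -> `|f s| <= M * heaviside s.
  move=> st; have [s0|s0] := leP 0 s; first by rewrite heavisideE// mulr1 fM.
  by have [_ f0 _] := cf; rewrite f0// normr0 heaviside_lt0// mulr0.
rewrite -convZ// ler_norml; apply/andP; split.
  rewrite -mulN1r -convZ//; last exact: causal_boundedZ.
  apply: conv_le => //; first by do 2 apply: causal_boundedZ.
  by move=> s /hM; rewrite ler_norml mulN1r => /andP[].
apply: conv_le => //; first exact: causal_boundedZ.
by move=> s /hM; rewrite ler_norml => /andP[].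
Qed.

Lemma conv_heavisideE k t : causal_kernel k ->
  (\int[mu]_(u in `]0%R, t[) (k u)%:E = (conv k heaviside t)%:E)%E.
Proof.
move=> kk; rewrite -kernel_reflect//.
have fin : (\int[mu]_(s in `[0%R, t[) (k (t - s)%R)%:E < +oo)%E.
  by rewrite kernel_reflect//; have [_ _ _] := kk; exact.
have [_ k_ge0 k0 _] := kk.
rewrite conv_itv//; last exact: heaviside_lt0.
rewrite /Rintegral; have -> : (\int[mu]_(s in `[0%R, t[) (k (t - s)%R * heaviside s)%:E =
    \int[mu]_(s in `[0%R, t[) (k (t - s)%R)%:E)%E.
  apply: eq_integral => s; rewrite inE/= in_itv/= => /andP[s0 _].
  by rewrite heavisideE// mulr1.
by rewrite fineK// ge0_fin_numE// integral_ge0// => s _; rewrite lee_fin.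
Qed.

Lemma conv_heaviside_ndecr k s t : causal_kernel k -> s <= t ->
  conv k heaviside s <= conv k heaviside t.
Proof.
move=> kk st; have [mk k_ge0 _ _] := kk.
rewrite -lee_fin -!conv_heavisideE//; apply: ge0_subset_integral => //=.
- by apply/measurable_EFinP/measurable_funTS.
- by move=> u _; rewrite lee_fin.
- by apply: subset_itvl; rewrite bnd_simp.
Qed.

Lemma causal_bounded_conv k f : causal_kernel k -> causal_bounded f ->
  causal_bounded (conv k f).
Proof.
move=> kk cf; have [mk _ _ _] := kk; have [mf f0 bf] := cf; split.
- exact: measurable_conv.
- by move=> s s0; rewrite conv_lt0// ltW.
- move=> T; have [M HM] := bf T.
  have M0 : 0 <= M by exact: le_trans (HM T (lexx T)).
  exists (M * conv k heaviside T) => s sT.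
  rewrite (le_trans (conv_norm_le kk cf (M := M) _))//.
    by move=> u us; apply: HM; exact: le_trans (ltW us) sT.
  by rewrite ler_wpM2l// conv_heaviside_ndecr.
Qed.

Lemma convA k1 k2 k3 f : causal_kernel k1 -> causal_kernel k2 -> causal_kernel k3 ->
  (forall u, \int[mu]_s (k1 (u - s) * k2 s)%:E = (k3 u)%:E)%E ->
  causal_bounded f -> conv k1 (conv k2 f) = conv k3 f.
Proof.
move=> kk1 kk2 kk3 E cf; have [mf _ _] := cf; apply/funext => t.
have [m1 k1_ge0 _ _] := kk1; have [m2 k2_ge0 _ _] := kk2.
by apply: conv_assoc => //; exact: conv_integrable.
Qed.

Lemma conv_fkerA (a b : R) f : 0 < a -> 0 < b -> causal_bounded f ->
  conv (fker a) (conv (fker b) f) = conv (fker (a + b)) f.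
Proof.
move=> a0 b0 cf; apply: convA => //; try exact: fker_kernel.
  by apply: fker_kernel; exact: addr_gt0.
by move=> u; exact: fker_conv.
Qed.

End causal.

(** * Fractional integrals: continuity and Laplace transform *)

Section fractional_integral.
Context {R : realType}.
Notation mu := (@lebesgue_measure R).
Implicit Types (f g x phi : R -> R) (a b t T M l q : R).

Lemma fker1 (u : R) : 0 < u -> fker 1 u = 1.
Proof.
move=> u0; rewrite fkerE// subrr powRr0 mulr1.
suff -> : Gamma 1 = 1 :> R by rewrite invr1.
apply: EFin_inj; rewrite -EFin_Gamma//.
rewrite integral_itv_obnd_cbnd; last first.
  by apply/measurable_EFinP/measurable_funTS; exact: measurable_gamma_integrand.
rewrite -(integral_exponential_pdf (ltr01 : 0 < 1 :> R)) integral_mkcond.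
apply: eq_integral => s _; rewrite /exponential_pdf !patchE; case: ifP => // _.
by rewrite subrr powRr0 !mul1r mulN1r.
Qed.

(** Integration is convolution with [fker 1], so this is [fker_conv] with [b = 1]; the functional
    equation of Gamma is bypassed. *)
Lemma fkerS a t : 0 < a -> (\int[mu]_(u in `]0%R, t[) (fker a u)%:E = (fker (a + 1) t)%:E)%E.
Proof.
move=> a0; rewrite -fker_conv// integral_mkcond.
transitivity (\int[mu]_s (fker a s * fker 1 (t - s))%:E)%E.
  apply: eq_integral => s _; rewrite patchE; case: ifPn => [|/negP].
    by rewrite inE/= in_itv/= => /andP[s0 st]; rewrite fker1 ?subr_gt0// mulr1.
  rewrite inE/= in_itv/= => /negP; rewrite negb_and -!leNgt => /orP[s0|ts].
    by rewrite (fker_le0 a)// mul0r.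
  by rewrite (fker_le0 1) ?mulr0// subr_le0.
have mg : measurable_fun [set: R] (fun s => fker a s * fker 1 (t - s)).
  apply: measurable_funM; first exact: measurable_fker.
  by apply: measurable_fun_reflect; exact: measurable_fker.
rewrite -(@ge0_integral_reflect _ _ t); last 2 first.
- by apply/measurable_EFinP; exact: mg.
- by move=> s; rewrite lee_fin mulr_ge0 ?fker_ge0.
by apply: eq_integral => s _; rewrite /= opprB addrCA subrr addr0.
Qed.

Lemma conv_fker_heaviside a : 0 < a -> conv (fker a) heaviside = fker (a + 1).
Proof.
move=> a0; apply/funext => t; apply: EFin_inj.
by rewrite -conv_heavisideE ?fkerS//; exact: fker_kernel.
Qed.

Lemma conv_fker1 f t : (forall s, s < 0 -> f s = 0) ->
  conv (fker 1) f t = \int[mu]_(s in `[0, t[) f s.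
Proof.
move=> f0; rewrite conv_itv//; last exact: fker_le0.
by apply: eq_Rintegral => s; rewrite inE/= in_itv/= => /andP[_ st]; rewrite fker1 ?mul1r ?subr_gt0.
Qed.

Lemma fker_nincr a s t : 0 < a <= 1 -> 0 < s -> s <= t -> fker a t <= fker a s.
Proof.
move=> /andP[a0 a1] s0 st; have t0 : 0 < t by exact: lt_le_trans st.
rewrite !fkerE//; apply: ler_wpM2l; first by rewrite invr_ge0 ltW// Gamma_gt0.
have -> : a - 1 = - (1 - a) by rewrite opprB.
rewrite !powRN lef_pV2 ?posrE ?powR_gt0//.
by apply: ge0_ler_powR; rewrite ?subr_ge0// nnegrE ltW.
Qed.

Lemma fkerS_ndecr a s t : 0 < a -> s <= t -> fker (a + 1) s <= fker (a + 1) t.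
Proof.
move=> a0 st; rewrite -conv_fker_heaviside//; apply: conv_heaviside_ndecr => //.
exact: fker_kernel.
Qed.

Lemma causal_bounded_shift s : 0 <= s -> causal_bounded (fun u : R => @heaviside R (u - s)).
Proof.
move=> s0; have [mh _ _] := @causal_bounded_heaviside R; split.
- by apply: measurableT_comp => //; exact: measurable_funB.
- by move=> u u0; rewrite heaviside_lt0//; lra.
- move=> T; exists 1 => u _; have [us|us] := leP 0 (u - s).
    by rewrite heavisideE// normr1.
  by rewrite heaviside_lt0// normr0.
Qed.

Lemma conv_fker_shift a s t : 0 < a -> 0 <= s ->
  conv (fker a) (fun u : R => @heaviside R (u - s)) t = fker (a + 1) (t - s).
Proof.
move=> a0 s0; have [mh _ _] := @causal_bounded_heaviside R.
rewrite -conv_fker_heaviside//; congr fine.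
rewrite -[RHS](@ge0_integral_shift _ _ (- s)).
- by apply: eq_integral => u _ /=; congr (fker _ _ * _)%:E; ring.
- apply/measurable_EFinP/measurable_funM => //.
  by apply: measurable_fun_reflect; exact: measurable_fker.
- move=> u; rewrite lee_fin mulr_ge0 ?fker_ge0//.
  by apply: restrict_ge0 => ? _; exact: ler01.
Qed.

(** For [a <= 1] the kernel is nonincreasing, so the absolute difference of its two translates has a
    known sign before [s] and can be integrated exactly. *)
Lemma conv_fker_holder a f M s t : 0 < a <= 1 -> causal_bounded f -> s <= t ->
  (forall u, u < t -> `|f u| <= M) ->
  `|conv (fker a) f t - conv (fker a) f s| <= 2 * M * fker (a + 1) (t - s).
Proof.
move=> a01 cf st fM; have /andP[a0 a1] := a01; have kk := fker_kernel a0.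
have M0 : 0 <= M.
  by have := fM (t - 1); rewrite ltrBlDr ltrDl ltr01 => /(_ isT); exact: le_trans.
have [mf f0 _] := cf.
have k2n u v : u <= v -> fker (a + 1) u <= fker (a + 1) v.
  exact: fkerS_ndecr.
have [s0|s0] := leP s 0.
  rewrite (conv_lt0 kk f0 s0) subr0 (le_trans (conv_norm_le kk cf fM))//.
  rewrite conv_fker_heaviside// -mulrA mulrCA ler_wpM2l//.
  have : fker (a + 1) t <= fker (a + 1) (t - s) by apply: k2n; lra.
  have := @fker_ge0 R (a + 1) (t - s) (addr_gt0 a0 ltr01); lra.
pose hs : R -> R := fun u => heaviside (u - s).
have chs : causal_bounded hs by apply: causal_bounded_shift; exact: ltW.
have chsE : conv (fker a) hs t = fker (a + 1) (t - s) by apply: conv_fker_shift => //; exact: ltW.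
have i1 u g : causal_bounded g -> mu.-integrable setT (EFin \o (fun v => fker a (u - v) * g v)).
  by move=> cg; exact: conv_integrable.
have ch := @causal_bounded_heaviside R.
rewrite -RintegralB//; try exact: i1.
apply: (le_trans (le_normr_Rintegral _ _)) => //.
  by have := integrableB measurableT (i1 t _ cf) (i1 s _ cf); apply: eq_integrable.
(* This majorant contains no absolute value. Before [s] it is the difference of the kernels; between
   [s] and [t] the first kernel is 0 and the doubled term turns minus the second kernel into plus.
   Its integral is explicit. *)
pose G u := M * (fker a (s - u) * heaviside u - fker a (t - u) * heaviside u
    + 2 * (fker a (t - u) * hs u)).
have iG0 : mu.-integrable setT (EFin \o (fun u => fker a (s - u) * heaviside u - fker a (t - u) * heaviside u)).
  by have := integrableB measurableT (i1 s _ ch) (i1 t _ ch); apply: eq_integrable.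
have iG1 : mu.-integrable setT (EFin \o (fun u => 2 * (fker a (t - u) * hs u))).
  by have := integrableZl measurableT 2 (i1 t _ chs); apply: eq_integrable.
have iG2 : mu.-integrable setT (EFin \o (fun u => fker a (s - u) * heaviside u - fker a (t - u) * heaviside u
    + 2 * (fker a (t - u) * hs u))).
  by have := integrableD measurableT iG0 iG1; apply: eq_integrable.
have iG : mu.-integrable setT (EFin \o G).
  by have := integrableZl measurableT M iG2; apply: eq_integrable.
apply: (@le_trans _ _ (\int[mu]_u G u)).
  apply: le_Rintegral => //.
    have := integrableB measurableT (i1 t _ cf) (i1 s _ cf).
    by move/integrable_abse; apply: eq_integrable.
  move=> u _; rewrite /G -mulrBl normrM mulrC.
  have [u0|u0] := ltP u 0.
    by rewrite f0// normr0 mul0r /hs !heaviside_lt0//; lra.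
  rewrite heavisideE// !mulr1.
  have [us|su] := ltP u s.
    rewrite /hs heaviside_lt0 ?subr_lt0// !mulr0 addr0 ler_pM//.
      by apply: fM; exact: lt_le_trans st.
    rewrite ler0_norm ?opprB// subr_le0; apply: fker_nincr => //; lra.
  rewrite /hs heavisideE ?subr_ge0// mulr1 (fker_le0 a (u := s - u)) ?subr_le0//.
  have [ut|tu] := ltP u t; last first.
    by rewrite (fker_le0 a (u := t - u)) ?subr_le0// !subr0 normr0 !mulr0 addr0 mulr0.
  have -> : `|fker a (t - u) - 0| = fker a (t - u) by rewrite subr0 ger0_norm ?fker_ge0.
  rewrite [X in M * X](_ : _ = fker a (t - u)); last by ring.
  by rewrite ler_wpM2r ?fker_ge0// fM.
rewrite RintegralZl// RintegralD// RintegralB//; try exact: i1.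
rewrite RintegralZl//; last exact: i1.
rewrite -/(conv (fker a) heaviside s) -/(conv (fker a) heaviside t) -/(conv (fker a) hs t).
rewrite chsE conv_fker_heaviside// -mulrA mulrCA ler_wpM2l//.
have := k2n _ _ st; lra.
Qed.

Lemma continuous_conv_fker a f : 0 < a <= 1 -> causal_bounded f ->
  continuous (conv (fker a) f).
Proof.
move=> a01 cf t0; have /andP[a0 a1] := a01; have [_ _ /(_ (t0 + 1))[M HM]] := cf.
have M0 : 0 <= M by apply: (le_trans (normr_ge0 _) (HM t0 _)); rewrite lerDl.
have Ma : 0 < 2 * M + 1 by lra.
have aS : 0 < a + 1 by exact: addr_gt0.
have G0 : 0 < Gamma (a + 1) by exact: Gamma_gt0.
apply/cvgrPdist_le => e e0.
(* The solution of [(2 M + 1) d^a / Gamma (a + 1) = e]; adding 1 to [2 M] avoids a division by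
   zero. *)
pose d := (e * Gamma (a + 1) / (2 * M + 1)) `^ a^-1.
have d0 : 0 < d by rewrite powR_gt0// divr_gt0// mulr_gt0.
have kd u : 0 <= u -> u <= d -> 2 * M * fker (a + 1) u <= e.
  rewrite le_eqVlt => /predU1P[<- _|u0 ud]; first by rewrite fker_le0// mulr0 ltW.
  rewrite fkerE// addrK.
  have : u `^ a <= e * Gamma (a + 1) / (2 * M + 1).
    have -> : e * Gamma (a + 1) / (2 * M + 1) = d `^ a.
      by rewrite /d -powRrM mulVf ?gt_eqF// powRr1// divr_ge0 ?mulr_ge0// ltW.
    by apply: ge0_ler_powR => //; rewrite ?nnegrE ltW.
  rewrite ler_pdivlMr// => H.
  rewrite mulrCA -ler_pdivlMl ?invr_gt0// invrK.
  have := powR_ge0 u a; nra.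
near=> t.
have td : `|t0 - t| <= Num.min d 1 by near: t; apply: cvgr_dist_le => //; rewrite lt_min d0/=.
move: td; rewrite le_min => /andP[td t1].
have fM (v : R) : v <= t0 + 1 -> forall u : R, u < v -> `|f u| <= M.
  by move=> vt u uv; apply: HM; exact: le_trans (ltW uv) vt.
have [tt|tt] := leP t t0.
  rewrite (le_trans (conv_fker_holder a01 cf tt (fM t0 _)))//.
    by rewrite lerDl.
  by apply: kd; rewrite ?subr_ge0//; move: td; rewrite ger0_norm// subr_ge0.
have t01 : t <= t0 + 1 by move: t1; rewrite ler_norml => /andP[]; lra.
rewrite distrC (le_trans (conv_fker_holder a01 cf (ltW tt) (fM t t01)))//.
apply: kd; first by rewrite subr_ge0 ltW.
by move: td; rewrite distrC ger0_norm// subr_ge0 ltW.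
Unshelve. all: by end_near. Qed.

Definition laplace l f : R := \int[mu]_s (expR (- (l * s)) * f s).

Lemma laplace_conv_fker a l f M : 0 < a -> 0 < l -> causal_bounded f ->
  (forall s, `|f s| <= M) -> laplace l (conv (fker a) f) = l `^ (- a) * laplace l f.
Proof.
move=> a0 l0 cf fM; have [mf f0 _] := cf.
pose e (g : R -> R) (s : R) := expR (- (l * s)) * g s.
have me g : measurable_fun [set: R] g -> measurable_fun [set: R] (e g).
  move=> mg; apply: measurable_funM => //.
  apply: measurableT_comp; first exact: measurable_expR.
  by apply: measurableT_comp => //; exact: measurable_funM.
have ief : mu.-integrable setT (EFin \o e f).
  have ip := integrableZl measurableT (M / l) (integrable_exponential_pdf l0).
  apply: le_integrable ip => //.
    by apply/measurable_EFinP; exact: me.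
  move=> s _; rewrite /= lee_fin /e normrM ger0_norm ?expR_ge0//.
  have [s0|s0] := ltP s 0; first by rewrite f0// normr0 mulr0.
  rewrite exponential_pdfE// (_ : M / l * _ = M * expR (- (l * s))); last first.
    by rewrite mulNr; field; rewrite gt_eqF.
  rewrite normrM [`|expR _|]ger0_norm ?expR_ge0// mulrC ler_wpM2r ?expR_ge0//.
  exact: le_trans (fM s) (ler_norm _).
(* Convolution with the constant 1, taken at 0, is the total integral; the transform of a
   convolution thereby becomes an instance of associativity. *)
have H := @conv_assoc R (fun=> 1) (e (fker a)) (fun=> l `^ (- a)) (e f) 0.
transitivity (conv (fun=> 1) (conv (e (fker a)) (e f)) 0).
  apply: eq_Rintegral => s _; rewrite mul1r /conv -RintegralZl//.
    apply: eq_Rintegral => u _; rewrite /e mulrACA -expRD; congr (expR _ * _).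
    ring.
  by apply: conv_integrable => //; exact: fker_kernel.
rewrite H.
- by rewrite /conv RintegralZl.
- exact: measurable_cst.
- by [].
- by apply: me; exact: measurable_fker.
- by move=> u; rewrite mulr_ge0 ?expR_ge0 ?fker_ge0.
- exact: me.
- move=> u; rewrite -laplace_fker//; apply: eq_integral => s _.
  by rewrite mul1r mulrC.
- exact: (integrableZl measurableT (l `^ (- a)) ief).
Qed.

End fractional_integral.

(** * Solutions as solutions of Volterra equations *)

Section volterra.
Context {R : realType}.
Notation mu := (@lebesgue_measure R).
Implicit Types (f g x y phi : R -> R) (a b t T M l q : R).

Lemma conv_itv_oo k f t : causal_kernel k -> causal_bounded f ->
  conv k f t = \int[mu]_(s in `]0, t[) (k (t - s) * f s).
Proof.
move=> kk cf; have [_ _ k0 _] := kk; have [_ f0 _] := cf.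
rewrite conv_itv// Rintegral_itv_obnd_cbnd//.
have := conv_integrable t kk cf; apply: integrableS => //.
Qed.

Lemma integral_derive1 x t : caputo_regular x -> 0 < t ->
  \int[mu]_(s in `]0, t[) derive1 x s = x t - x 0.
Proof.
move=> [cx dx cdx ix] t0; apply: Rintegral_FTC_at0 => //.
- by move=> s s0; split => //; exact: dx.
- by have /continuous_within_itvcyP[_] := cx.
- exact: ix.
Qed.

Lemma conv_of_derive1 k x t : (forall u, u <= 0 -> k u = 0) ->
  conv k (derive1 x \_ `]0, +oo[) t = \int[mu]_(s in `]0, t[) (k (t - s) * derive1 x s).
Proof.
move=> k0; rewrite [RHS]Rintegral_mkcond; apply: eq_Rintegral => s _.
rewrite !patchE; case: (ltP 0 s) => s0; last first.
  rewrite memNset ?mulr0 ?memNset//= in_itv/= ?andbT; apply/negP; rewrite ?negb_and -?leNgt ?s0//.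
rewrite [X in if X then _ else _]mem_set/=; last by rewrite in_itv/= s0.
case: (ltP s t) => st; first by rewrite mem_set//= in_itv/= s0.
rewrite k0 ?subr_le0// mul0r; by case: ifP.
Qed.

(** Integrability is not assumed: a positive factor scales the positive and negative parts
    separately, and [fine] sends infinite values to 0 on both sides. *)
Lemma RintegralZl_gt0 (D : set R) c f : measurable D -> measurable_fun D f -> 0 < c ->
  \int[mu]_(s in D) (c * f s) = c * \int[mu]_(s in D) f s.
Proof.
move=> mD mf c0.
have mE : measurable_fun D (EFin \o f) by exact/measurable_EFinP.
have EZ (a b : \bar R) : (0 <= a -> 0 <= b -> c%:E * a - c%:E * b = c%:E * (a - b))%E.
  case: a => [a||]//; case: b => [b||]// _ _.
  - exact: (congr1 EFin (esym (mulrBr c a b))).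
  - by rewrite gt0_muley ?lte_fin//= gt0_muleNy ?lte_fin.
  - by rewrite gt0_muley ?lte_fin//= gt0_muley ?lte_fin.
  - by rewrite gt0_muley ?lte_fin//= gt0_muleNy ?lte_fin.
have -> : \int[mu]_(s in D) (c * f s) = fine (c%:E * \int[mu]_(s in D) (f s)%:E)%E.
  rewrite /Rintegral; congr fine.
  rewrite -[LHS]/(\int[mu]_(s in D) (fun s => c%:E * (EFin \o f) s) s)%E.
  rewrite [LHS]integralE (ge0_funeposM _ (ltW c0)) (ge0_funenegM _ (ltW c0)).
  rewrite !ge0_integralZl_EFin ?ltW//; last 2 first.
  - exact: measurable_funeneg.
  - exact: measurable_funepos.
  by rewrite EZ ?integral_ge0// [in RHS]integralE.
rewrite /Rintegral; case: (integral _ _ _) => [r||] //=.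
- by rewrite gt0_muley ?lte_fin//= mulr0.
- by rewrite gt0_muleNy ?lte_fin//= mulr0.
Qed.

(* [caputo q x] is the convolution of [fker (1 - q)] with the derivative of [x];
   convolving with [fker q] leaves the integral of that derivative. *)
Lemma caputo_volterra q x phi : 0 < q <= 1 -> caputo_regular x ->
  causal_bounded phi -> (forall t, 0 < t -> caputo q x t = phi t) ->
  forall t, 0 <= t -> x t = x 0 + conv (fker q) phi t.
Proof.
move=> /andP[q0 q1] rx cphi E t; have kq := fker_kernel q0.
have [mphi phi0 bphi] := cphi.
rewrite le_eqVlt => /predU1P[<-|t0]; first by rewrite conv_lt0 ?addr0.
suff : \int[mu]_(s in `]0, t[) derive1 x s = conv (fker q) phi t.
  by rewrite integral_derive1// => <-; rewrite addrC subrK.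
move: E; have [->|qn1] := eqVneq q 1 => E.
  rewrite conv_itv_oo//; last exact: fker_kernel.
  apply: eq_Rintegral => s; rewrite inE/= in_itv/= => /andP[s0 st].
  by rewrite fker1 ?subr_gt0// mul1r -E// /caputo eqxx.
have q1' : 0 < 1 - q by rewrite subr_gt0 lt_neqAle qn1.
have [_ _ cdx ix] := rx.
(* The derivative may be unbounded near 0, so [u] need not be [causal_bounded]; associativity is
   therefore taken from [conv_assoc], with integrability supplied by [ix]. *)
pose u : R -> R := derive1 x \_ `]0, +oo[.
have mu0 : measurable_fun [set: R] u.
  apply/(measurable_restrictT _ _).1 => //.
  apply: open_continuous_measurable_fun => //.
  by move=> s /[!inE]/=; rewrite in_itv/= andbT; exact: cdx.
have E' s : 0 < s -> conv (fker (1 - q)) u s = phi s.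
  move=> s0; rewrite -E// /caputo (negbTE qn1) conv_of_derive1; last exact: fker_le0.
  rewrite -RintegralZl_gt0//; last by rewrite invr_gt0 Gamma_gt0.
    apply: eq_Rintegral => v; rewrite inE/= in_itv/= => /andP[v0 vs].
    by rewrite fkerE ?subr_gt0// mulrA (_ : 1 - q - 1 = - q)//; ring.
  apply: measurable_funM; last by apply/measurable_EFinP; exact: measurable_int (ix _ s0).
  apply: measurable_funTS; apply: (@measurable_fun_reflect R s (fun v => v `^ (- q))).
  exact: measurable_powR.
have cc : causal_bounded (conv (fker (1 - q)) u).
  split.
  - apply: measurable_conv => //; exact: measurable_fker.
  - move=> s s0; rewrite conv_of_derive1; last exact: fker_le0.
    by rewrite set_itv_ge ?Rintegral_set0// bnd_simp -leNgt ltW.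
  - move=> T; have [M HM] := bphi T; exists M => s sT.
    have [s0|s0] := ltP 0 s; first by rewrite E'// HM.
    rewrite conv_of_derive1; last exact: fker_le0.
    rewrite set_itv_ge ?Rintegral_set0 ?normr0; first exact: le_trans (HM _ sT).
    by rewrite bnd_simp -leNgt.
transitivity (conv (fker 1) u t).
  rewrite conv_of_derive1; last exact: fker_le0.
  apply: eq_Rintegral => s; rewrite inE/= in_itv/= => /andP[s0 st].
  by rewrite fker1 ?subr_gt0// mul1r.
transitivity (conv (fker q) (conv (fker (1 - q)) u) t); last first.
  rewrite !conv_itv_oo//; apply: eq_Rintegral => s.
  by rewrite inE/= in_itv/= => /andP[s0 st]; rewrite E'.
symmetry; apply: conv_assoc => //.
- exact: measurable_fker.
- by move=> s; exact: fker_ge0.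
- exact: measurable_fker.
- by move=> s; exact: fker_ge0.
- by move=> s; rewrite fker_conv// addrC subrK.
- have iu : mu.-integrable setT ((EFin \o derive1 x) \_ (`]0, t[%classic : set R)).
    by apply/integrable_restrict => //; rewrite setTI; exact: ix.
  apply: eq_integrable iu => // s _; rewrite /u /= !patchE.
  case: (ltP 0 s) => s0; last first.
    by rewrite memNset ?memNset ?mulr0//= in_itv/= ltNge s0.
  rewrite [X in _ = (_ * (if X then _ else _))%:E]mem_set/=; last by rewrite in_itv/= s0.
  case: (ltP s t) => st.
    by rewrite mem_set/= ?in_itv/= ?s0// fker1 ?subr_gt0// mul1r.
  by rewrite fker_le0 ?subr_le0// mul0r memNset//= in_itv/= s0 ltNge st.
Qed.

Lemma causal_bounded_solution x : caputo_regular x ->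
  causal_bounded (x \_ `[0, +oo[).
Proof.
move=> [cx _ _ _]; split.
- apply/(measurable_restrictT _ _).1 => //.
  exact: subspace_continuous_measurable_fun.
- move=> s s0; rewrite patchE memNset//= in_itv/= andbT; apply/negP.
  by rewrite -ltNge.
- move=> T; have [T0|T0] := ltP 0 T; last first.
    exists `|x 0| => s sT; rewrite patchE; case: ifP; rewrite ?normr0//.
    rewrite inE/= in_itv/= andbT => s0.
    by rewrite (_ : s = 0)//; apply/eqP; rewrite eq_le s0 (le_trans sT).
  have cxT : {within `[0, T], continuous x}.
    by apply: continuous_subspaceW cx; apply: subset_itvl.
  have [c1 _ H1] := EVT_max (ltW T0) cxT.
  have [c2 _ H2] := EVT_min (ltW T0) cxT.
  exists (`|x c1| + `|x c2|) => s sT; rewrite patchE; case: ifP => [|_]; last first.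
    by rewrite normr0 addr_ge0.
  rewrite inE/= in_itv/= andbT => s0.
  have := H1 s; have := H2 s; rewrite in_itv/= s0 sT => /(_ isT) h2 /(_ isT) h1.
  have := ler_norm (x c1); have := ler_norm (- x c2); rewrite normrN.
  have := normr_ge0 (x c1); have := normr_ge0 (x c2).
  rewrite ler_norml; lra.
Qed.

Lemma solution_volterra (A : 'M[R]_2) q1 q2 (x0 y0 : R) x y :
  0 < q1 <= 1 -> 0 < q2 <= 1 -> is_solution A q1 q2 x0 y0 x y ->
  exists X Y, [/\ causal_bounded X, causal_bounded Y,
    forall t, 0 <= t -> x t = X t /\ y t = Y t,
    forall t, X t = x0 * heaviside t +
      conv (fker q1) (fun s => A 0 0 * X s + A 0 1 * Y s) t &
    forall t, Y t = y0 * heaviside t +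
      conv (fker q2) (fun s => A 1 0 * X s + A 1 1 * Y s) t].
Proof.
move=> hq1 hq2 [rx ry x00 y00 E].
pose X : R -> R := x \_ `[0, +oo[; pose Y : R -> R := y \_ `[0, +oo[.
have cX := causal_bounded_solution rx; have cY := causal_bounded_solution ry.
have XE f t : 0 <= t -> (f \_ `[0, +oo[) t = f t.
  by move=> t0; rewrite patchE mem_set//= in_itv/= t0.
have X0 f t : t < 0 -> (f \_ `[0, +oo[) t = 0 :> R.
  by move=> t0; rewrite patchE memNset//= in_itv/= andbT; apply/negP; rewrite -ltNge.
have cb c d : causal_bounded (fun s => c * X s + d * Y s).
  by apply: causal_boundedD; exact: causal_boundedZ.
exists X, Y; split => //.
- by move=> t t0; rewrite /X /Y !XE.
- move=> t; have [t0|t0] := leP 0 t; last first.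
    rewrite /X X0// heaviside_lt0// mulr0 add0r conv_lt0 ?ltW//.
      by apply: fker_kernel; case/andP: hq1.
    by have [] := cb (A 0 0) (A 0 1).
  rewrite heavisideE// mulr1 /X XE// -x00; apply: caputo_volterra => // s s0.
  by have [-> _] := E s s0; rewrite /X /Y !XE// ltW.
- move=> t; have [t0|t0] := leP 0 t; last first.
    rewrite /Y X0// heaviside_lt0// mulr0 add0r conv_lt0 ?ltW//.
      by apply: fker_kernel; case/andP: hq2.
    by have [] := cb (A 1 0) (A 1 1).
  rewrite heavisideE// mulr1 /Y XE// -y00; apply: caputo_volterra => // s s0.
  by have [_ ->] := E s s0; rewrite /X /Y !XE// ltW.
Qed.

Lemma laplace_integrable l f M : 0 < l -> causal_bounded f ->
  (forall s, `|f s| <= M) ->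
  mu.-integrable setT (EFin \o (fun s => expR (- (l * s)) * f s)).
Proof.
move=> l0 [mf f0 _] fM.
have ip := integrableZl measurableT (M / l) (integrable_exponential_pdf l0).
apply: le_integrable ip => //.
  apply/measurable_EFinP; apply: measurable_funM => //.
  apply: measurableT_comp; first exact: measurable_expR.
  by apply: measurableT_comp => //; exact: measurable_funM.
move=> s _; rewrite /= lee_fin normrM ger0_norm ?expR_ge0//.
have [s0|s0] := ltP s 0; first by rewrite f0// normr0 mulr0.
rewrite exponential_pdfE// (_ : M / l * _ = M * expR (- (l * s))); last first.
  by rewrite mulNr; field; rewrite gt_eqF.
rewrite normrM [`|expR _|]ger0_norm ?expR_ge0// mulrC ler_wpM2r ?expR_ge0//.
exact: le_trans (fM s) (ler_norm _).
Qed.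

Lemma laplace_heaviside l : 0 < l -> laplace l heaviside = l^-1.
Proof.
move=> l0; apply: EFin_inj.
rewrite -[RHS]mule1 -(integral_exponential_pdf l0) -ge0_integralZl//.
- rewrite /laplace /Rintegral fineK; last first.
    apply: integrable_fin_num => //; apply: (@laplace_integrable _ _ 1) => //.
      exact: causal_bounded_heaviside.
    move=> s; have [s0|s0] := leP 0 s; first by rewrite heavisideE// normr1.
    by rewrite heaviside_lt0// normr0.
  apply: eq_integral => s _; have [s0|s0] := ltP s 0.
    by rewrite heaviside_lt0// mulr0 lt0_exponential_pdf// mule0.
  by rewrite heavisideE// exponential_pdfE// -EFinM mulKf ?gt_eqF// mulr1 mulNr.
- by apply/measurable_EFinP; exact: measurable_exponential_pdf.
- by move=> s _; rewrite lee_fin exponential_pdf_ge0// ltW.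
- by rewrite lee_fin invr_ge0 ltW.
Qed.

Lemma laplaceD l f g M : 0 < l -> causal_bounded f -> causal_bounded g ->
  (forall s, `|f s| <= M) -> (forall s, `|g s| <= M) -> forall c d : R,
  laplace l (fun s => c * f s + d * g s) = c * laplace l f + d * laplace l g.
Proof.
move=> l0 cf cg fM gM c d.
have i1 := laplace_integrable l0 cf fM; have i2 := laplace_integrable l0 cg gM.
rewrite /laplace -!RintegralZl// -RintegralD//.
- by apply: eq_Rintegral => s _; ring.
- exact: (integrableZl measurableT c i1).
- exact: (integrableZl measurableT d i2).
Qed.

Lemma laplace_volterra l q (x0 c d M : R) f g h : 0 < l -> 0 < q -> causal_bounded f ->
  causal_bounded g -> causal_bounded h ->
  (forall s, `|f s| <= M) -> (forall s, `|g s| <= M) -> (forall s, `|h s| <= M) ->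
  (forall t, h t = x0 * heaviside t + conv (fker q) (fun s => c * f s + d * g s) t) ->
  l `^ q * laplace l h = l `^ q / l * x0 + (c * laplace l f + d * laplace l g).
Proof.
move=> l0 q0 cf cg ch fM gM hM E.
have M0 : 0 <= M by exact: le_trans (fM 0).
have cfg : causal_bounded (fun s => c * f s + d * g s).
  by apply: causal_boundedD; exact: causal_boundedZ.
have fgM s : `|c * f s + d * g s| <= (`|c| + `|d|) * M.
  by rewrite (le_trans (ler_normD _ _))// !normrM mulrDl lerD// ler_wpM2l.
have bh s : `|@heaviside R s| <= 1.
  have [s0|s0] := leP 0 s; first by rewrite heavisideE// normr1.
  by rewrite heaviside_lt0// normr0.
have chv := @causal_bounded_heaviside R.
have := laplace_conv_fker q0 l0 cfg fgM; rewrite (laplaceD l0 cf cg fM gM).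
have -> : conv (fker q) (fun s => c * f s + d * g s) =
    (fun s => 1 * h s + (- x0) * heaviside s).
  by apply/funext => s; rewrite E; ring.
have hM1 s : `|h s| <= M + 1 by rewrite (le_trans (hM s))// lerDl.
have bh1 s : `|@heaviside R s| <= M + 1 by rewrite (le_trans (bh s))// lerDr.
rewrite (laplaceD l0 ch chv hM1 bh1) laplace_heaviside// mul1r mulNr => E2.
have -> : laplace l h = x0 / l + l `^ (- q) * (c * laplace l f + d * laplace l g).
  by rewrite -E2; ring.
by rewrite powRN mulrDr mulVKf ?gt_eqF ?powR_gt0//; ring.
Qed.

(* If solutions with small data are bounded, their Laplace transforms at [l] solve a
   singular linear system, which constrains the initial data. *)
Lemma root_unstable (A : 'M[R]_2) q1 q2 l :
  0 < q1 <= 1 -> 0 < q2 <= 1 ->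
  (forall x0 y0 : R, exists x y, is_solution A q1 q2 x0 y0 x y) -> 0 < l ->
  (l `^ q1 - A 0 0) * (l `^ q2 - A 1 1) = A 0 1 * A 1 0 ->
  unstable A q1 q2.
Proof.
move=> hq1 hq2 ex l0 root st.
have /andP[q10 _] := hq1; have /andP[q20 _] := hq2.
have [eta eta0 Heta] := st 1 ltr01.
have key (x0 y0 : R) : norm2 x0 y0 < eta -> exists X Y : R,
    (l `^ q1 - A 0 0) * X - A 0 1 * Y = l `^ q1 / l * x0 /\
    (l `^ q2 - A 1 1) * Y - A 1 0 * X = l `^ q2 / l * y0.
  move=> n0; have [x [y sol]] := ex x0 y0.
  have [X [Y [cX cY xX EX EY]]] := solution_volterra hq1 hq2 sol.
  have bXY t : `|X t| <= 1 /\ `|Y t| <= 1.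
    have [t0|t0] := ltP t 0.
      have [_ X0 _] := cX; have [_ Y0 _] := cY.
      by rewrite X0// Y0// normr0.
    have := Heta _ _ _ _ sol n0 t t0; have [-> ->] := xX t t0.
    rewrite /norm2 => n1; split; apply: le_trans n1; rewrite -sqrtr_sqr ler_wsqrtr//.
      by rewrite lerDl sqr_ge0.
    by rewrite lerDr sqr_ge0.
  have bX t := (bXY t).1; have bY t := (bXY t).2.
  have L1 := laplace_volterra l0 q10 cX cY cX bX bY bX EX.
  have L2 := laplace_volterra l0 q20 cX cY cY bX bY bY EY.
  exists (laplace l X), (laplace l Y); split.
    by rewrite mulrBl L1; ring.
  by rewrite mulrBl L2; ring.
pose c := eta / 2.
have c0 : 0 < c by rewrite divr_gt0.
have n1 : norm2 c 0 < eta.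
  by rewrite /norm2 expr0n/= addr0 sqrtr_sqr ger0_norm ?ltW// /c; lra.
have n2 : norm2 0 c < eta.
  by rewrite /norm2 expr0n/= add0r sqrtr_sqr ger0_norm ?ltW// /c; lra.
have [X1 [Y1 [E1 E2]]] := key _ _ n1; have [X2 [Y2 [E3 E4]]] := key _ _ n2.
rewrite mulr0 in E2; rewrite mulr0 in E3.
set p1 := l `^ q1 - _ in root E1 E3; set p2 := l `^ q2 - _ in root E2 E4.
set d1 := _ / l * c in E1; set d2 := _ / l * c in E4.
have d10 : d1 != 0 by rewrite gt_eqF// mulr_gt0// divr_gt0// powR_gt0.
have d20 : d2 != 0 by rewrite gt_eqF// mulr_gt0// divr_gt0// powR_gt0.
(* Cramer's rule: [p2] times the first equation plus [A 0 1] times the second has a vanishing left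
   side by [root], and leaves [p2 * d1 = 0]. The initial values with the other component zero give
   [p1 = 0] in the same way. *)
have p2z : p2 = 0.
  apply/eqP; have /eqP : p2 * d1 = 0.
    rewrite -E1 (_ : _ * _ = p1 * p2 * X1 - A 0 1 * (p2 * Y1)); last by ring.
    by rewrite root (_ : p2 * Y1 = A 1 0 * X1); [ring|apply/eqP; rewrite -subr_eq0 E2].
  by rewrite mulf_eq0 (negbTE d10) orbF.
have p1z : p1 = 0.
  apply/eqP; have /eqP : p1 * d2 = 0.
    rewrite -E4 (_ : _ * _ = p1 * p2 * Y2 - A 1 0 * (p1 * X2)); last by ring.
    by rewrite root (_ : p1 * X2 = A 0 1 * Y2); [ring|apply/eqP; rewrite -subr_eq0 E3].
  by rewrite mulf_eq0 (negbTE d20) orbF.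
(* Now an off-diagonal coefficient vanishes too, and the equation containing it reads [0 = d1] or
   [0 = d2]. *)
rewrite p1z mul0r in root; move/esym/eqP: root; rewrite mulf_eq0 => /orP[]/eqP a0.
  by move/eqP: d10; apply; rewrite -E1 p1z a0; ring.
by move/eqP: d20; apply; rewrite -E4 p2z a0; ring.
Qed.
End volterra.

(** * Existence of solutions *)

Section power_sums.
Context {R : realType}.
Notation mu := (@lebesgue_measure R).
Implicit Types (a b c q s t T C : R) (l : seq (R * R)).

(* The list of the pairs [(c, e)] encodes the sum of the functions [c * fker e]. *)
Definition psum l (t : R) : R := \sum_(p <- l) p.1 * fker p.2 t.
Definition pscale c l := [seq (c * p.1, p.2) | p <- l].
Definition pshift a l := [seq (p.1, p.2 + a) | p <- l].
Definition pnorm l : R := \sum_(p <- l) `|p.1|.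

Lemma psum_cat l1 l2 t : psum (l1 ++ l2) t = psum l1 t + psum l2 t.
Proof. by rewrite /psum big_cat. Qed.

Lemma psum_scale c l t : psum (pscale c l) t = c * psum l t.
Proof. by rewrite /psum big_map mulr_sumr; apply: eq_bigr => p _; rewrite mulrA. Qed.

Lemma pnorm_cat l1 l2 : pnorm (l1 ++ l2) = pnorm l1 + pnorm l2.
Proof. by rewrite /pnorm big_cat. Qed.

Lemma pnorm_scale c l : pnorm (pscale c l) = `|c| * pnorm l.
Proof. by rewrite /pnorm big_map mulr_sumr; apply: eq_bigr => p _; rewrite normrM. Qed.

Lemma pnorm_shift a l : pnorm (pshift a l) = pnorm l.
Proof. by rewrite /pnorm big_map. Qed.

Lemma pnorm_ge0 l : 0 <= pnorm l.
Proof. by apply: sumr_ge0. Qed.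

Lemma pshift_cat a l1 l2 : pshift a (l1 ++ l2) = pshift a l1 ++ pshift a l2.
Proof. by rewrite /pshift map_cat. Qed.

Lemma pshift_scale a c l : pshift a (pscale c l) = pscale c (pshift a l).
Proof. by rewrite /pshift /pscale -!map_comp. Qed.

Lemma pshiftD a b l : pshift a (pshift b l) = pshift (b + a) l.
Proof.
by rewrite /pshift -map_comp; apply: eq_map => p /=; rewrite addrA.
Qed.

Lemma pshift0 l : pshift 0 l = l.
Proof. by rewrite /pshift -[RHS]map_id; apply: eq_map => -[c g] /=; rewrite addr0. Qed.

Lemma psum_le0 l t : t <= 0 -> psum l t = 0.
Proof. by move=> t0; rewrite /psum big1// => p _; rewrite fker_le0// mulr0. Qed.

Lemma measurable_psum l : measurable_fun [set: R] (psum l).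
Proof.
elim: l => [|p l IH].
  by rewrite (_ : psum [::] = cst 0)//; apply/funext => t; rewrite /psum big_nil.
rewrite (_ : psum (p :: l) = fun t => p.1 * fker p.2 t + psum l t); last first.
  by apply/funext => t; rewrite /psum big_cons.
apply: measurable_funD => //; apply: measurable_funM => //; exact: measurable_fker.
Qed.

Lemma continuous_fker a t : 0 < t -> {for t, continuous (fker a)}.
Proof.
move=> t0; have cp : {for t, continuous (fun u : R => u `^ (a - 1))}.
  apply: differentiable_continuous; apply/derivable1_diffP.
  by apply: derivable_powR; rewrite in_itv/= t0.
have c : {for t, continuous (fun u => (Gamma a)^-1 * u `^ (a - 1))}.
  by apply: cvgM; [exact: cvg_cst|exact: cp].
rewrite /prop_for /continuous_at fkerE//.
apply: cvg_trans c; apply: near_eq_cvg; near=> u.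
by rewrite fkerE//; near: u; exact: lt_nbhsr.
Unshelve. all: by end_near. Qed.

Lemma continuous_psum l t : 0 < t -> {for t, continuous (psum l)}.
Proof.
move=> t0; elim: l => [|p l IH].
  rewrite (_ : psum [::] = cst 0); first exact: cvg_cst.
  by apply/funext => s; rewrite /psum big_nil.
rewrite (_ : psum (p :: l) = fun t => p.1 * fker p.2 t + psum l t); last first.
  by apply/funext => s; rewrite /psum big_cons.
apply: cvgD => //; apply: cvgM; first exact: cvg_cst.
exact: continuous_fker.
Qed.

Lemma fker_conv_integrable a b t : 0 < a -> 0 < b ->
  mu.-integrable setT (EFin \o (fun s => fker a (t - s) * fker b s)).
Proof.
move=> a0 b0; have mf : measurable_fun [set: R] (fun s => fker a (t - s) * fker b s).
  apply: measurable_funM; last exact: measurable_fker.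
  by apply: measurable_fun_reflect; exact: measurable_fker.
apply/integrableP; split; first by apply/measurable_EFinP; exact: mf.
under eq_integral do rewrite /= ger0_norm ?mulr_ge0 ?fker_ge0//.
by rewrite fker_conv// ltry.
Qed.

Lemma conv_psum a l t : 0 < a -> (forall p, p \in l -> 0 < p.2) ->
  conv (fker a) (psum l) t = psum (pshift a l) t /\
  mu.-integrable setT (EFin \o (fun s => fker a (t - s) * psum l s)).
Proof.
move=> a0; elim: l => [_|p l IH pl].
  split.
    rewrite /psum /pshift/= big_nil /conv.
    under eq_Rintegral do rewrite big_nil mulr0.
    by rewrite /Rintegral integral0.
  apply: (eq_integrable _ (cst 0)) => //; last exact: integrable0.
  by move=> s _; rewrite /psum /= big_nil mulr0.
have p0 : 0 < p.2 by apply: pl; rewrite mem_head.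
have [|E i] := IH; first by move=> r rl; apply: pl; rewrite in_cons rl orbT.
have ip := integrableZl measurableT p.1 (fker_conv_integrable t a0 p0).
split.
  rewrite /psum /pshift/= big_cons -/(pshift a l) -/(psum (pshift a l) t) -E /conv.
  transitivity (\int[mu]_s (p.1 * (fker a (t - s) * fker p.2 s) + fker a (t - s) * psum l s)).
    by apply: eq_Rintegral => s _; rewrite /psum big_cons; ring.
  rewrite RintegralD//; congr (_ + _).
  rewrite RintegralZl//; last exact: fker_conv_integrable.
  by rewrite /Rintegral fker_conv//= addrC.
have := integrableD measurableT ip i; apply: eq_integrable => // s _.
by rewrite /psum /= big_cons -EFinM -EFinD; congr EFin; ring.
Qed.

(** This is [Gamma_ge] at [B]. For [B] larger than [t] the bound decays geometrically in the order
    [b]. *)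
Lemma fker_le b t B : 0 < b -> 0 < t -> 0 < B ->
  fker b t <= 2 * expR (2 * B) * (t / B) `^ b / t.
Proof.
move=> b0 t0 B0; have G0 := Gamma_gt0 b0.
rewrite fkerE// powRB ?(lt0r_neq0 t0) ?implybT// (powRr1 (ltW t0)) mulrA.
apply: ler_wpM2r; first by rewrite invr_ge0 ltW.
have tB0 : 0 <= t / B by rewrite divr_ge0// ltW.
have -> : t `^ b = (t / B) `^ b * B `^ b.
  by rewrite -powRM ?divfK ?gt_eqF// ltW.
rewrite ler_pdivrMl//.
rewrite [leRHS]mulrA [leRHS]mulrC; apply: ler_wpM2l; first exact: powR_ge0.
have E0 : 0 <= 2 * expR (2 * B) by rewrite mulr_ge0 ?expR_ge0.
have := ler_wpM2l E0 (Gamma_ge b0 B0).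
have EE : expR (2 * B) * expR (- (2 * B)) = 1 by rewrite -expRD subrr expR0.
rewrite (_ : 2 * expR (2 * B) * _ = B `^ b * (expR (2 * B) * expR (- (2 * B)))); last by field.
by rewrite EE mulr1 [X in _ -> _ <= X]mulrC.
Qed.

(** Of the [n + 1] factors [(t / B) ^ q], one is kept to retain the behaviour [t ^ (q - 1)] at 0;
    the other [n] are bounded by their value at [T] and give a geometric rate. *)
Lemma psum_le l t T B q (n : nat) : 0 < q -> 0 < t -> t <= T -> T <= B ->
  (forall p, p \in l -> n.+1%:R * q <= p.2) ->
  `|psum l t| <= pnorm l * (2 * expR (2 * B) * (t / B) `^ q / t) * ((T / B) `^ q) ^+ n.
Proof.
move=> q0 t0 tT TB lq.
have T0 : 0 < T by exact: lt_le_trans tT.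
have B0 : 0 < B by exact: lt_le_trans TB.
rewrite /psum /pnorm -mulrA mulr_suml.
apply: (le_trans (ler_norm_sum _ _ _)).
rewrite !big_seq; apply: ler_sum => p pl.
rewrite normrM ler_wpM2l//.
have p0 : 0 < p.2.
  by apply: lt_le_trans (lq _ pl); rewrite mulr_gt0.
rewrite ger0_norm ?fker_ge0// (le_trans (fker_le p0 t0 B0))//.
rewrite mulrAC [leRHS](_ : _ = 2 * expR (2 * B) / t * ((t / B) `^ q * (T / B) `^ q ^+ n)); last by ring.
apply: ler_wpM2l; first by rewrite divr_ge0 ?mulr_ge0 ?expR_ge0// ltW.
have tB : 0 < t / B <= 1.
  by rewrite divr_gt0//= ler_pdivrMr// mul1r (le_trans tT).
apply: (le_trans (ger_powR tB (lq _ pl))).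
rewrite -natr1 mulrDl mul1r addrC powRD; last first.
  by have /andP[h _] := tB; rewrite (lt0r_neq0 h) implybT.
rewrite ler_wpM2l ?powR_ge0// [_ * q]mulrC powRrM powR_mulrn ?powR_ge0//.
rewrite lerXn2r ?nnegrE ?powR_ge0//.
apply: ge0_ler_powR; rewrite ?nnegrE ?ler_pM2r ?invr_gt0// ?divr_ge0//; exact: ltW.
Qed.

End power_sums.

(** * Series dominated by a singular kernel times a geometric sequence *)

Section dominated_series.
Context {R : realType}.
Notation mu := (@lebesgue_measure R).
Implicit Types (a q s t T C : R).

(** The counterpart of [conv_integrable] and [conv_norm_le] for functions that are singular at 0:
    the majorant [fker q] has an explicit convolution. *)
Lemma conv_dominated a q C T t (f : R -> R) : 0 < a -> 0 < q -> t <= T ->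
  measurable_fun [set: R] f -> (forall s, s <= 0 -> f s = 0) ->
  (forall s, 0 < s -> s <= T -> `|f s| <= C * fker q s) ->
  mu.-integrable setT (EFin \o (fun s => fker a (t - s) * f s)) /\
  `|conv (fker a) f t| <= C * fker (a + q) t.
Proof.
move=> a0 q0 tT mf f0 fC.
have mkf : measurable_fun [set: R] (fun s => fker a (t - s) * f s).
  apply: measurable_funM => //.
  by apply: measurable_fun_reflect; exact: measurable_fker.
have iC := integrableZl measurableT C (fker_conv_integrable t a0 q0).
have le s : `|fker a (t - s) * f s| <= C * (fker a (t - s) * fker q s).
  rewrite normrM ger0_norm ?fker_ge0// mulrCA; have [s0|s0] := ltP 0 s; last first.
    by rewrite f0// normr0 (fker_le0 q s0) !mulr0.
  have [st|ts] := ltP s t.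
    by rewrite ler_wpM2l ?fker_ge0// fC// (le_trans (ltW st)).
  by rewrite fker_le0 ?mul0r// subr_le0.
have i : mu.-integrable setT (EFin \o (fun s => fker a (t - s) * f s)).
  apply: le_integrable iC => //.
    by apply/measurable_EFinP; exact: mkf.
  by move=> s _; rewrite /= lee_fin; exact: le_trans (le s) (ler_norm _).
split=> //; apply: (le_trans (le_normr_Rintegral _ i)) => //.
rewrite (_ : fker (a + q) t = \int[mu]_s (fker a (t - s) * fker q s)); last first.
  by rewrite /Rintegral fker_conv.
rewrite -RintegralZl//; last exact: fker_conv_integrable.
apply: le_Rintegral => //.
by move/integrable_abse : i; apply: eq_integrable.
Qed.

Variables (u : nat -> R -> R) (q : R).
Hypothesis q0 : 0 < q.
Hypothesis mu_ : forall n, measurable_fun [set: R] (u n).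
Hypothesis u0 : forall n t, t <= 0 -> u n t = 0.
Hypothesis cu : forall n t, 0 < t -> {for t, continuous (u n)}.
Hypothesis bu : forall T, 0 < T -> exists2 C, 0 <= C & forall n t, 0 < t -> t <= T ->
  `|u n t| <= C * fker q t * 2^-1 ^+ n.

Definition dsum (t : R) : R := limn (fun N => \sum_(n < N) u n t).

Let partial_dist T C : (forall n t, 0 < t -> t <= T -> `|u n t| <= C * fker q t * 2^-1 ^+ n) ->
  forall N M t, 0 < t -> t <= T -> (N <= M)%N ->
  `|\sum_(n < M) u n t - \sum_(n < N) u n t| <= 2 * C * fker q t * 2^-1 ^+ N.
Proof.
move=> H N M t t0 tT NM; rewrite -(subnKC NM).
(* Keeping the subtracted power makes the bound telescope, so that the induction goes through. *)
suff : `|\sum_(n < N + (M - N)) u n t - \sum_(n < N) u n t| <=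
    2 * C * fker q t * (2^-1 ^+ N - 2^-1 ^+ (N + (M - N))).
  move/le_trans; apply; have C0 : 0 <= C * fker q t.
    by have := le_trans (normr_ge0 _) (H 0%N t t0 tT); rewrite expr0 mulr1.
  have h : (0 : R) <= 2^-1 ^+ (N + (M - N)) by rewrite exprn_ge0.
  by apply: ler_wpM2l; rewrite ?gerBl// -mulrA mulr_ge0.
elim: (M - N)%N => [|k IH]; first by rewrite addn0 !subrr normr0 mulr0.
rewrite addnS big_ord_recr/= addrAC (le_trans (ler_normD _ _))//.
have := H (N + k)%N t t0 tT; rewrite exprS; move: IH; set X := `|_|; set Y := `|_|.
lra.
Qed.

Lemma dsum_cvg t : (fun N => \sum_(n < N) u n t) @ \oo --> dsum t.
Proof.
have [t0|t0] := ltP 0 t; last first.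
  have E : (fun N => \sum_(n < N) u n t) = cst 0.
    by apply/funext => N; rewrite big1// => i _; exact: u0.
  by rewrite /dsum E lim_cst//; exact: cvg_cst.
have [C C0 HC] := bu t0.
suff : cvgn (series (u ^~ t)).
  by rewrite /series/=; under eq_fun do rewrite big_mkord.
apply: normed_cvg; apply: (@series_le_cvg _ _ (geometric (C * fker q t) 2^-1)).
- by move=> n; exact: normr_ge0.
- by move=> n; rewrite /= !mulr_ge0 ?fker_ge0// exprn_ge0.
- by move=> n; exact: HC.
- by apply: is_cvg_geometric_series; rewrite ger0_norm; lra.
Qed.

Lemma dsum_dist T C : (forall n t, 0 < t -> t <= T -> `|u n t| <= C * fker q t * 2^-1 ^+ n) ->
  forall N t, 0 < t -> t <= T ->
  `|dsum t - \sum_(n < N) u n t| <= 2 * C * fker q t * 2^-1 ^+ N.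
Proof.
move=> H N t t0 tT.
have cv : `|\sum_(n < M) u n t - \sum_(n < N) u n t| @[M --> \oo] -->
    `|dsum t - \sum_(n < N) u n t|.
  by apply: cvg_norm; apply: cvgB; [exact: dsum_cvg|exact: cvg_cst].
apply: (cvgr_to_le cv); near=> M; apply: partial_dist H _ _ _ _ _ _ => //.
by near: M; exact: nbhs_infty_ge.
Unshelve. all: by end_near. Qed.

Lemma dsum_le0 t : t <= 0 -> dsum t = 0.
Proof.
move=> t0; rewrite /dsum (_ : (fun N => _) = cst 0) ?lim_cst//.
by apply/funext => N; rewrite big1// => i _; exact: u0.
Qed.

Lemma dsum_le T C : (forall n t, 0 < t -> t <= T -> `|u n t| <= C * fker q t * 2^-1 ^+ n) ->
  forall t, 0 < t -> t <= T -> `|dsum t| <= 2 * C * fker q t.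
Proof.
move=> H t t0 tT; have := dsum_dist H 0 t0 tT.
by rewrite big_ord0 subr0 expr0 mulr1.
Qed.

Let cvg_half : (2^-1 : R) ^+ n @[n --> \oo] --> (0 : R).
Proof. by apply: cvg_expr; rewrite ger0_norm; lra. Qed.

Let half_small K e : 0 < e -> \forall n \near \oo, K * (2^-1 : R) ^+ n <= e.
Proof.
move=> e0; have H : K * (2^-1 : R) ^+ n @[n --> \oo] --> (0 : R).
  by rewrite -[X in _ --> X](mulr0 K); apply: cvgM => //; exact: cvg_cst.
exact: cvgr_le H _ e0.
Qed.

Lemma continuous_dsum t : 0 < t -> {for t, continuous dsum}.
Proof.
move=> t0; have T0 : 0 < t + 1 by exact: addr_gt0.
have [C C0 HC] := bu T0; have HD := dsum_dist HC.
apply/cvgrPdist_le => e e0.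
(* Convergence is uniform only away from 0; near a fixed [t > 0], [fker q] stays below
   [fker q t + 1]. *)
pose K := 2 * C * (fker q t + 1).
have K0 : 0 <= K by rewrite !mulr_ge0// addr_ge0// fker_ge0.
have [N HN] : exists N : nat, K * 2^-1 ^+ N <= e / 3.
  have e3 : 0 < e / 3 by rewrite divr_gt0.
  by have [N _ /(_ N (leqnn N))] := half_small K e3; exists N.
have cS : {for t, continuous (fun s => \sum_(n < N) u n s)}.
  elim: (N) => [|n IH].
    rewrite (_ : (fun _ => _) = cst 0); first exact: cvg_cst.
    by apply/funext => s; rewrite big_ord0.
  rewrite (_ : (fun s => _) = (fun s => \sum_(i < n) u i s + u n s)).
    by apply: cvgD => //; exact: cu.
  by apply/funext => s; rewrite big_ord_recr.
have ck : \forall s \near t, fker q s <= fker q t + 1.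
  have cq : fker q s @[s --> t] --> fker q t by exact: continuous_fker.
  by have := cvgr_le _ cq (fker q t + 1); apply; rewrite ltrDl.
have csT : \forall s \near t, s <= t + 1.
  have ct : s @[s --> t] --> t by exact: cvg_id.
  by have := cvgr_le _ ct (t + 1); apply; rewrite ltrDl.
move/cvgrPdist_le : cS => /(_ (e / 3)) cS.
have {}cS : \forall s \near t, `|\sum_(n < N) u n t - \sum_(n < N) u n s| <= e / 3.
  by apply: cS; rewrite divr_gt0.
near=> s.
have s0 : 0 < s by near: s; exact: lt_nbhsr.
have sT : s <= t + 1.
  by near: s.
have H1 : `|dsum t - \sum_(n < N) u n t| <= e / 3.
  apply: le_trans (HD N t t0 _) _; first by rewrite lerDl.
  apply: le_trans HN; rewrite /K ler_wpM2r ?exprn_ge0// ler_wpM2l ?mulr_ge0// lerDl//.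
have H2 : `|dsum s - \sum_(n < N) u n s| <= e / 3.
  apply: le_trans (HD N s s0 sT) _.
  apply: le_trans HN; rewrite /K ler_wpM2r ?exprn_ge0// ler_wpM2l ?mulr_ge0//.
  by near: s.
have H3 : `|\sum_(n < N) u n t - \sum_(n < N) u n s| <= e / 3 by near: s.
move: H1 H2 H3; rewrite !ler_norml => /andP[? ?] /andP[? ?] /andP[? ?].
by apply/andP; split; lra.
Unshelve. all: by end_near. Qed.

Lemma measurable_dsum : measurable_fun [set: R] dsum.
Proof.
have -> : dsum = dsum \_ (`]0, +oo[%classic : set R).
  apply/funext => t; rewrite patchE; case: ifPn => // /negP.
  by rewrite inE/= in_itv/= andbT => /negP; rewrite -leNgt; exact: dsum_le0.
apply/(measurable_restrictT _ _).1 => //.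
apply: open_continuous_measurable_fun => //.
by move=> s /[!inE]/=; rewrite in_itv/= andbT; exact: continuous_dsum.
Qed.

(** The remainder of the series is at most [2 C 2^-N] times [fker q], so its convolution is at most
    that multiple of [fker (a + q) t]. *)
Lemma conv_dsum_cvg a t : 0 < a ->
  (fun N => \sum_(n < N) conv (fker a) (u n) t) @ \oo --> conv (fker a) dsum t.
Proof.
move=> a0; have [t0|t0] := ltP 0 t; last first.
  have c0 f : (forall s, s <= 0 -> f s = 0) -> conv (fker a) f t = 0.
    by move=> f0; apply: conv_lt0 => //; [exact: fker_kernel|move=> s /ltW/f0].
  rewrite (c0 dsum dsum_le0) (_ : (fun N => _) = cst 0); first exact: cvg_cst.
  by apply/funext => N; rewrite big1// => n _; rewrite c0//; exact: u0.
have [C C0 HC] := bu t0.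
have iu n : mu.-integrable setT (EFin \o (fun s => fker a (t - s) * u n s)).
  have [] // := @conv_dominated a q (C * 2^-1 ^+ n) t t (u n) a0 q0 (lexx t) _ (u0 n).
  by move=> s s0 st; rewrite mulrAC; exact: HC.
have iU : mu.-integrable setT (EFin \o (fun s => fker a (t - s) * dsum s)).
  have [] // := @conv_dominated a q (2 * C) t t dsum a0 q0 (lexx t) measurable_dsum dsum_le0.
  exact: dsum_le HC.
have ES N : mu.-integrable setT (EFin \o (fun s => fker a (t - s) * \sum_(n < N) u n s)) /\
    \sum_(n < N) conv (fker a) (u n) t = conv (fker a) (fun s => \sum_(n < N) u n s) t.
  elim: N => [|N [iN IH]].
    split.
      apply: (eq_integrable _ (cst 0%E)) => //; last exact: integrable0.
      by move=> s _; rewrite /= big_ord0 mulr0.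
    rewrite big_ord0 /conv; under eq_Rintegral do rewrite big_ord0 mulr0.
    by rewrite /Rintegral integral0.
  split.
    have := integrableD measurableT iN (iu N); apply: eq_integrable => // s _.
    by rewrite /= big_ord_recr/= -EFinD mulrDr.
  rewrite big_ord_recr/= IH /conv -RintegralD//; apply: eq_Rintegral => s _.
  by rewrite big_ord_recr/= mulrDr.
apply/cvgrPdist_le => e e0.
near=> N.
have [iS ->] := ES N.
rewrite -RintegralB//.
apply: (@le_trans _ _ (2 * C * 2^-1 ^+ N * fker (a + q) t)).
  have [] := @conv_dominated a q (2 * C * 2^-1 ^+ N) t t (fun s => dsum s - \sum_(n < N) u n s) a0 q0 (lexx t).
  - apply: measurable_funB; first exact: measurable_dsum.
    exact: measurable_sum.
  - by move=> s s0; rewrite dsum_le0// big1 ?subr0// => i _; exact: u0.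
  - by move=> s s0 st; rewrite mulrAC; exact: dsum_dist HC _ _ s0 st.
  - move=> _; apply: le_trans; rewrite le_eqVlt; apply/orP; left; apply/eqP; congr `|_|.
    by apply: eq_Rintegral => s _; rewrite mulrBr.
rewrite mulrAC; near: N; exact: half_small.
Unshelve. all: by end_near. Qed.

End dominated_series.

(** * The primitive of a dominated series is regular, and its Caputo derivative *)

Section dsum_regular.
Context {R : realType}.
Notation mu := (@lebesgue_measure R).
Variables (u : nat -> R -> R) (q x0 : R).
Hypothesis q0 : 0 < q.
Hypothesis u0 : forall n t, t <= 0 -> u n t = 0.
Hypothesis cu : forall n t, 0 < t -> {for t, continuous (u n)}.
Hypothesis bu : forall T, 0 < T -> exists2 C, 0 <= C & forall n t, 0 < t -> t <= T ->
  `|u n t| <= C * fker q t * 2^-1 ^+ n.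

Let U := dsum u.
(* The series [U] is the derivative of the solution: its terms behave like a negative
   power of [t] at 0, so they are dominated by [fker q] and not by a constant. *)
Definition dsum_primitive (t : R) : R := x0 + conv (fker 1) U t.

Let iU (T : R) : mu.-integrable `[0, T[ (EFin \o U).
Proof.
have [T0|T0] := ltP 0 T; last first.
  by rewrite set_itv_ge ?bnd_simp -?leNgt//; exact: integrable_set0.
have [C C0 HC] := bu T0.
have [i _] := @conv_dominated R 1 q (2 * C) T T U ltr01 q0 (lexx T)
  (measurable_dsum q0 u0 cu bu) (dsum_le0 u0) (dsum_le q0 u0 bu HC).
apply: (@eq_integrable _ _ _ mu _ _ (EFin \o (fun s => fker 1 (T - s) * U s))) => //.
  move=> s; rewrite inE/= in_itv/= => /andP[_ sT].
  by rewrite fker1 ?subr_gt0// mul1r.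
exact: integrableS i.
Qed.

Let iUc (T : R) : mu.-integrable `[0, T] (EFin \o U).
Proof.
apply: integrableS (iU (T + 1)) => //; apply: subset_itvl; rewrite bnd_simp.
by rewrite ltrDl.
Qed.

Let primitiveE : dsum_primitive = fun t => x0 + parameterized_integral mu 0 t U.
Proof.
apply/funext => t; rewrite /dsum_primitive conv_fker1; last first.
  by move=> s /ltW; exact: dsum_le0.
by rewrite Rintegral_itv_bndo_bndc//; exact: iU.
Qed.

Lemma dsum_primitive0 : dsum_primitive 0 = x0.
Proof.
rewrite /dsum_primitive conv_lt0 ?addr0//; first exact: fker_kernel.
by move=> s /ltW; exact: dsum_le0.
Qed.

Let is_derive_primitive (t : R) : 0 < t -> is_derive t 1 dsum_primitive (U t).
Proof.
move=> t0; rewrite primitiveE.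
have t1 : t < t + 1 by rewrite ltrDl.
have H := @continuous_FTC1 R U (BLeft 0) t (t + 1) t1 (iUc (t + 1)).
have [|d1 d2] := H _ (continuous_dsum q0 u0 cu bu t0).
  by rewrite /= lte_fin.
have dF : is_derive t 1 (fun t => parameterized_integral mu 0 t U) (U t).
  by split; [exact: d1|rewrite -derive1E -d2].
rewrite -[X in is_derive _ _ _ X]add0r.
exact: is_deriveD.
Qed.

Lemma derive1_dsum_primitive (t : R) : 0 < t -> derive1 dsum_primitive t = U t.
Proof. by move=> /is_derive_primitive[_ <-]; rewrite derive1E. Qed.

Lemma dsum_primitive_regular : caputo_regular dsum_primitive.
Proof.
split.
- apply/continuous_within_itvcyP; split.
    move=> t; rewrite in_itv/= andbT => t0.
    apply: differentiable_continuous; apply/derivable1_diffP.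
    by have [] := is_derive_primitive t0.
  rewrite dsum_primitive0 primitiveE -[X in _ --> X]addr0.
  apply: cvgD; first exact: cvg_cst.
  apply: cvg_at_right_filter.
  exact: (parameterized_integral_cvg_left ltr01 (iUc 1)).
- by move=> t t0; have [] := is_derive_primitive t0.
- move=> t t0; rewrite /prop_for /continuous_at derive1_dsum_primitive//.
  have := continuous_dsum q0 u0 cu bu t0; apply: cvg_trans; apply: near_eq_cvg.
  by near=> s; rewrite derive1_dsum_primitive//; near: s; exact: lt_nbhsr.
- move=> T T0; apply: (@eq_integrable _ _ _ mu _ _ (EFin \o U)) => //.
    move=> s; rewrite inE/= in_itv/= => /andP[s0 _].
    by rewrite /= derive1_dsum_primitive.
  by apply: integrableS (iU T) => //; apply: subset_itvr; rewrite bnd_simp.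
Unshelve. all: by end_near. Qed.

Lemma caputo_dsum_primitive (a t : R) : 0 < a < 1 -> 0 < t ->
  caputo a dsum_primitive t = conv (fker (1 - a)) U t.
Proof.
move=> /andP[a0 a1] t0; have a1' : 0 < 1 - a by rewrite subr_gt0.
rewrite /caputo lt_eqF//.
have -> : conv (fker (1 - a)) U t =
    conv (fker (1 - a)) (derive1 dsum_primitive \_ `]0, +oo[) t.
  apply: eq_Rintegral => s _; congr (_ * _); rewrite patchE.
  case: (ltP 0 s) => s0; last first.
    by rewrite memNset ?/U ?dsum_le0//= in_itv/= ltNge s0.
  by rewrite mem_set/= ?in_itv/= ?s0// derive1_dsum_primitive.
rewrite conv_of_derive1; last exact: fker_le0.
have [_ _ _ ix] := dsum_primitive_regular.
rewrite -RintegralZl_gt0//; last by rewrite invr_gt0 Gamma_gt0.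
  apply: eq_Rintegral => v; rewrite inE/= in_itv/= => /andP[v0 vs].
  by rewrite fkerE ?subr_gt0// mulrA (_ : 1 - a - 1 = - a)//; ring.
apply: measurable_funM; last by apply/measurable_EFinP; exact: measurable_int (ix _ t0).
apply: measurable_funTS; apply: (@measurable_fun_reflect R t (fun v => v `^ (- a))).
exact: measurable_powR.
Qed.

Lemma caputo1_dsum_primitive (t : R) : 0 < t -> caputo 1 dsum_primitive t = U t.
Proof. by move=> t0; rewrite /caputo eqxx derive1_dsum_primitive. Qed.

End dsum_regular.

(** * Picard iteration for the derivatives of the solution *)

Section existence.
Context {R : realType}.
Variables (A : 'M[R]_2) (q1 q2 x0 y0 : R).
Hypotheses (hq1 : 0 < q1 <= 1) (hq2 : 0 < q2 <= 1).

(** Differentiating the Volterra equations, the derivatives u and v satisfy u = (a11 x0 + a12 y0)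
    [fker q1] + J^q1 (a11 u + a12 v), and similarly for v. [pinit] holds the inhomogeneous terms and
    [pstep] applies the linear part. *)
Definition pinit := ([:: (A 0 0 * x0 + A 0 1 * y0, q1)],
                     [:: (A 1 0 * x0 + A 1 1 * y0, q2)]).
Definition pstep (lm : seq (R * R) * seq (R * R)) :=
  (pshift q1 (pscale (A 0 0) lm.1 ++ pscale (A 0 1) lm.2),
   pshift q2 (pscale (A 1 0) lm.1 ++ pscale (A 1 1) lm.2)).
Definition picard n := iter n pstep pinit.

Let q : R := Num.min q1 q2.
Let q0 : 0 < q. Proof. by rewrite lt_min; case/andP: hq1 => ->; case/andP: hq2 => ->. Qed.
Let K : R := `|A 0 0| + `|A 0 1| + `|A 1 0| + `|A 1 1|.

Lemma picard_exp n (p : R * R) : p \in (picard n).1 ++ (picard n).2 ->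
  n.+1%:R * q <= p.2.
Proof.
have qq1 : q <= q1 by rewrite ge_min lexx.
have qq2 : q <= q2 by rewrite ge_min lexx orbT.
elim: n p => [|n IH] p.
  by rewrite /= !inE mul1r => /orP[]/eqP->.
have H b (l : seq (R * R)) : q <= b -> {subset l <= (picard n).1 ++ (picard n).2} ->
    forall c, p \in pshift b (pscale c l) -> n.+2%:R * q <= p.2.
  move=> qb sl c; rewrite /pshift /pscale -map_comp => /mapP[r /sl/IH rq ->] /=.
  by rewrite -natr1 mulrDl mul1r lerD.
have s1 : {subset (picard n).1 <= (picard n).1 ++ (picard n).2}.
  by move=> r; rewrite mem_cat => ->.
have s2 : {subset (picard n).2 <= (picard n).1 ++ (picard n).2}.
  by move=> r; rewrite mem_cat orbC => ->.
rewrite /= /pstep/= !pshift_cat !mem_cat -!orbA => /or4P[]; by apply: H.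
Qed.

Lemma picard_norm n : pnorm (picard n).1 + pnorm (picard n).2 <=
  (pnorm pinit.1 + pnorm pinit.2) * K ^+ n.
Proof.
elim: n => [|n IH]; first by rewrite expr0 mulr1.
rewrite exprSr mulrA; apply: le_trans (_ : (pnorm (picard n).1 + pnorm (picard n).2) * K <= _).
  rewrite /= /pstep/= !pnorm_shift !pnorm_cat !pnorm_scale /K.
  have := pnorm_ge0 (picard n).1; have := pnorm_ge0 (picard n).2.
  rewrite /picard; set a := pnorm _; set b := pnorm _.
  have := normr_ge0 (A 0 0); have := normr_ge0 (A 0 1); have := normr_ge0 (A 1 0).
  by have := normr_ge0 (A 1 1); nra.
by rewrite ler_wpM2r// !addr_ge0.
Qed.

Let bound_aux (l : nat -> seq (R * R)) :
  (forall n p, p \in l n -> n.+1%:R * q <= p.2) ->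
  (forall n, pnorm (l n) <= (pnorm pinit.1 + pnorm pinit.2) * K ^+ n) ->
  forall T, 0 < T -> exists2 C, 0 <= C & forall n t, 0 < t -> t <= T ->
    `|psum (l n) t| <= C * fker q t * 2^-1 ^+ n.
Proof.
move=> le ln T T0; set S := pnorm _ + pnorm _ in ln.
have S0 : 0 <= S by rewrite addr_ge0 ?pnorm_ge0.
have K0 : 0 <= K by rewrite !addr_ge0.
have K1 : 1 <= 2 * (K + 1) by lra.
(* Chosen so that [(T / B) ^ q = 1 / (2 (K + 1))]: together with the factor [K] by which
   coefficients grow, each step then gains at least 1/2. *)
pose B := T * (2 * (K + 1)) `^ q^-1.
have c1 : 1 <= (2 * (K + 1)) `^ q^-1.
  rewrite -[leLHS](powRr0 (2 * (K + 1))); apply: ler_powR => //.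
  by rewrite invr_ge0 ltW.
have TB : T <= B by rewrite /B ler_peMr// ltW.
have B0 : 0 < B by exact: lt_le_trans TB.
have rho : (T / B) `^ q = (2 * (K + 1))^-1.
  rewrite /B invfM mulVKf ?gt_eqF// -powRN -powRrM mulNr mulVf ?gt_eqF//.
  by rewrite powR_inv1//; lra.
exists (S * (2 * expR (2 * B)) * Gamma q * B `^ (- q)).
  by rewrite !mulr_ge0 ?expR_ge0 ?powR_ge0// ltW// Gamma_gt0.
move=> n t t0 tT.
apply: (le_trans (psum_le q0 t0 tT TB (le n))).
have -> : 2 * expR (2 * B) * (t / B) `^ q / t =
    2 * expR (2 * B) * Gamma q * B `^ (- q) * fker q t.
  rewrite fkerE// powRB ?(lt0r_neq0 t0) ?implybT// (powRr1 (ltW t0)).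
  rewrite powRM ?invr_ge0 ?(ltW t0) ?(ltW B0)// powRN.
  rewrite -(@powR_inv1 _ B (ltW B0)) -powRrM mulN1r powRN.
  by field; rewrite !gt_eqF ?powR_gt0 ?Gamma_gt0.
set X := 2 * expR (2 * B) * Gamma q * B `^ (- q) * fker q t.
have X0 : 0 <= X by rewrite /X !mulr_ge0 ?expR_ge0 ?powR_ge0 ?fker_ge0// ltW// Gamma_gt0.
have -> : S * (2 * expR (2 * B)) * Gamma q * B `^ (- q) * fker q t = S * X.
  by rewrite /X; ring.
rewrite rho mulrAC [leRHS]mulrAC ler_wpM2r//.
apply: (@le_trans _ _ (S * K ^+ n * (2 * (K + 1))^-1 ^+ n)).
  by rewrite ler_wpM2r// exprn_ge0// invr_ge0; lra.
rewrite -mulrA -exprMn ler_wpM2l// lerXn2r// ?nnegrE ?divr_ge0//; try lra.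
by rewrite ler_pdivrMr; lra.
Qed.

Let u n t := psum (picard n).1 t.
Let v n t := psum (picard n).2 t.

Let bu T : 0 < T -> exists2 C, 0 <= C & forall n t, 0 < t -> t <= T ->
  `|u n t| <= C * fker q t * 2^-1 ^+ n.
Proof.
apply: bound_aux => [n p pl|n]; first by apply: picard_exp; rewrite mem_cat pl.
by apply: le_trans (picard_norm n); rewrite lerDl pnorm_ge0.
Qed.

Let bv T : 0 < T -> exists2 C, 0 <= C & forall n t, 0 < t -> t <= T ->
  `|v n t| <= C * fker q t * 2^-1 ^+ n.
Proof.
apply: bound_aux => [n p pl|n]; first by apply: picard_exp; rewrite mem_cat pl orbT.
by apply: le_trans (picard_norm n); rewrite lerDr pnorm_ge0.
Qed.

(** The list encoding unifies the two cases of [caputo]: for [a = 1] there is no kernel of order 0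
    to convolve with, but [pshift 0] is the identity. *)
Let caputo_cvg (l : nat -> seq (R * R)) (a c t : R) :
  (forall n p, p \in l n -> n.+1%:R * q <= p.2) ->
  (forall T, 0 < T -> exists2 C, 0 <= C & forall n t, 0 < t -> t <= T ->
    `|psum (l n) t| <= C * fker q t * 2^-1 ^+ n) ->
  0 < a <= 1 -> 0 < t ->
  (fun N => \sum_(n < N) psum (pshift (1 - a) (l n)) t) @ \oo -->
    caputo a (dsum_primitive (fun n => psum (l n)) c) t.
Proof.
move=> le bl /andP[a0 a1] t0.
have ml n : measurable_fun [set: R] (psum (l n)) by exact: measurable_psum.
have l0 n s : s <= 0 -> psum (l n) s = 0 by exact: psum_le0.
have cl n s : 0 < s -> {for s, continuous (psum (l n))} by exact: continuous_psum.
have [->|an1] := eqVneq a 1.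
  rewrite (caputo1_dsum_primitive c q0 l0 cl bl t0) subrr.
  under eq_cvg do under eq_bigr do rewrite pshift0.
  exact: (dsum_cvg q0 l0 bl).
have a01 : 0 < a < 1 by rewrite a0 lt_neqAle an1.
rewrite (caputo_dsum_primitive c q0 l0 cl bl a01 t0).
have a1' : 0 < 1 - a by rewrite subr_gt0; case/andP: a01.
have := conv_dsum_cvg (t := t) q0 ml l0 cl bl a1'; apply: cvg_trans; apply: near_eq_cvg.
near=> N; apply: eq_bigr => n _; have [] // := @conv_psum R (1 - a) (l n) t a1'.
by move=> p /le; apply: lt_le_trans; rewrite mulr_gt0.
Unshelve. all: by end_near. Qed.

Let prim_cvg (l : nat -> seq (R * R)) (c t : R) :
  (forall n p, p \in l n -> n.+1%:R * q <= p.2) ->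
  (forall T, 0 < T -> exists2 C, 0 <= C & forall n t, 0 < t -> t <= T ->
    `|psum (l n) t| <= C * fker q t * 2^-1 ^+ n) ->
  (fun N => c + \sum_(n < N) psum (pshift 1 (l n)) t) @ \oo -->
    dsum_primitive (fun n => psum (l n)) c t.
Proof.
move=> le bl.
have ml n : measurable_fun [set: R] (psum (l n)) by exact: measurable_psum.
have l0 n s : s <= 0 -> psum (l n) s = 0 by exact: psum_le0.
have cl n s : 0 < s -> {for s, continuous (psum (l n))} by exact: continuous_psum.
apply: cvgD; first exact: cvg_cst.
have := conv_dsum_cvg (t := t) q0 ml l0 cl bl ltr01; apply: cvg_trans; apply: near_eq_cvg.
near=> N; apply: eq_bigr => n _; have [] // := @conv_psum R 1 (l n) t ltr01.
by move=> p /le; apply: lt_le_trans; rewrite mulr_gt0.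
Unshelve. all: by end_near. Qed.

Lemma solution_exists : exists x y, is_solution A q1 q2 x0 y0 x y.
Proof.
have le1 n p : p \in (picard n).1 -> n.+1%:R * q <= p.2.
  by move=> pl; apply: picard_exp; rewrite mem_cat pl.
have le2 n p : p \in (picard n).2 -> n.+1%:R * q <= p.2.
  by move=> pl; apply: picard_exp; rewrite mem_cat pl orbT.
pose x := dsum_primitive (fun n => psum (picard n).1) x0.
pose y := dsum_primitive (fun n => psum (picard n).2) y0.
have l0 (l : nat -> seq (R * R)) n s : s <= 0 -> psum (l n) s = 0 by exact: psum_le0.
have cl (l : nat -> seq (R * R)) n s : 0 < s -> {for s, continuous (psum (l n))} by exact: continuous_psum.
have key (l : nat -> seq (R * R)) (a c d t : R) z : 0 < t -> 0 < a <= 1 ->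
    l 0%N = [:: (c * x0 + d * y0, a)] ->
    (forall n, l n.+1 = pshift a (pscale c (picard n).1 ++ pscale d (picard n).2)) ->
    (fun N => \sum_(n < N) psum (pshift (1 - a) (l n)) t) @ \oo --> z ->
    z = c * x t + d * y t.
  move=> t0 ha l00 lS cz; apply: (cvg_unique _ _ (_ : (fun N => c * (x0 + \sum_(n < N) psum (pshift 1 (picard n).1) t)
      + d * (y0 + \sum_(n < N) psum (pshift 1 (picard n).2) t)) @ \oo --> _)) => //; last first.
    apply: cvgD; (apply: cvgM; first exact: cvg_cst).
      exact: (@prim_cvg (fun n => (picard n).1) x0 t le1 bu).
    exact: (@prim_cvg (fun n => (picard n).2) y0 t le2 bv).
  (* Shifting [N] by one isolates term 0, which contributes the constant [c * x0 + d * y0] because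
     [fker 1 = 1]. The orders [a] of a Picard step and [1 - a] add up to 1, so term [n + 1] becomes
     the integral of the combination of the terms [n]. *)
  move: cz; rewrite -cvg_shiftS; apply: cvg_trans; apply: near_eq_cvg; near=> N.
  rewrite /= big_ord_recl l00 /pshift /= {1}/psum big_seq1 /= (_ : a + (1 - a) = 1); last by ring.
  rewrite fker1// mulr1.
  rewrite (eq_bigr (fun n : 'I_N => c * psum (pshift 1 (picard n).1) t + d * psum (pshift 1 (picard n).2) t)).
    by rewrite big_split/= -!mulr_sumr; ring.
  move=> n _; rewrite /bump/= add1n lS -/(pshift _ _) pshiftD (_ : a + (1 - a) = 1); last by ring.
  by rewrite pshift_cat psum_cat !pshift_scale !psum_scale.
exists x, y; split.
- exact: (dsum_primitive_regular x0 q0 (l0 _) (cl _) bu).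
- exact: (dsum_primitive_regular y0 q0 (l0 _) (cl _) bv).
- exact: dsum_primitive0 (l0 _).
- exact: dsum_primitive0 (l0 _).
- move=> t t0; split.
    by apply: (key (fun n => (picard n).1) q1) => //; exact: (@caputo_cvg (fun n => (picard n).1) q1 x0 t le1 bu hq1 t0).
  by apply: (key (fun n => (picard n).2) q2) => //; exact: (@caputo_cvg (fun n => (picard n).2) q2 y0 t le2 bv hq2 t0).
Unshelve. all: by end_near. Qed.

End existence.

(** * Instability *)

Section instability.
Context {R : realType}.
Variables (A : 'M[R]_2).

Lemma det_mx2 : \det A = A 0 0 * A 1 1 - A 0 1 * A 1 0.
Proof.
rewrite (expand_det_row _ 0) big_ord_recl big_ord1 /cofactor !det_mx11 !mxE /=.
have e1 : lift ord0 ord0 = 1 :> 'I_2 by exact/val_inj.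
have e2 : lift 0 0 = 1 :> 'I_2 by exact/val_inj.
rewrite ?e1 ?e2 /= expr0 mul1r expr1 mulN1r mulrN.
by congr (A _ _ * _ - A _ _ * A _ _); exact/val_inj.
Qed.

(** The characteristic function at [l = expR x], so that positive roots become real roots. *)
Definition charfun (q1 q2 x : R) : R :=
  (expR (q1 * x) - A 0 0) * (expR (q2 * x) - A 1 1) - A 0 1 * A 1 0.

(** The function is nonnegative far to the right, so the intermediate value theorem gives a root. *)
Lemma charfun_unstable q1 q2 x : 0 < q1 <= 1 -> 0 < q2 <= 1 ->
  charfun q1 q2 x <= 0 -> unstable A q1 q2.
Proof.
move=> hq1 hq2 gx; have /andP[q10 _] := hq1; have /andP[q20 _] := hq2.
(* Once both exponentials exceed [K], one factor is at least [1 + |A 0 1 * A 1 0|] and the other at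
   least 1. *)
pose K := 1 + `|A 0 0| + `|A 1 1| + `|A 0 1 * A 1 0|.
pose y := Num.max x (Num.max (K / q1) (K / q2)).
have gy : 0 <= charfun q1 q2 y.
  have h q : 0 < q -> K / q <= y -> K <= expR (q * y).
    move=> q0 Ky; apply: le_trans (expR_ge1Dx _).
    by rewrite ler_wpDl// mulrC -ler_pdivrMr.
  have h1 := h q1 q10; have h2 := h q2 q20.
  have {}h1 : K <= expR (q1 * y) by apply: h1; rewrite /y !le_max lexx !orbT.
  have {}h2 : K <= expR (q2 * y) by apply: h2; rewrite /y !le_max lexx !orbT.
  rewrite /charfun subr_ge0.
  have := ler_norm (A 0 0); have := ler_norm (A 1 1); have := ler_norm (A 0 1 * A 1 0).
  have := normr_ge0 (A 0 0); have := normr_ge0 (A 1 1); have := normr_ge0 (A 0 1 * A 1 0).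
  rewrite /K in h1 h2; move: h1 h2.
  set c := A 0 1 * _; set a := A 0 0; set b := A 1 1.
  set z := expR _; set w := expR _ => h1 h2 n1 n2 n3 c1 b1 a1.
  apply: (le_trans c1); have z1 : 1 + `|c| <= z - a by lra.
  have w1 : 1 <= w - b by lra.
  apply: (@le_trans _ _ ((1 + `|c|) * 1)); first by rewrite mulr1; lra.
  by apply: ler_pM => //; lra.
have cg : continuous (charfun q1 q2).
  move=> z; apply: cvgB; last exact: cvg_cst.
  have ce q : expR (q * t) @[t --> z] --> expR (q * z).
    apply: continuous_cvg; first exact: continuous_expR.
    by apply: cvgM; [exact: cvg_cst|exact: cvg_id].
  by apply: cvgM; (apply: cvgB; [exact: ce|exact: cvg_cst]).
have xy : x <= y by rewrite /y le_max lexx.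
have [|l _ gl] := @IVT R (charfun q1 q2) x y 0 xy (continuous_subspaceT cg).
  by rewrite (le_trans _ (_ : 0 <= _)) ?ge_min ?gx ?le_max ?gy ?orbT.
apply: (@root_unstable R A q1 q2 (expR l)) => //.
- by move=> x0 y0; exact: solution_exists.
- exact: expR_gt0.
- rewrite /powR gt_eqF ?expR_gt0// expRK; apply/eqP; rewrite -subr_eq0.
  by apply/eqP; exact: gl.
Qed.

(** As [x] tends to [-oo] both exponentials vanish and [charfun] tends to the determinant. *)
Lemma det_lt0_unstable q1 q2 : \det A < 0 -> 0 < q1 <= 1 -> 0 < q2 <= 1 ->
  unstable A q1 q2.
Proof.
rewrite det_mx2 => d0 hq1 hq2; have /andP[q10 q11] := hq1; have /andP[q20 q21] := hq2.
set d := _ - _ in d0.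
pose K := 1 + `|A 0 0| + `|A 1 1|.
have K0 : 0 < K by rewrite /K -addrA ltr_pwDl// addr_ge0.
(* When both exponentials are at most [e], the terms other than the determinant add up to at most
   [e * K], hence to at most [- d]. *)
pose e := Num.min 1 (- d / K).
have e0 : 0 < e by rewrite lt_min ltr01 divr_gt0// oppr_gt0.
have e1 : e <= 1 by rewrite ge_min lexx.
have eK : e * K <= - d by rewrite -ler_pdivlMr// /e ge_min lexx orbT.
pose q := Num.min q1 q2.
have q0 : 0 < q by rewrite lt_min q10.
have le0 : ln e <= 0 by exact: ln_le0.
have h p : q <= p -> expR (p * (ln e / q)) <= e.
  move=> qp; rewrite -[leRHS](lnK e0) ler_expR mulrCA -[leRHS]mulr1.
  by rewrite ler_wnM2l// ler_pdivlMr// mul1r.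
apply: (charfun_unstable (x := ln e / q)) => //.
have := h q1; rewrite ge_min lexx => /(_ isT) h1.
have := h q2; rewrite ge_min lexx orbT => /(_ isT) h2.
have := expR_gt0 (q1 * (ln e / q)); have := expR_gt0 (q2 * (ln e / q)).
rewrite /charfun; move: h1 h2; set z := expR _; set w := expR _ => h1 h2 w0 z0.
rewrite (_ : _ - _ = z * w - A 0 0 * w - A 1 1 * z + d); last by rewrite /d; ring.
have n1 := ler_norm (- A 0 0); have n2 := ler_norm (- A 1 1); rewrite !normrN in n1 n2.
have m1 := normr_ge0 (A 0 0); have m2 := normr_ge0 (A 1 1).
have : z * w <= e by rewrite -[leRHS]mulr1; apply: ler_pM; lra.
have : - A 0 0 * w <= `|A 0 0| * e.
  by apply: le_trans (ler_wpM2r (ltW w0) n1) _; exact: ler_wpM2l.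
have : - A 1 1 * z <= `|A 1 1| * e.
  by apply: le_trans (ler_wpM2r (ltW z0) n2) _; exact: ler_wpM2l.
rewrite /K in eK; lra.
Qed.

(** Each condition makes the characteristic function nonpositive at one point: at [l = 1] its value
    is [1 - tr A + det A], and where [l ^ q1 = A 0 0] it is [- A 0 1 * A 1 0]. *)
Lemma det_gt0_unstable q1 q2 :
  (A 0 0 + A 1 1 >= \det A + 1 \/
    [/\ A 0 0 > 0, A 1 1 > 0 & A 0 0 * A 1 1 >= \det A]) ->
  0 < q1 <= 1 -> 0 < q2 <= 1 -> unstable A q1 q2.
Proof.
rewrite det_mx2 => -[H|[a0 b0 H]] hq1 hq2.
  apply: (charfun_unstable (x := 0)) => //.
  by rewrite /charfun !mulr0 expR0; lra.
have /andP[q10 _] := hq1.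
apply: (charfun_unstable (x := ln (A 0 0) / q1)) => //.
by rewrite /charfun mulrCA divff ?gt_eqF// mulr1 lnK// subrr mul0r; lra.
Qed.

End instability.

(** * The fractional maximum principle *)

Section maximum_principle.
Context {R : realType}.
Notation mu := (@lebesgue_measure R).
Implicit Types (f g h phi : R -> R) (a c t T H : R).

Lemma Rintegral_shift f c : measurable_fun [set: R] f ->
  \int[mu]_x f (x + c) = \int[mu]_x f x.
Proof.
move=> mf; congr fine.
have mE : measurable_fun [set: R] (EFin \o f) by exact/measurable_EFinP.
have mp := measurable_funepos mE; have mn := measurable_funeneg mE.
rewrite -[LHS]/(\int[mu]_x ((EFin \o f) \o (fun x => x + c)%R) x)%E.
rewrite [LHS]integralE [RHS]integralE funepos_comp funeneg_comp.
by congr (_ - _)%E; exact: ge0_integral_shift.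
Qed.

Lemma conv_shift k f c t : measurable_fun [set: R] k -> measurable_fun [set: R] f ->
  conv k (fun s => f (s - c)) t = conv k f (t - c).
Proof.
move=> mk mf; rewrite /conv -[RHS](@Rintegral_shift _ (- c)).
  by apply: eq_Rintegral => s _; congr (k _ * _); ring.
by apply: measurable_funM => //; exact: measurable_fun_reflect.
Qed.

(** The value at [s] is the value at [t] of the convolution with [f] delayed by [t - s], and the
    delayed function lies below [f]. *)
Lemma conv_ndecr k f s t t1 : causal_kernel k -> causal_bounded f ->
  (forall u v, u <= v -> v <= t1 -> f u <= f v) -> s <= t -> t <= t1 ->
  conv k f s <= conv k f t.
Proof.
move=> kk cf fn st tt1; have [mk _ _ _] := kk; have [mf f0 bf] := cf.
have -> : s = t - (t - s) by ring.
rewrite -conv_shift//; apply: conv_le => //.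
  split.
  - by apply: measurableT_comp => //; exact: measurable_funB.
  - by move=> u u0; rewrite f0//; lra.
  - move=> T; have [M HM] := bf T; exists M => u uT; apply: HM; lra.
by move=> u ut; apply: fn; lra.
Qed.

Lemma conv_nincr k f t0 s t : causal_kernel k -> causal_bounded f ->
  (forall u v, 0 < u -> u <= v -> k v <= k u) -> t0 <= s -> s <= t ->
  (forall u, 0 <= f u) -> (forall u, t0 <= u -> f u = 0) ->
  conv k f t <= conv k f s.
Proof.
move=> kk cf kd t0s st f0 fz; apply: le_Rintegral => //; try exact: conv_integrable.
move=> u _; have [ut|tu] := ltP u t0; last by rewrite fz// !mulr0.
by rewrite ler_wpM2r// kd ?subr_gt0 ?lerD2r//; lra.
Qed.

Lemma conv_split k f t0 t : causal_kernel k -> causal_bounded f ->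
  conv k f t = conv k (f \_ (`]-oo, t0[%classic : set R)) t +
    conv k (f \_ (`[t0, +oo[%classic : set R)) t.
Proof.
move=> kk cf; rewrite -convD//; try exact: causal_bounded_restrict.
congr (conv k _ t); apply/funext => s; rewrite !patchE.
have [st|ts] := ltP s t0.
  by rewrite mem_set/= ?in_itv/= ?st// memNset/= ?addr0// in_itv/= andbT leNgt st.
by rewrite memNset/= ?in_itv/= ?ltNge ?ts// add0r mem_set/= ?in_itv/= ?ts.
Qed.

Lemma conv_fker1_nincr phi t0 s t : causal_bounded phi -> s <= t ->
  (forall u, s <= u -> u <= t -> phi u <= 0) ->
  conv (fker 1) phi t <= conv (fker 1) phi s.
Proof.
move=> cphi st phin; have k1 := @fker_kernel R 1 ltr01.
have [_ _ k10 _] := k1.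
rewrite (conv_split s t k1 cphi).
have -> : conv (fker 1) (phi \_ (`]-oo, s[%classic : set R)) t = conv (fker 1) phi s.
  apply: eq_Rintegral => u _; rewrite patchE.
  have [us|su] := ltP u s; last first.
    by rewrite memNset/= ?in_itv/= ?ltNge ?su// mulr0 k10 ?mul0r ?subr_le0.
  by rewrite mem_set/= ?in_itv/= ?us// !fker1 ?subr_gt0// (lt_le_trans us).
have H : conv (fker 1) (phi \_ (`[s, +oo[%classic : set R)) t <= conv (fker 1) (fun u => 0 * heaviside u) t.
  apply: conv_le => //; first exact: causal_bounded_restrict.
    by apply: causal_boundedZ; exact: causal_bounded_heaviside.
  move=> u ut; rewrite mul0r patchE; case: ifPn => //.
  by rewrite inE/= in_itv/= andbT => su; apply: phin => //; exact: ltW.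
rewrite convZ// in H; last exact: causal_bounded_heaviside.
by move: H; rewrite mul0r; lra.
Qed.

(* The convolution of [fker (1 - a)] and the part [G1] of [H - f] after [t0] is
   nondecreasing up to [t2]; hence so is its convolution with [fker a], which is the
   primitive of [G1], and [G1] cannot be negative. *)
Lemma barrier a f phi H t0 t2 : 0 < a < 1 -> 0 <= H -> 0 <= t0 -> causal_bounded phi ->
  f = conv (fker a) phi -> (forall t, t <= t0 -> f t <= H) ->
  (forall t, t0 <= t -> t <= t2 -> phi t <= 0) -> forall t, t <= t2 -> f t <= H.
Proof.
move=> /andP[a0 a1] H0 t00 cphi fE fH phin s st2.
have [st0|t0s] := leP s t0; first exact: fH.
rewrite leNgt; apply/negP => Hfs.
have b0 : 0 < 1 - a by rewrite subr_gt0.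
have ka := fker_kernel a0; have kb := fker_kernel b0; have k1 := @fker_kernel R 1 ltr01.
have a01 : 0 < a <= 1 by rewrite a0 ltW.
have cf : causal_bounded f by rewrite fE; exact: causal_bounded_conv.
have cof : continuous f by rewrite fE; exact: continuous_conv_fker.
have ch := @causal_bounded_heaviside R.
pose G u := H * heaviside u - f u.
have cHh := causal_boundedZ H ch.
have cG : causal_bounded G by exact: causal_boundedB.
pose G0 : R -> R := G \_ (`]-oo, t0[%classic : set R).
pose G1 : R -> R := G \_ (`[t0, +oo[%classic : set R).
have cG0 : causal_bounded G0 by exact: causal_bounded_restrict.
have cG1 : causal_bounded G1 by exact: causal_bounded_restrict.
have G0_ge0 u : 0 <= G0 u.
  have [u0|u0] := ltP u 0; first by have [_ z _] := cG0; rewrite z.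
  rewrite /G0 patchE; case: ifPn => //; rewrite inE/= in_itv/= => ut.
  by rewrite /G heavisideE// mulr1 subr_ge0 fH// ltW.
have G0z u : t0 <= u -> G0 u = 0.
  by move=> tu; rewrite /G0 patchE memNset//= in_itv/= ltNge tu.
have G1z u : u < t0 -> G1 u = 0.
  by move=> tu; rewrite /G1 patchE memNset//= in_itv/= leNgt tu.
have G1E u : t0 <= u -> G1 u = H - f u.
  move=> tu; rewrite /G1 patchE mem_set/= ?in_itv/= ?tu//.
  by rewrite /G heavisideE ?mulr1//; exact: le_trans tu.
pose Psi := conv (fker (1 - a)) G1.
have cPsi : causal_bounded Psi by exact: causal_bounded_conv.
(* J^(1-a) f is the primitive of [phi], so [Psi] has three terms, each nondecreasing between [t0]
   and [t2]: a kernel of order [2 - a], minus the primitive of the nonpositive [phi], and minus the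
   effect of [G0], which is over by [t0] while its kernel decreases. *)
have PsiE u : Psi u = H * fker (1 - a + 1) u - conv (fker 1) phi u - conv (fker (1 - a)) G0 u.
  have := conv_split t0 u kb cG; rewrite -/G0 -/G1 -/(Psi u).
  rewrite (convB _ kb cHh cf) (convZ _ _ kb ch) conv_fker_heaviside// fE.
  by rewrite conv_fkerA// subrK => ->; ring.
have Psi_t0 u : u <= t0 -> Psi u = 0.
  move=> ut; rewrite /Psi (conv_eq (g := fun v => 0 * heaviside v)).
  - by rewrite convZ// mul0r.
  - by have [] := kb.
  - by move=> v vu; rewrite mul0r G1z//; exact: lt_le_trans ut.
have PsiD : Psi = conv (fker (1 - a)) G1 by [].
clearbody Psi; clearbody G0 G1.
have Psi_n1 u v : t0 <= u -> u <= v -> v <= t2 -> Psi u <= Psi v.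
  move=> tu uv vt; rewrite !PsiE.
  have h1 : H * fker (1 - a + 1) u <= H * fker (1 - a + 1) v by apply: ler_wpM2l => //; exact: fkerS_ndecr.
  have h2 : conv (fker 1) phi v <= conv (fker 1) phi u.
    by apply: (@conv_fker1_nincr _ t0) => // w uw wv; apply: phin; lra.
  have h3 : conv (fker (1 - a)) G0 v <= conv (fker (1 - a)) G0 u.
    apply: (@conv_nincr _ _ t0) => // x y x0 xy; apply: fker_nincr => //.
    by rewrite b0/= gerBl ltW.
  exact: lerB (lerB h1 h2) h3.
have Psi_n u v : u <= v -> v <= t2 -> Psi u <= Psi v.
  move=> uv vt; have [tu|ut] := leP t0 u; first exact: Psi_n1.
  rewrite (Psi_t0 u (ltW ut)); have [tv|vt0] := leP t0 v; last by rewrite (Psi_t0 v (ltW vt0)).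
  by rewrite -(Psi_t0 t0 (lexx _)); exact: Psi_n1.
have IG u v : u <= v -> v <= t2 -> conv (fker 1) G1 u <= conv (fker 1) G1 v.
  move=> uv vt; have -> : conv (fker 1) G1 = conv (fker a) Psi.
    have e1 : a + (1 - a) = 1 by ring.
    by rewrite PsiD (conv_fkerA a0 b0 cG1) e1.
  exact: conv_ndecr Psi_n uv vt.
(* By continuity [G1 <= - e] on some [[s - d, s]], so the primitive of [G1] strictly decreases
   there, against [IG]. *)
pose e := (f s - H) / 2.
have e0 : 0 < e by rewrite divr_gt0// subr_gt0.
have : \forall t \near s, H + e < f t by apply: (cvgr_gt _ (cof s)); rewrite /e; lra.
case/nbhs_ballP => r /= r0 br.
pose d := Num.min (r / 2) (s - t0).
have d0 : 0 < d by rewrite lt_min divr_gt0// subr_gt0.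
have dr : d <= r / 2 by rewrite /d ge_min lexx.
have dt : d <= s - t0 by rewrite /d ge_min lexx orbT.
have Hlow u : s - d <= u -> u <= s -> G1 u <= - e.
  move=> du us; rewrite G1E; last by lra.
  have : H + e < f u by apply: br; rewrite /ball/= ger0_norm ?subr_ge0//; lra.
  lra.
have sd0 : 0 <= s - d by lra.
have csh := causal_bounded_shift sd0.
have HI : conv (fker 1) (G1 \_ (`[s - d, +oo[%classic : set R)) s <= - e * fker (1 + 1) d.
  rewrite [X in fker _ X](_ : d = s - (s - d)); last by ring.
  rewrite -conv_fker_shift// -convZ//; apply: conv_le => //.
  - exact: causal_bounded_restrict.
  - exact: causal_boundedZ.
  - move=> u us; rewrite patchE; case: ifPn => [|/negP].
      rewrite inE/= in_itv/= andbT => h; rewrite heavisideE ?subr_ge0// mulr1.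
      by apply: Hlow => //; exact: ltW.
    rewrite inE/= in_itv/= andbT => /negP; rewrite -ltNge => h.
    by rewrite heaviside_lt0 ?mulr0// subr_lt0.
have := IG (s - d) s; rewrite (conv_split (s - d) s k1 cG1).
have -> : conv (fker 1) (G1 \_ (`]-oo, (s - d)[%classic : set R)) s = conv (fker 1) G1 (s - d).
  have [_ _ k10 _] := k1.
  apply: eq_Rintegral => u _; rewrite patchE.
  have [us|su] := ltP u (s - d); last first.
    by rewrite memNset/= ?in_itv/= ?ltNge ?su// mulr0 k10 ?mul0r ?subr_le0.
  by rewrite mem_set/= ?in_itv/= ?us// !fker1 ?subr_gt0//; lra.
have kd0 : 0 < fker (1 + 1) d by exact: fker_gt0.
have : 0 < e * fker (1 + 1) d by rewrite mulr_gt0.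
by move=> h1 /(_ _ st2); rewrite mulNr in HI; lra.
Qed.

(* If [f t > H' > H], let [s0] be the last time up to which [f <= H'] holds: while [f > H]
   the source [c * (h - f)] is nonpositive, so [f] cannot cross the level [H'] at [s0]. *)
Lemma fractional_max_principle a c f h T H : 0 < a < 1 -> 0 < c -> 0 <= H ->
  causal_bounded f -> causal_bounded h ->
  f = conv (fker a) (fun s => c * (h s - f s)) ->
  (forall s, s <= T -> h s <= H) -> forall t, t <= T -> f t <= H.
Proof.
move=> a01 c0 H0 cf ch fE hH t tT.
have /andP[a0 a1] := a01.
pose phi s := c * (h s - f s).
have cphi : causal_bounded phi by apply: causal_boundedZ; exact: causal_boundedB.
have cof : continuous f.
  by rewrite fE; apply: continuous_conv_fker => //; rewrite a0 ltW.
have [_ f0 _] := cf.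
have fz u : u <= 0 -> f u = 0.
  move=> u0; rewrite fE conv_lt0//; first exact: fker_kernel.
  by have [] := cphi.
rewrite leNgt; apply/negP => Hft.
pose H' := (H + f t) / 2.
have HH' : H < H' by rewrite /H'; lra.
have H'f : H' < f t by rewrite /H'; lra.
pose S := [set s | s <= t /\ forall u, u <= s -> f u <= H'].
have t0 : 0 <= t by rewrite leNgt; apply/negP => /ltW/fz; lra.
have S0 : S 0.
  by split=> // u u0; rewrite fz//; lra.
have hS : has_sup S by split; [exists 0|exists t => s []].
pose s0 := sup S.
have s00 : 0 <= s0 by exact: ub_le_sup hS.2 _ S0.
have fs0 u : u < s0 -> f u <= H'.
  move=> us; have su : 0 < s0 - u by rewrite subr_gt0.
  have [v [_ Hv] uv] := sup_adherent su hS; apply: Hv; move: uv; rewrite -/s0; lra.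
have Ss0 u : u <= s0 -> f u <= H'.
  rewrite le_eqVlt => /predU1P[->|]; last exact: fs0.
  rewrite leNgt; apply/negP => Hf.
  have : \forall t \near s0, H' < f t by apply: (cvgr_gt _ (cof s0)).
  case/nbhs_ballP => e /= e0 be.
  have : H' < f (s0 - e / 2).
    by apply: be; rewrite /ball/= opprB addrC subrK ger0_norm; lra.
  by have := fs0 (s0 - e / 2); lra.
have s0t : s0 < t.
  have : s0 <= t by apply: ge_sup; [exists 0|move=> s []].
  rewrite le_eqVlt => /predU1P[E|//]; have := Ss0 s0 (lexx _); rewrite E; lra.
have [d d0 [dt Hd]] : exists2 d, 0 < d & s0 + d <= t /\ forall u, u <= s0 + d -> f u <= H'.
  have [Hs|Hs] := ltP (f s0) H'.
    have : \forall t \near s0, f t < H' by apply: (cvgr_lt _ (cof s0)).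
    case/nbhs_ballP => e /= e0 be.
    exists (Num.min (e / 2) (t - s0)); first by rewrite lt_min divr_gt0// subr_gt0.
    split; first by rewrite -lerBrDl ge_min lexx orbT.
    move=> u; rewrite -lerBlDl le_min => /andP[ue ut].
    have [us|su] := leP u s0; first exact: Ss0.
    apply: ltW; apply: be; rewrite /ball/= distrC ger0_norm ?subr_ge0 ?ltW//; lra.
  have Hs' : H < f s0 by lra.
  have : \forall t \near s0, H < f t by apply: (cvgr_gt _ (cof s0)).
  case/nbhs_ballP => e /= e0 be.
  exists (Num.min (e / 2) (t - s0)); first by rewrite lt_min divr_gt0// subr_gt0.
  split; first by rewrite -lerBrDl ge_min lexx orbT.
  apply: (@barrier a f phi H' s0) => //; first by lra.
  move=> u su; rewrite -lerBlDl le_min => /andP[ue ut].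
  have hu : h u <= H by apply: hH; lra.
  have fu : H < f u by apply: be; rewrite /ball/= distrC ger0_norm ?subr_ge0//; lra.
  by rewrite /phi pmulr_rle0// subr_le0; lra.
have : s0 + d <= s0 by apply: ub_le_sup; [exact: hS.2|split].
by lra.
Qed.

End maximum_principle.

(** * Real resolvents *)

Section real_resolvents.
Context {R : realType}.
Notation mu := (@lebesgue_measure R).
Implicit Types (f g h : R -> R) (a c s t T H : R) (r : nat).

(** The resolvent kernel of ordinary integration: [h + s * conv (expker s) h] solves
    [f - s * conv (fker 1) f = h]. *)
Definition expker s : R -> R := (fun u => expR (s * u)) \_ (`]0, +oo[%classic : set R).

Lemma expkerE s u : 0 < u -> expker s u = expR (s * u).
Proof. by move=> u0; rewrite /expker patchE mem_set//= in_itv/= u0. Qed.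

Lemma expker_le0 s u : u <= 0 -> expker s u = 0.
Proof.
by move=> u0; rewrite /expker patchE memNset//= in_itv/= andbT; apply/negP; rewrite -leNgt.
Qed.

Lemma integral_expR s t : 0 < s -> 0 < t ->
  (\int[mu]_(u in `]0%R, t[) (expR (s * u))%:E = ((expR (s * t) - 1) / s)%:E)%E.
Proof.
move=> s0 t0.
have ds (u : R) : is_derive u 1 (fun u => expR (s * u) / s) (expR (s * u)).
  have d1 : is_derive (u : R) (1 : R) (fun v : R => s * v) s.
    by rewrite -[X in is_derive _ _ _ X]mulr1; exact: is_deriveZ.
  have d2 : is_derive u 1 (expR \o (fun v => s * v)) (s * expR (s * u)).
    by rewrite mulrC; apply: is_derive1_comp.
  have -> : expR (s * u) = s^-1 *: (s * expR (s * u)) by rewrite /GRing.scale/= mulKf ?gt_eqF.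
  have -> : (fun u => expR (s * u) / s) = s^-1 \*: (expR \o (fun v => s * v)).
    by apply/funext => v; rewrite /GRing.scale/= mulrC.
  exact: is_deriveZ.
rewrite (@ge0_integral_FTC_at0 _ _ (fun u => expR (s * u) / s))//.
- by rewrite mulr0 expR0 mulrBl.
- move=> u _; apply: continuous_cvg; first exact: continuous_expR.
  by apply: cvgM; [exact: cvg_cst|exact: cvg_id].
- by move=> u _; have [] := ds u; rewrite derive1E.
- have c0 : {for 0, continuous (fun u => expR (s * u) / s)}.
    by apply: differentiable_continuous; apply/derivable1_diffP; have [] := ds 0.
  exact: cvg_at_right_filter c0.
Qed.

Lemma expker_kernel s : 0 < s -> causal_kernel (expker s).
Proof.
move=> s0; split.
- apply/(measurable_restrictT _ _).1 => //; apply: measurable_funTS.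
  by apply: measurableT_comp; [exact: measurable_expR|exact: measurable_funM].
- by move=> u; apply: restrict_ge0 => v _; exact: expR_ge0.
- exact: expker_le0.
move=> T; have [T0|T0] := ltP 0 T; last first.
  by rewrite set_itv_ge ?integral_set0 ?ltry// bnd_simp -leNgt.
have -> : (\int[mu]_(u in `]0%R, T[) (expker s u)%:E = \int[mu]_(u in `]0%R, T[) (expR (s * u))%:E)%E.
  by apply: eq_integral => u; rewrite inE/= in_itv/= => /andP[u0 _]; rewrite expkerE.
by rewrite integral_expR// ltry.
Qed.

Lemma conv_fker1_expker s u : 0 < s ->
  (\int[mu]_v (fker 1 (u - v) * expker s v)%:E = ((expker s u - fker 1 u) / s)%:E)%E.
Proof.
move=> s0; have [u0|u0] := ltP 0 u; last first.
  rewrite expker_le0// fker_le0// subrr mul0r (eq_integral (fun=> 0%E)) ?integral0//.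
  move=> v _; have [v0|v0] := leP v 0; first by rewrite expker_le0// mulr0.
  by rewrite fker_le0 ?mul0r//; lra.
rewrite expkerE// fker1// -integral_expR// [RHS]integral_mkcond.
apply: eq_integral => v _; rewrite patchE; case: ifPn => [|/negP].
  by rewrite inE/= in_itv/= => /andP[v0 vu]; rewrite expkerE// fker1 ?subr_gt0// mul1r.
rewrite inE/= in_itv/= => /negP; rewrite negb_and -!leNgt => /orP[v0|uv].
  by rewrite expker_le0// mulr0.
by rewrite fker_le0 ?mul0r// subr_le0.
Qed.

Lemma volterra_exp s h : 0 < s -> causal_bounded h ->
  exists2 f, causal_bounded f & forall t, f t - s * conv (fker 1) f t = h t.
Proof.
move=> s0 ch; have ke := expker_kernel s0; have k1 := @fker_kernel R 1 ltr01.
have ceh := causal_bounded_conv ke ch.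
have csh := causal_boundedZ s ceh.
exists (fun t => h t + s * conv (expker s) h t); first exact: causal_boundedD.
move=> t; rewrite (convD _ k1 ch csh) (convZ _ _ k1 ceh).
have -> : conv (fker 1) (conv (expker s) h) t = (conv (expker s) h t - conv (fker 1) h t) / s.
  have [m1 k1_ge0 _ _] := k1; have [me ke_ge0 _ _] := ke; have [mh _ _] := ch.
  have i1 := conv_integrable t ke ch; have i2 := conv_integrable t k1 ch.
  have i3 := integrableB measurableT i1 i2.
  have i4 : mu.-integrable setT (EFin \o (fun v => expker s (t - v) * h v - fker 1 (t - v) * h v)).
    by move: i3; apply: eq_integrable.
  rewrite (@conv_assoc R (fker 1) (expker s) (fun u => (expker s u - fker 1 u) / s))//.
  - rewrite /conv -RintegralB// -RintegralZr//; apply: eq_Rintegral => v _; ring.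
  - by move=> u; exact: conv_fker1_expker.
  - have := integrableZl measurableT s^-1 i4; apply: eq_integrable => // v _.
    by rewrite /= -EFinM; congr EFin; ring.
by field; rewrite gt_eqF.
Qed.

Definition dyadic r : R := 2^-1 ^+ r.

Lemma dyadic_gt0 r : 0 < dyadic r. Proof. by rewrite exprn_gt0. Qed.

Lemma dyadicS r : dyadic r.+1 + dyadic r.+1 = dyadic r.
Proof. by rewrite /dyadic exprS; field. Qed.

Lemma dyadic_lt1 r : (0 < r)%N -> dyadic r < 1.
Proof. by move=> r0; rewrite exprn_ilt1 -?lt0n//; lra. Qed.

Lemma fker_dyadic r : causal_kernel (fker (dyadic r)).
Proof. exact/fker_kernel/dyadic_gt0. Qed.

Lemma conv_dyadicS r f : causal_bounded f ->
  conv (fker (dyadic r.+1)) (conv (fker (dyadic r.+1)) f) = conv (fker (dyadic r)) f.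
Proof. by move=> cf; rewrite (conv_fkerA (dyadic_gt0 _) (dyadic_gt0 _) cf) dyadicS. Qed.

(** Difference of squares: for J of order [dyadic r.+1], J J has order [dyadic r], and [1 - s J] is
    inverted by applying [1 + s J] after the inverse of [1 - s^2 J J]. Solutions may grow in time;
    only existence is at stake. *)
Lemma resolvent_pos r s h : 0 < s -> causal_bounded h ->
  exists2 f, causal_bounded f & forall t, f t - s * conv (fker (dyadic r)) f t = h t.
Proof.
elim: r s => [|r IH] s s0 ch; first by rewrite /dyadic expr0; exact: volterra_exp.
have [f cf E] := IH (s * s) (mulr_gt0 s0 s0) ch.
have kr := fker_dyadic r.+1; have cJ := causal_bounded_conv kr cf.
have csJ := causal_boundedZ s cJ.
exists (fun t => f t + s * conv (fker (dyadic r.+1)) f t); first exact: causal_boundedD.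
move=> t; rewrite (convD _ kr cf csJ) (convZ _ _ kr cJ) (conv_dyadicS _ cf) -E; ring.
Qed.

(** The other factor of the same difference of squares gives the inverse of [1 + c J]. The equation
    is put in the form that [fractional_max_principle] takes. *)
Lemma resolvent_neg r c h : (0 < r)%N -> 0 < c -> causal_bounded h ->
  exists2 f, causal_bounded f & f = conv (fker (dyadic r)) (fun t => c * (h t - f t)).
Proof.
case: r => // r _ c0 ch; have [f cf E] := resolvent_pos r (mulr_gt0 c0 c0) ch.
have kr := fker_dyadic r.+1; have cJ := causal_bounded_conv kr cf.
have csJ := causal_boundedZ c cJ.
pose v t := f t - c * conv (fker (dyadic r.+1)) f t.
have cv : causal_bounded v by exact: causal_boundedB.
have Ev t : v t + c * conv (fker (dyadic r.+1)) v t = h t.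
  rewrite /v (convB _ kr cf csJ) (convZ _ _ kr cJ) (conv_dyadicS _ cf) -E; ring.
exists (fun t => h t - v t); first exact: causal_boundedB.
apply/funext => t.
rewrite (_ : (fun u => c * (h u - (h u - v u))) = (fun u => c * v u)); last first.
  by apply/funext => u; ring.
by rewrite (convZ _ _ kr cv) -Ev; ring.
Qed.

End real_resolvents.

(** * Fractional integrals of complex functions *)

Section complex_operators.
Context {R : realType}.
Notation C := (R[i]).
Implicit Types (F G : R -> C) (c t T H : R) (r : nat) (s : C).

Definition ccausal F := causal_bounded (fun t => complex.Re (F t)) /\
  causal_bounded (fun t => complex.Im (F t)).

Definition frac r F t : C := Complex (conv (fker (dyadic r)) (fun u => complex.Re (F u)) t)
  (conv (fker (dyadic r)) (fun u => complex.Im (F u)) t).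

Lemma eq_complexP (z w : C) : complex.Re z = complex.Re w -> complex.Im z = complex.Im w -> z = w.
Proof. by case: z w => [a b] [a' b'] /= -> ->. Qed.

Lemma ReM (z w : C) : complex.Re (z * w) = complex.Re z * complex.Re w - complex.Im z * complex.Im w.
Proof. by case: z w => [a b] [a' b']. Qed.

Lemma ImM (z w : C) : complex.Im (z * w) = complex.Re z * complex.Im w + complex.Im z * complex.Re w.
Proof. by case: z w => [a b] [a' b']. Qed.

Lemma ReD (z w : C) : complex.Re (z + w) = complex.Re z + complex.Re w.
Proof. by case: z w => [a b] [a' b']. Qed.

Lemma ImD (z w : C) : complex.Im (z + w) = complex.Im z + complex.Im w.
Proof. by case: z w => [a b] [a' b']. Qed.

Lemma ReB (z w : C) : complex.Re (z - w) = complex.Re z - complex.Re w.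
Proof. by case: z w => [a b] [a' b']. Qed.

Lemma ImB (z w : C) : complex.Im (z - w) = complex.Im z - complex.Im w.
Proof. by case: z w => [a b] [a' b']. Qed.

Lemma normc_ge0 (z : C) : 0 <= normc z.
Proof. by case: z => a b; exact: sqrtr_ge0. Qed.

Lemma normc_sqr (z : C) : normc z ^+ 2 = complex.Re z ^+ 2 + complex.Im z ^+ 2.
Proof. by case: z => a b; rewrite sqr_sqrtr// addr_ge0 ?sqr_ge0. Qed.

Lemma Re_le_normc (z : C) : complex.Re z <= normc z.
Proof.
apply: le_trans (ler_norm _) _; rewrite -sqrtr_sqr; case: z => a b /=.
by apply: ler_wsqrtr; rewrite lerDl sqr_ge0.
Qed.

Lemma normc_real (a : R) : normc (a%:C)%C = `|a|.
Proof. by rewrite /= expr0n addr0 sqrtr_sqr. Qed.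

Lemma ccausal_comb F G s s' : ccausal F -> ccausal G -> ccausal (fun t => s * F t + s' * G t).
Proof.
move=> [rF iF] [rG iG]; split.
- under eq_fun do rewrite ReD !ReM.
  by apply: causal_boundedD; apply: causal_boundedB; exact: causal_boundedZ.
- under eq_fun do rewrite ImD !ImM.
  by apply: causal_boundedD; apply: causal_boundedD; exact: causal_boundedZ.
Qed.

Lemma ccausal0 : ccausal (fun=> 0).
Proof.
have c0 : causal_bounded (fun=> 0 : R).
  have := causal_boundedZ 0 (@causal_bounded_heaviside R).
  by under [X in causal_bounded X -> _]eq_fun do rewrite mul0r.
by split.
Qed.

Lemma ccausalZ F s : ccausal F -> ccausal (fun t => s * F t).
Proof.
move=> cF; have := ccausal_comb s 0 cF cF.
by under [X in ccausal X -> _]eq_fun do rewrite mul0r addr0.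
Qed.

Lemma ccausalD F G : ccausal F -> ccausal G -> ccausal (fun t => F t + G t).
Proof.
move=> cF cG; have := ccausal_comb 1 1 cF cG.
by under [X in ccausal X -> _]eq_fun do rewrite !mul1r.
Qed.

Lemma ccausalB F G : ccausal F -> ccausal G -> ccausal (fun t => F t - G t).
Proof.
move=> cF cG; have := ccausal_comb 1 (-1) cF cG.
by under [X in ccausal X -> _]eq_fun do rewrite mul1r mulN1r.
Qed.

Lemma ccausal_frac r F : ccausal F -> ccausal (frac r F).
Proof.
move=> [rF iF].
by split; [exact: causal_bounded_conv (fker_dyadic r) rF|exact: causal_bounded_conv (fker_dyadic r) iF].
Qed.

Lemma frac_comb r F G s s' t : ccausal F -> ccausal G ->
  frac r (fun t => s * F t + s' * G t) t = s * frac r F t + s' * frac r G t.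
Proof.
move=> [rF iF] [rG iG]; have kr := @fker_dyadic R r; apply: eq_complexP.
- rewrite ReD !ReM /=; under eq_fun do rewrite ReD !ReM.
  by rewrite convD ?convB ?convZ//; try (apply: causal_boundedB); exact: causal_boundedZ.
- rewrite ImD !ImM /=; under eq_fun do rewrite ImD !ImM.
  by rewrite !convD ?convZ//; try (apply: causal_boundedD); exact: causal_boundedZ.
Qed.

Lemma fracZ r F s t : ccausal F -> frac r (fun t => s * F t) t = s * frac r F t.
Proof.
move=> cF; have := frac_comb r s 0 t cF cF.
by under [X in frac r X]eq_fun do rewrite mul0r addr0; rewrite mul0r addr0.
Qed.

Lemma fracD r F G t : ccausal F -> ccausal G ->
  frac r (fun t => F t + G t) t = frac r F t + frac r G t.
Proof.
move=> cF cG; have := frac_comb r 1 1 t cF cG.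
by under [X in frac r X]eq_fun do rewrite !mul1r; rewrite !mul1r.
Qed.

Lemma fracB r F G t : ccausal F -> ccausal G ->
  frac r (fun t => F t - G t) t = frac r F t - frac r G t.
Proof.
move=> cF cG; have := frac_comb r 1 (-1) t cF cG.
by under [X in frac r X]eq_fun do rewrite mul1r mulN1r; rewrite mul1r mulN1r.
Qed.

Lemma frac0 r t : frac r (fun=> 0) t = 0.
Proof.
have := fracZ r 0 t ccausal0.
by under [X in frac r X]eq_fun do rewrite mul0r; rewrite mul0r.
Qed.

Lemma fracS r F : ccausal F -> frac r.+1 (frac r.+1 F) = frac r F.
Proof.
move=> [rF iF]; apply/funext => t; apply: eq_complexP.
- by have /(congr1 (fun f => f t)) := conv_dyadicS r rF; apply: etrans.
- by have /(congr1 (fun f => f t)) := conv_dyadicS r iF; apply: etrans.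
Qed.

(* Rotating by the conjugate of [F t] reduces the bound to the real maximum principle. *)
Lemma frac_contraction r c F G T H : (0 < r)%N -> 0 < c -> ccausal F -> ccausal G ->
  (forall t, F t = (c%:C)%C * frac r (fun u => G u - F u) t) ->
  (forall t, t <= T -> normc (G t) <= H) -> forall t, t <= T -> normc (F t) <= H.
Proof.
move=> r0 c0 cF cG E GH t tT.
have H0 : 0 <= H by exact: le_trans (normc_ge0 _) (GH _ tT).
pose w := conjc (F t).
have wF : normc w = normc (F t) by rewrite /w; case: (F t) => a b /=; rewrite sqrrN.
have [cwF _] := ccausalZ w cF; have [cwG _] := ccausalZ w cG.
have key : complex.Re (w * F t) <= normc w * H.
  apply: (@fractional_max_principle R (dyadic r) c (fun t => complex.Re (w * F t))
    (fun t => complex.Re (w * G t)) T) => //.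
  - by rewrite dyadic_gt0 dyadic_lt1.
  - by rewrite mulr_ge0// normc_ge0.
  - apply/funext => u.
    have cGF := ccausalB cG cF; have kr := @fker_dyadic R r.
    have [rGF iGF] := cGF.
    have -> : (fun u => c * (complex.Re (w * G u) - complex.Re (w * F u))) =
        (fun u => c * (complex.Re w * complex.Re (G u - F u) - complex.Im w * complex.Im (G u - F u))).
      by apply/funext => v; rewrite !ReM ReB ImB; congr (_ * _); ring.
    rewrite convZ//; last by apply: causal_boundedB; exact: causal_boundedZ.
    rewrite convB//; try exact: causal_boundedZ.
    rewrite !convZ// E ReM ReM ImM/= !mul0r; ring.
  - move=> u uT; apply: le_trans (Re_le_normc _) _.
    by rewrite normcM ler_wpM2l ?normc_ge0 ?GH.
have E2 : complex.Re (w * F t) = normc (F t) ^+ 2.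
  by rewrite normc_sqr /w ReM; case: (F t) => a b /=; ring.
rewrite E2 wF in key.
have [->|n0] := eqVneq (normc (F t)) 0; first exact: H0.
by rewrite -(@ler_pM2l _ (normc (F t))) ?lt_neqAle 1?eq_sym ?n0 ?normc_ge0// -expr2.
Qed.

Lemma frac_kernel0 r c F : (0 < r)%N -> 0 < c -> ccausal F ->
  (forall t, F t + (c%:C)%C * frac r F t = 0) -> forall t, F t = 0.
Proof.
move=> r0 c0 cF E t; apply: eq0_normc; apply/eqP; rewrite eq_le normc_ge0 andbT.
apply: (@frac_contraction r c F (fun=> 0) t 0) => //; first exact: ccausal0.
- move=> u; rewrite (fracB _ _ ccausal0 cF) frac0 sub0r mulrN.
  by apply/eqP; rewrite -subr_eq0 opprK E.
- by move=> u _; rewrite normc0.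
Qed.

Lemma frac_resolvent r c F : (0 < r)%N -> 0 < c -> ccausal F ->
  exists2 G, ccausal G & forall t, G t = (c%:C)%C * frac r (fun u => F u - G u) t.
Proof.
move=> r0 c0 [rF iF]; have kr := @fker_dyadic R r.
have [f cf Ef] := resolvent_neg r0 c0 rF; have [g cg Eg] := resolvent_neg r0 c0 iF.
exists (fun t => Complex (f t) (g t)); first by split.
move=> t; apply: eq_complexP.
- rewrite ReM/= mul0r subr0 {1}Ef convZ//; last exact: causal_boundedB.
  by congr (_ * conv _ _ _); apply/funext => u; rewrite ReB.
- rewrite ImM/= mul0r addr0 {1}Eg convZ//; last exact: causal_boundedB.
  by congr (_ * conv _ _ _); apply/funext => u; rewrite ImB.
Qed.

End complex_operators.

(** * Uniform bounds for a single factor *)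

Section stable_factors.
Context {R : realType}.
Notation C := (R[i]).
Implicit Types (F G K W : R -> C) (c t T H : R) (r : nat) (s : C).

Lemma ccausal_comb3 W F G K s1 s2 s3 : ccausal F -> ccausal G -> ccausal K ->
  (forall u, W u = s1 * F u + s2 * G u + s3 * K u) -> ccausal W.
Proof.
move=> cF cG cK /funext ->; apply: ccausalD; first exact: ccausal_comb.
exact: ccausalZ.
Qed.

Lemma frac_comb3 r W F G K s1 s2 s3 : ccausal F -> ccausal G -> ccausal K ->
  (forall u, W u = s1 * F u + s2 * G u + s3 * K u) ->
  forall t, frac r W t = s1 * frac r F t + s2 * frac r G t + s3 * frac r K t.
Proof.
move=> cF cG cK /funext -> t.
by rewrite (fracD _ _ (ccausal_comb s1 s2 cF cG) (ccausalZ s3 cK)) frac_comb// fracZ.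
Qed.

Lemma ccausal_norm_le F T : ccausal F -> exists M, forall t, t <= T -> normc (F t) <= M.
Proof.
move=> [[_ _ bR] [_ _ bI]]; have [M HM] := bR T; have [N HN] := bI T.
exists (M + N) => t tT.
have -> : F t = ((complex.Re (F t))%:C + 'i * (complex.Im (F t))%:C)%C by rewrite -complexE.
apply: le_trans (le_normcD _ _) _; rewrite normcM !normc_real.
rewrite [normc 'i%C]/= expr0n/= add0r expr1n sqrtr1 mul1r.
by rewrite lerD ?HM ?HN.
Qed.

(** An a priori estimate only: existence of an inverse is not claimed. The constant does not depend
    on [T], and the bounds up to [T] require no global bound on [F]. *)
Definition bounded_inverse r s := exists2 M, 0 <= M & forall T H F, ccausal F ->
  (forall t, t <= T -> normc (F t - s * frac r F t) <= H) ->
  forall t, t <= T -> normc (F t) <= M * H.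

(* With [J = frac r], [G = F - s J F] and [c] large enough for [|c + s| < c]:
   [F = ((c + s) / c) X + G - Z] where [X = c J (F - X)] and [Z = c J (G - Z)] are
   contractions of [F] and [G]. *)
Lemma bounded_inverse_left r s : (0 < r)%N -> complex.Re s < 0 -> bounded_inverse r s.
Proof.
move=> r0 s0; set n := normc s.
have n0 : 0 < n.
  rewrite lt_neqAle normc_ge0 andbT eq_sym; apply: contraTN s0 => /eqP/eq0_normc ->.
  by rewrite ltxx.
(* With this choice [|c + s|^2 = c^2 + 2 c Re s + |s|^2 = c^2 - |s|^2], hence [k < 1]. *)
pose c := n ^+ 2 / - complex.Re s.
have c0 : 0 < c by rewrite divr_gt0 ?exprn_gt0 ?oppr_gt0.
have cC : (c%:C)%C != 0 :> C by rewrite eq_complex/= gt_eqF.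
pose k := normc ((c%:C)%C + s) / c.
have k0 : 0 <= k by rewrite divr_ge0 ?normc_ge0// ltW.
have k1 : k < 1.
  rewrite ltr_pdivrMr// mul1r -(@ltr_pXn2r _ 2)// ?nnegrE ?normc_ge0 ?(ltW c0)//.
  rewrite normc_sqr ReD ImD/= add0r.
  have E : complex.Re s ^+ 2 + complex.Im s ^+ 2 = n ^+ 2 by rewrite normc_sqr.
  have Ec : c * complex.Re s = - n ^+ 2 by rewrite /c; field; rewrite lt_eqF.
  have n20 : 0 < n ^+ 2 by rewrite exprn_gt0.
  have -> : (c + complex.Re s) ^+ 2 + complex.Im s ^+ 2 =
    c ^+ 2 + (c * complex.Re s) *+ 2 + (complex.Re s ^+ 2 + complex.Im s ^+ 2) by ring.
  by rewrite E Ec; lra.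
exists (2 / (1 - k)); first by rewrite divr_ge0// subr_ge0 ltW.
move=> T H F cF GH.
have cJF := ccausal_frac r cF; have cJJF := ccausal_frac r cJF.
pose G t := F t - s * frac r F t.
have cG : ccausal G by apply: ccausalB => //; exact: ccausalZ.
have [X cX EX] := frac_resolvent r0 c0 cF.
have [Z cZ EZ] := frac_resolvent r0 c0 cG.
pose q := ((c%:C)%C + s) / (c%:C)%C.
pose D t := s * frac r F t - q * X t + Z t.
have ED u : D u = s * frac r F u + (- q) * X u + 1 * Z u by rewrite /D; ring.
have cD := ccausal_comb3 cJF cX cZ ED.
have EJX t : frac r (fun u => F u - X u) t = frac r F t - frac r X t by rewrite fracB.
have EJZ t : frac r (fun u => G u - Z u) t = frac r F t - s * frac r (frac r F) t - frac r Z t.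
  by rewrite fracB// fracB ?fracZ//; exact: ccausalZ.
have D0 : forall t, D t = 0.
  apply: (frac_kernel0 r0 c0 cD) => t.
  rewrite (frac_comb3 r cJF cX cZ ED) ED.
  have := EX t; have := EZ t; rewrite EJX EJZ => e1 e2.
  rewrite {1}e1 {1}e2 /q; field; exact: cC.
have FE t : F t = G t + q * X t - Z t.
  by apply/eqP; rewrite -subr_eq0 -(D0 t) /D /G; apply/eqP; ring.
have nq : normc q = k by rewrite /q normcM normcV normc_real gtr0_norm.
have [M HM] := ccausal_norm_le T cF.
(* The supremum is finite because [F] is bounded up to [T]; the decomposition bounds it by [2 H]
   plus [k] times itself, which gives the constant [2 / (1 - k)]. *)
pose S := [set normc (F t) | t in [set t | t <= T]].
have hS : has_sup S.
  split; first by exists (normc (F T)), T => //=.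
  by exists M => _ [t tT <-]; exact: HM.
have FS u : u <= T -> normc (F u) <= sup S.
  by move=> uT; apply: ub_le_sup; [exact: hS.2|exists u].
have FN u : u <= T -> normc (F u) <= H + k * sup S + H.
  move=> uT; rewrite FE.
  apply: le_trans (le_normcD _ _) _; rewrite normcN.
  apply: lerD; last exact: (frac_contraction r0 c0 cZ cG EZ GH).
  apply: le_trans (le_normcD _ _) _; apply: lerD; first exact: GH.
  by rewrite normcM nq ler_wpM2l// (frac_contraction r0 c0 cX cF EX FS).
have SN : sup S <= H + k * sup S + H.
  by apply: ge_sup; [exact: hS.1|move=> _ [u uT <-]; exact: FN].
move=> t tT; apply: le_trans (FS t tT) _.
have k2 : 0 < 1 - k by rewrite subr_gt0.
by rewrite mulrAC ler_pdivlMr//; move: (sup S) SN => S' SN; lra.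
Qed.

Let sub_flip (z1 z2 z3 : C) : z1 = z2 - z3 -> z3 = z2 - z1.
Proof. by move=> ->; rewrite subKr. Qed.

(* With [J = frac r.+1], so that [J J = K = frac r]: the function
   [y = (J/(1+J) + K/(1+K) - 2 JK/((1+J)(1+K))) G] is bounded by contraction and solves
   [y + K y = J G], and [W = F + y / s] satisfies
   [W - s^2 K W = G + (1/s + s) y]. *)
Lemma bounded_inverse_step r s : (0 < r)%N -> s != 0 ->
  bounded_inverse r (s ^+ 2) -> bounded_inverse r.+1 s.
Proof.
move=> r0 s0 [M M0 HM].
pose n := normc s^-1; pose b := normc (s^-1 + s).
have n0 : 0 <= n by exact: normc_ge0.
have b0 : 0 <= b by exact: normc_ge0.
exists (M * (1 + b * 4) + n * 4).
  by rewrite addr_ge0 ?mulr_ge0// addr_ge0 ?mulr_ge0.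
move=> T H F cF GH.
pose J := @frac R r.+1; pose K := @frac R r.
have JJ W : ccausal W -> J (J W) = K W by exact: fracS.
have cJ W : ccausal W -> ccausal (J W) by exact: ccausal_frac.
have cJF := cJ _ cF; have cJJF := cJ _ cJF.
have cKF : ccausal (K F) by exact: ccausal_frac.
pose G t := F t - s * J F t.
have cG : ccausal G by apply: ccausalB => //; exact: ccausalZ.
have one0 : (0 : R) < 1 by [].
have oneC : ((1 : R)%:C)%C = 1 :> C by [].
have [v cv Ev] := frac_resolvent (ltn0Sn r) one0 cG.
have [w cw Ew] := frac_resolvent r0 one0 cG.
have [p cp Ep] := frac_resolvent (ltn0Sn r) one0 cw.
have vH := frac_contraction (ltn0Sn r) one0 cv cG Ev GH.
have wH := frac_contraction r0 one0 cw cG Ew GH.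
have pH := frac_contraction (ltn0Sn r) one0 cp cw Ep wH.
have EJv t : J v t = J G t - v t by have := Ev t; rewrite oneC mul1r (fracB _ _ cG cv); exact: sub_flip.
have EKw t : K w t = K G t - w t by have := Ew t; rewrite oneC mul1r (fracB _ _ cG cw); exact: sub_flip.
have EJp t : J p t = J w t - p t by have := Ep t; rewrite oneC mul1r (fracB _ _ cw cp); exact: sub_flip.
(* Formally [y = (J + K) / ((1 + J) (1 + K)) G = J / (1 + K) G], since [K = J J]. Written this way,
   [y] is a sum of contractions, bounded by [(1 + 1 + 2) H]. *)
pose y t := v t + w t - 2 * p t.
have Ey u : y u = 1 * v u + 1 * w u + (-2) * p u by rewrite /y; ring.
have cy := ccausal_comb3 cv cw cp Ey.
have yH u : u <= T -> normc (y u) <= 4 * H.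
  move=> uT.
  have -> : y u = v u + w u - p u - p u by rewrite /y; ring.
  apply: le_trans (le_normcD _ _) _; rewrite normcN.
  have := vH _ uT; have := wH _ uT; have := pH _ uT.
  have := le_normcD (v u + w u) (- p u); rewrite normcN.
  have := le_normcD (v u) (w u).
  move: (normc _) (normc _) (normc _) (normc _) (normc _); move=> *; lra.
have cJG := cJ _ cG; have cKG : ccausal (K G) by exact: ccausal_frac.
have cJw := cJ _ cw; have cKy : ccausal (K y) by exact: ccausal_frac.
have cKw : ccausal (K w) by exact: ccausal_frac.
have EJy t : y t + J y t = J G t + w t - J w t.
  have -> := frac_comb3 r.+1 cv cw cp Ey t : J y t = _.
  by rewrite -/J EJv EJp Ey; ring.
have yJG t : y t + K y t = J G t.
  apply/eqP; rewrite -subr_eq0; apply/eqP; move: t.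
  pose D t := y t + K y t - J G t.
  have ED u : D u = 1 * y u + 1 * K y u + (-1) * J G u by rewrite /D; ring.
  have cD := ccausal_comb3 cy cKy cJG ED.
  (* The equation is checked only after applying [1 + J], which is injective; there it follows from
     the equations of [v], [w] and [p]. *)
  apply: (frac_kernel0 (ltn0Sn r) one0 cD) => t.
  rewrite (frac_comb3 r.+1 cy cKy cJG ED) -/J oneC ED.
  have JK W : ccausal W -> J (K W) = K (J W).
    by move=> cW; rewrite -(JJ _ cW) -(JJ _ (cJ _ cW)).
  have ck W : ccausal W -> ccausal (K W) by exact: ccausal_frac.
  have EQ : K (fun t => y t + J y t) = K (fun t => J G t + w t - J w t).
    by congr K; apply/funext.
  have := congr1 (fun f => f t) EQ.
  rewrite /K (fracD _ _ cy (cJ _ cy)) (fracB _ _ (ccausalD cJG cw) cJw) (fracD _ _ cJG cw).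
  rewrite -/K -(JK _ cy) -(JK _ cG) -(JK _ cw).
  have -> : J (K w) t = J (K G) t - J w t.
    by rewrite -(fracB _ _ cKG cw); congr J; apply/funext => u; rewrite EKw.
  rewrite (EKw t) (JJ _ cG) => E.
  have := EJy t => E'.
  have -> : J y t = J G t + w t - J w t - y t by rewrite -E'; ring.
  have -> : J (K y) t = J (K G) t + (K G t - w t) - (J (K G) t - J w t) - K y t.
    by rewrite -E; ring.
  ring.
(* Applying [1 + s J] to [G] would bring in [J G], which is not bounded uniformly in time; since
   [J G = y + K y], the correction [y / s] absorbs the term [s K y]. *)
pose W t := F t + s^-1 * y t.
have EW u : W u = 1 * F u + s^-1 * y u + 0 * y u by rewrite /W; ring.
have cW := ccausal_comb3 cF cy cy EW.
have EWK t : W t - s ^+ 2 * K W t = G t + (s^-1 + s) * y t.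
  have -> := frac_comb3 r cF cy cy EW t : K W t = _.
  rewrite -/K EW -(JJ _ cF).
  have JGE : J G t = J F t - s * J (J F) t.
    by rewrite /J fracB ?fracZ//; exact: ccausalZ.
  have -> : J (J F) t = s^-1 * (J F t - (y t + K y t)).
    by rewrite yJG JGE; field.
  by rewrite /G; field.
have WH t : t <= T -> normc (W t) <= M * (H + b * (4 * H)).
  apply: (HM T _ W cW) => u uT; rewrite EWK.
  apply: le_trans (le_normcD _ _) _; apply: lerD; first exact: GH.
  by rewrite normcM ler_wpM2l// yH.
move=> t tT; have -> : F t = W t - s^-1 * y t by rewrite /W; ring.
apply: le_trans (le_normcD _ _) _; rewrite normcN normcM.
have h1 := WH _ tT; have h2 : n * normc (y t) <= n * (4 * H) by rewrite ler_wpM2l// yH.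
apply: le_trans (lerD h1 h2) _.
rewrite le_eqVlt; apply/orP; left; apply/eqP; ring.
Qed.

End stable_factors.

(** * Products of factors and polynomials in the fractional integral *)

Section products_of_factors.
Context {R : realType}.
Notation C := (R[i]).
Implicit Types (F G g : R -> C) (c t T H : R) (r n d : nat) (s : C) (ss : seq C).

(** Each squaring of [s] lowers the order index by one; [j < r] leaves it positive when
    [bounded_inverse_left] is reached. *)
Lemma bounded_inverse_pow2 j s r : s != 0 -> complex.Re (s ^+ (2 ^ j)) < 0 ->
  (j < r)%N -> bounded_inverse r s.
Proof.
elim: j s r => [|j IH] s r s0 sj jr; first exact: bounded_inverse_left.
case: r jr => // r; rewrite ltnS => jr.
apply: bounded_inverse_step => //; first exact: leq_trans jr.
by apply: IH => //; rewrite ?expf_neq0// -exprM -expnS.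
Qed.

(* Squaring at least doubles [1 - cos (arg s)] as long as [Re s >= 0]. *)
Lemma angle_doubling j s : (forall i, (i <= j)%N -> 0 <= complex.Re (s ^+ (2 ^ i))) ->
  2 ^+ j * (normc s - complex.Re s) <= normc s.
Proof.
elim: j s => [|j IH] s sj.
  by have := sj 0 (leqnn _); rewrite expr0 mul1r expn0 expr1; lra.
have [->|s0] := eqVneq (normc s) 0.
  by have := sj 0 (leq0n _); rewrite expn0 expr1 => sR; rewrite mulr_ge0_le0 ?exprn_ge0//; lra.
have sp : 0 < normc s by rewrite lt_neqAle eq_sym s0 normc_ge0.
have := IH (s ^+ 2); rewrite expr2 normcM => h; rewrite -(ler_pM2r sp).
apply: le_trans (h _); last first.
  by move=> i ij; rewrite -expr2 -exprM -expnS; exact: sj.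
have sR : 0 <= complex.Re s by have := sj 0 (leq0n _); rewrite expn0 expr1.
rewrite exprSr -!mulrA ler_wpM2l ?exprn_ge0//.
have -> : normc s * normc s - complex.Re (s * s) = 2 * ((normc s - complex.Re s) * (normc s + complex.Re s)).
  have := normc_sqr s; rewrite ReM; set N := normc s; set a := complex.Re s; set b := complex.Im s.
  move=> E; have -> : b * b = N ^+ 2 - a ^+ 2 by rewrite E; ring.
  ring.
rewrite ler_wpM2l// ler_wpM2l// ?lerDl// subr_ge0; exact: Re_le_normc.
Qed.

Lemma bounded_inverse_fine s : ~ (complex.Im s = 0 /\ 0 <= complex.Re s) ->
  exists N, forall r, (N <= r)%N -> bounded_inverse r s.
Proof.
move=> sP.
have s0 : s != 0 by apply/eqP => E; apply: sP; rewrite E.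
have dp : 0 < normc s - complex.Re s.
  rewrite subr_gt0 lt_neqAle Re_le_normc andbT; apply/eqP => E; apply: sP; split; last first.
    by rewrite E normc_ge0.
  by have := normc_sqr s; rewrite E => /eqP; rewrite -subr_eq0 opprD addrA subrr sub0r oppr_eq0 sqrf_eq0 => /eqP.
have [j sj] : exists j, complex.Re (s ^+ (2 ^ j)) < 0.
  apply: contrapT => /forallNP nj.
  (* If all these powers had nonnegative real part, [angle_doubling] would bound [2^k] by
     [|s| / (|s| - Re s)], which is finite off the nonnegative axis. *)
  pose k := Num.bound (normc s / (normc s - complex.Re s)).
  have := @angle_doubling k s; apply/not_implyP; split.
    by move=> i _; rewrite leNgt; apply/negP; exact: nj.
  apply/negP; rewrite -ltNge -ltr_pdivrMr//.
  apply: lt_le_trans (archi_boundP _) _; first by rewrite divr_ge0 ?normc_ge0 ?ltW.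
  by rewrite -/k -natrX ler_nat ltnW// ltn_expl.
by exists j.+1 => r jr; exact: bounded_inverse_pow2 jr.
Qed.

(* [F] is a sum of the [J^i g_i] for [i <= d], with [J = frac r] and every [g_i] bounded
   by [H] up to time [T]. *)
Fixpoint frac_bounded r d T H F : Prop :=
  if d is d'.+1 then exists g G, [/\ ccausal g /\ (forall t, t <= T -> normc (g t) <= H),
    frac_bounded r d' T H G &
    forall t, F t = g t + frac r G t]
  else ccausal F /\ forall t, t <= T -> normc (F t) <= H.

Lemma frac_bounded_ccausal r d T H F : frac_bounded r d T H F -> ccausal F.
Proof.
elim: d F => [|d IH] F; first by case.
move=> [g [G [[cg _] /IH cG /funext ->]]]; apply: ccausalD => //; exact: ccausal_frac.
Qed.

Lemma frac_boundedD r d T H1 H2 F1 F2 :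
  frac_bounded r d T H1 F1 -> frac_bounded r d T H2 F2 ->
  frac_bounded r d T (H1 + H2) (fun t => F1 t + F2 t).
Proof.
have base G1 G2 : frac_bounded r 0 T H1 G1 -> frac_bounded r 0 T H2 G2 ->
    frac_bounded r 0 T (H1 + H2) (fun t => G1 t + G2 t).
  move=> [c1 h1] [c2 h2]; split; first exact: ccausalD.
  by move=> t tT; apply: le_trans (le_normcD _ _) _; rewrite lerD ?h1 ?h2.
elim: d F1 F2 => [|d IH] F1 F2; first exact: base.
move=> [g1 [G1 [b1 B1 E1]]] [g2 [G2 [b2 B2 E2]]].
exists (fun t => g1 t + g2 t), (fun t => G1 t + G2 t); split; [exact: base|exact: IH|].
move=> t; rewrite E1 E2 (fracD _ _ (frac_bounded_ccausal B1) (frac_bounded_ccausal B2)); ring.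
Qed.

Lemma frac_boundedZ r d T H F s :
  frac_bounded r d T H F -> frac_bounded r d T (normc s * H) (fun t => s * F t).
Proof.
have base G : frac_bounded r 0 T H G -> frac_bounded r 0 T (normc s * H) (fun t => s * G t).
  move=> [cG hG]; split; first exact: ccausalZ.
  by move=> t tT; rewrite normcM ler_wpM2l ?normc_ge0 ?hG.
elim: d F => [|d IH] F; first exact: base.
move=> [g [G [b B E]]]; exists (fun t => s * g t), (fun t => s * G t).
split; [exact: base|exact: IH|] => t.
by rewrite E (fracZ _ _ _ (frac_bounded_ccausal B)) mulrDr.
Qed.

Lemma frac_bounded_le r d T H H' F : H <= H' ->
  frac_bounded r d T H F -> frac_bounded r d T H' F.
Proof.
move=> HH; elim: d F => [|d IH] F.
  by move=> [cF hF]; split=> // t tT; exact: le_trans (hF t tT) HH.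
move=> [g [G [[cg hg] B E]]]; exists g, G; split => //; last exact: IH.
by split=> // t tT; exact: le_trans (hg t tT) HH.
Qed.

Lemma frac_bounded0 r d T : frac_bounded r d T 0 (fun=> 0).
Proof.
have base : frac_bounded r 0 T 0 (fun=> 0) by split; [exact: ccausal0|move=> t _; rewrite normc0].
elim: d => [//|d IH]; exists (fun=> 0), (fun=> 0); split=> // t.
by rewrite frac0 addr0.
Qed.

Lemma frac_boundedS r d T H F : 0 <= H ->
  frac_bounded r d T H F -> frac_bounded r d.+1 T H F.
Proof.
move=> H0; elim: d F => [|d IH] F.
  move=> B; exists F, (fun=> 0); split => //.
    exact: frac_bounded_le H0 (frac_bounded0 _ 0 _).
  by move=> t; rewrite frac0 addr0.
by move=> [g [G [b B E]]]; exists g, G; split => //; exact: IH.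
Qed.

Lemma frac_bounded_leq r d d' T H F : 0 <= H -> (d <= d')%N ->
  frac_bounded r d T H F -> frac_bounded r d' T H F.
Proof.
move=> H0 /subnK <- B; elim: (d' - d)%N => [//|k IH].
by rewrite addSn; exact: frac_boundedS.
Qed.

Lemma frac_bounded_iter r d T H F : 0 <= H ->
  frac_bounded r 0 T H F -> frac_bounded r d T H (iter d (frac r) F).
Proof.
move=> H0 B; elim: d => [//|d IH].
exists (fun=> 0), (iter d (frac r) F); split => //.
- exact: frac_bounded_le H0 (frac_bounded0 r 0 T).
- by move=> t; rewrite add0r iterS.
Qed.

(* If [F - s J F = g + J G] then [Z = F + G / s] satisfies [Z - s J Z = g + G / s]. *)
Lemma frac_bounded_inverse r s d : bounded_inverse r s -> s != 0 ->
  exists2 M, 0 <= M & forall T H F, 0 <= H -> ccausal F ->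
    frac_bounded r d.+1 T H (fun t => F t - s * frac r F t) -> frac_bounded r d T (M * H) F.
Proof.
move=> [M M0 HM] s0; have n0 := normc_ge0 s^-1.
have shift g G F : ccausal G -> ccausal F ->
    (forall t, F t - s * frac r F t = g t + frac r G t) ->
    forall t, (F t + s^-1 * G t) - s * frac r (fun t => F t + s^-1 * G t) t = g t + s^-1 * G t.
  move=> cG cF E t; rewrite (fracD _ _ cF (ccausalZ _ cG)) (fracZ _ _ _ cG).
  have -> : g t = F t - s * frac r F t - frac r G t by rewrite E addrK.
  by field.
elim: d => [|d [M' M'0 IH]].
  exists (M * (1 + normc s^-1) + normc s^-1) => [|T H F H0 cF [g [G [[cg hg] [cG hG] E]]]].
    by rewrite addr_ge0// mulr_ge0// addr_ge0.
  have cZ : ccausal (fun t => F t + s^-1 * G t) by apply: ccausalD => //; exact: ccausalZ.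
  split=> // t tT; have -> : F t = (F t + s^-1 * G t) - s^-1 * G t by rewrite addrK.
  apply: le_trans (le_normcD _ _) _; rewrite normcN normcM.
  rewrite mulrDl; apply: lerD; last by rewrite ler_wpM2l// hG.
  rewrite -mulrA; apply: (HM T _ _ cZ) => // u uT; rewrite (shift g G F)//.
  apply: le_trans (le_normcD _ _) _; rewrite mulrDl mul1r normcM lerD ?hg//.
  by rewrite ler_wpM2l// hG.
exists (M' * (1 + normc s^-1) + normc s^-1) => [|T H F H0 cF [g [G [b B E]]]].
  by rewrite addr_ge0// mulr_ge0// addr_ge0.
have cG := @frac_bounded_ccausal r d.+1 T H G B.
have cZ : ccausal (fun t => F t + s^-1 * G t) by apply: ccausalD => //; exact: ccausalZ.
have -> : F = (fun t => (F t + s^-1 * G t) + (- s^-1) * G t).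
  by apply/funext => t; rewrite mulNr addrK.
rewrite mulrDl; apply: frac_boundedD; last by rewrite -(normcN s^-1); exact: frac_boundedZ.
apply: frac_boundedS; first by rewrite mulr_ge0// mulr_ge0// addr_ge0.
rewrite -mulrA; apply: IH => //; first by rewrite mulr_ge0// addr_ge0.
rewrite (funext (shift g G F cG cF E)) mulrDl mul1r.
apply: frac_boundedD; last exact: frac_boundedZ.
exact: (@frac_bounded_leq r 0 d.+1 T H g H0 (leq0n _) b).
Qed.

Definition frac_prod r ss F := foldr (fun s G t => G t - s * frac r G t) F ss.

Lemma ccausal_frac_prod r ss F : ccausal F -> ccausal (frac_prod r ss F).
Proof.
move=> cF; elim: ss => [//|s ss IH]; rewrite /frac_prod/= -/(frac_prod r ss F).
by apply: ccausalB => //; apply: ccausalZ; exact: ccausal_frac.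
Qed.

(** Inverting a factor lowers by one the degree of the right-hand side in [frac r], so a degree
    equal to the number of factors is brought down to 0, a plain bound. *)
Lemma frac_prod_bounded r ss : (forall s, s \in ss -> s != 0 /\ bounded_inverse r s) ->
  exists2 M, 0 <= M & forall T H F, 0 <= H -> ccausal F ->
    frac_bounded r (size ss) T H (frac_prod r ss F) -> forall t, t <= T -> normc (F t) <= M * H.
Proof.
elim: ss => [|s ss IH] hs.
  by exists 1 => // T H F _ _ [_ hF] t tT; rewrite mul1r hF.
have [M M0 HM] := IH (fun s' h => hs s' (@mem_behead _ (s :: ss) s' h)).
have [s0 gs] := hs s (mem_head _ _).
have [M' M'0 HM'] := frac_bounded_inverse (size ss) gs s0.
exists (M * M') => [|T H F H0 cF B t tT]; first exact: mulr_ge0.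
rewrite -mulrA; apply: (HM T) => //; first exact: mulr_ge0.
by apply: HM' => //; exact: ccausal_frac_prod.
Qed.

Lemma ccausal_iter r n F : ccausal F -> ccausal (iter n (frac r) F).
Proof. by move=> cF; elim: n => [//|n IH]; rewrite iterS; exact: ccausal_frac. Qed.

(* The reversed polynomial [X^n p(1/X)] evaluated at [frac r]. *)
Definition frac_poly r n (p : {poly C}) F t : C :=
  \sum_(i < n.+1) p`_i * iter (n - i) (frac r) F t.

Lemma frac_sum r n (c : nat -> C) (G : nat -> R -> C) : (forall i, ccausal (G i)) ->
  ccausal (fun t => \sum_(i < n) c i * G i t) /\
  forall t, frac r (fun t => \sum_(i < n) c i * G i t) t = \sum_(i < n) c i * frac r (G i) t.
Proof.
move=> cG; elim: n => [|n [cS ES]].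
  under [X in ccausal X]eq_fun do rewrite big_ord0.
  split=> [|t]; first exact: ccausal0.
  by under [X in frac r X]eq_fun do rewrite big_ord0; rewrite frac0 big_ord0.
under [X in ccausal X]eq_fun do rewrite big_ord_recr/=.
have cZ := ccausalZ (c n) (cG n).
split=> [|t]; first exact: ccausalD.
under [X in frac r X]eq_fun do rewrite big_ord_recr/=.
by rewrite (fracD _ _ cS cZ) (fracZ _ _ _ (cG n)) ES big_ord_recr.
Qed.

Lemma frac_poly_factor r n (p : {poly C}) s F : (size p <= n.+1)%N -> ccausal F ->
  forall t, frac_poly r n.+1 (('X - s%:P) * p) F t =
    frac_poly r n p F t - s * frac r (frac_poly r n p F) t.
Proof.
move=> sp cF t; rewrite {1 2}/frac_poly.
have -> : frac r (frac_poly r n p F) t = \sum_(i < n.+1) p`_i * iter (n.+1 - i) (frac r) F t.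
  have [_ E] := @frac_sum r n.+1 (fun i => p`_i) (fun i => iter (n - i) (frac r) F)
    (fun i => ccausal_iter r (n - i) cF).
  by rewrite E; apply: eq_bigr => i _; rewrite -iterS -subSn// -ltnS.
under eq_bigr do rewrite mulrBl coefB coefXM coefCM mulrBl.
rewrite sumrB; congr (_ - _).
  rewrite big_ord_recl/= mul0r add0r; apply: eq_bigr => i _.
  by rewrite /bump/= add1n subSS.
rewrite big_ord_recr/= nth_default// mulr0 mul0r addr0 mulr_sumr.
by apply: eq_bigr => i _; rewrite mulrA.
Qed.

Lemma frac_prodE r ss F : ccausal F ->
  frac_prod r ss F = frac_poly r (size ss) (\prod_(s <- ss) ('X - s%:P)) F.
Proof.
move=> cF; elim: ss => [|s ss IH]; apply/funext => t.
  by rewrite /frac_poly big_nil big_ord_recl big_ord0 addr0 coef1 mul1r.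
rewrite big_cons frac_poly_factor// ?size_prod_XsubC//.
by rewrite /frac_prod/= -/(frac_prod r ss F) IH.
Qed.

End products_of_factors.

(** * Commensurate systems *)

Section commensurate_systems.
Context {R : realType}.
Notation C := (R[i]).
Implicit Types (f X Y : R -> R) (r m n : nat).

Lemma ccausal_real f : causal_bounded f -> ccausal (fun t => ((f t)%:C)%C).
Proof.
move=> cf; split; first exact: cf.
have [+ _] := @ccausal0 R; by [].
Qed.

Lemma conv0 (k : R -> R) t : conv k (fun=> 0) t = 0.
Proof. by rewrite /conv /Rintegral integral0_eq// => s _; rewrite mulr0. Qed.

(** The order 0 is left out because the identity is not given by a kernel [fker]. *)
Lemma iter_frac_real r k f : (0 < k)%N -> causal_bounded f ->
  iter k (frac r) (fun t => ((f t)%:C)%C) = (fun t => ((conv (fker (k%:R * dyadic r)) f t)%:C)%C).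
Proof.
move=> + cf; elim: k => [//|[|k] IH] _.
  apply/funext => t; rewrite mul1r; apply: eq_complexP => //=.
  exact: conv0.
have d0 := @dyadic_gt0 R r.
have k0 : 0 < k.+1%:R * dyadic r :> R by rewrite mulr_gt0.
rewrite iterS IH//; apply/funext => t; apply: eq_complexP; last first.
  exact: conv0.
rewrite -[k.+2]addn1 natrD mulrDl mul1r addrC.
by have /(congr1 (fun g => g t)) := conv_fkerA d0 k0 cf; apply: etrans.
Qed.

Lemma bounded_inverse_uniform (ss : seq C) :
  (forall s, s \in ss -> ~ (complex.Im s = 0 /\ 0 <= complex.Re s)) ->
  exists N, forall r, (N <= r)%N -> forall s, s \in ss -> s != 0 /\ bounded_inverse r s.
Proof.
elim: ss => [|s ss IH] hs; first by exists 0%N.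
have [N1 H1] := IH (fun s' h => hs s' (@mem_behead _ (s :: ss) s' h)).
have sP := hs s (mem_head _ _).
have [N2 H2] := bounded_inverse_fine sP.
exists (maxn N1 N2) => r; rewrite geq_max => /andP[r1 r2] s'; rewrite inE => /orP[/eqP->|]; last exact: H1.
by split; [apply/eqP => E; apply: sP; rewrite E|exact: H2].
Qed.

(** The coefficients are written as sums of Kronecker deltas so that [m = n] needs no separate
    treatment. Positivity on the nonnegative axis is what excludes roots there. *)
Lemma charpoly_factors (a b d : R) m n : (0 < m)%N -> (0 < n)%N ->
  (forall z : R, 0 <= z -> 0 < z ^+ (m + n) - a * z ^+ n - b * z ^+ m + d) ->
  exists ss : seq C, [/\ size ss = (m + n)%N,
    forall i, (\prod_(s <- ss) ('X - s%:P))`_i =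
      (((i == m + n)%N%:R - a * (i == n)%:R - b * (i == m)%:R + d * (i == 0%N)%:R)%:C)%C &
    forall s, s \in ss -> ~ (complex.Im s = 0 /\ 0 <= complex.Re s)].
Proof.
move=> m0 n0 pos.
pose p : {poly R} := 'X^(m + n) - (a *: 'X^n + b *: 'X^m - d%:P).
have pE z : p.[z] = z ^+ (m + n) - a * z ^+ n - b * z ^+ m + d.
  by rewrite /p !hornerE; ring.
have sq : (size (a *: 'X^n + b *: 'X^m - d%:P)%R < size ('X^(m + n) : {poly R}))%N.
  rewrite size_polyXn ltnS; apply: leq_trans (size_polyD _ _) _.
  rewrite size_polyN geq_max; apply/andP; split; last first.
    by apply: leq_trans (size_polyC_leq1 _) _; rewrite addn_gt0 m0.
  apply: leq_trans (size_polyD _ _) _; rewrite geq_max.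
  apply/andP; split; apply: leq_trans (size_scale_leq _ _) _; rewrite size_polyXn.
    by rewrite -add1n leq_add2r.
  by rewrite -addn1 leq_add2l.
rewrite -size_polyN in sq.
have sp : size p = (m + n).+1 by rewrite /p (size_polyDl sq) size_polyXn.
have lp : lead_coef p = 1 by rewrite /p (lead_coefDl sq) lead_coefXn.
pose pc := map_poly (real_complex R) p.
have [ss E] := closed_field_poly_normal pc.
have lpc : lead_coef pc = 1 by rewrite lead_coef_map lp.
rewrite lpc scale1r in E.
have spc : size pc = (m + n).+1 by rewrite size_map_poly.
exists ss; split.
- by move: spc; rewrite E size_prod_XsubC => -[].
- move=> i; rewrite -E coef_map/=; congr (_%:C)%C.
  rewrite /p !(coefD, coefN, coefZ, coefXn, coefC)/=.
  by case: (i == 0%N); rewrite ?mulr1n ?mulr0n ?mulr1 ?mulr0; ring.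
- move=> s sss [s1 s2].
  have : root pc s by rewrite E root_prod_XsubC.
  have -> : s = real_complex R (complex.Re s) by apply: eq_complexP.
  rewrite /root horner_map pE => /eqP /(congr1 (@complex.Re R)) /= Z.
  by have := pos _ s2; rewrite Z ltxx.
Qed.

(** The order [q2] integral of the first equation and the order [q1] integral of the second express
    J^q2 X and J^q1 Y; after substitution the terms in J^(q1+q2) Y cancel. No division by [a12]
    occurs. *)
Lemma volterra_eliminate (a11 a12 a21 a22 q1 q2 x0 y0 : R) X Y t :
  0 < q1 -> 0 < q2 -> causal_bounded X -> causal_bounded Y ->
  (forall t, X t = x0 * heaviside t + conv (fker q1) (fun s => a11 * X s + a12 * Y s) t) ->
  (forall t, Y t = y0 * heaviside t + conv (fker q2) (fun s => a21 * X s + a22 * Y s) t) ->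
  X t - a11 * conv (fker q1) X t - a22 * conv (fker q2) X t +
    (a11 * a22 - a12 * a21) * conv (fker (q1 + q2)) X t =
  x0 * heaviside t - a22 * x0 * conv (fker q2) heaviside t + a12 * y0 * conv (fker q1) heaviside t.
Proof.
move=> q10 q20 cX cY EX EY.
have k1 := fker_kernel q10; have k2 := fker_kernel q20.
have cJ k : causal_kernel k -> causal_bounded (fun s => a11 * conv k X s + a12 * conv k Y s).
  by move=> kk; apply: causal_boundedD; apply: causal_boundedZ; exact: causal_bounded_conv.
have ch := @causal_bounded_heaviside R.
have lin k b1 b2 : causal_kernel k ->
    conv k (fun s => b1 * X s + b2 * Y s) = (fun t => b1 * conv k X t + b2 * conv k Y t).
  by move=> kk; apply/funext => u; rewrite (convD _ kk (causal_boundedZ b1 cX) (causal_boundedZ b2 cY))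
    (convZ _ _ kk cX) (convZ _ _ kk cY).
have lin3 k b0 b1 b2 k' : causal_kernel k -> causal_kernel k' ->
    conv k (fun t => b0 * heaviside t + (b1 * conv k' X t + b2 * conv k' Y t)) t =
    b0 * conv k heaviside t + (b1 * conv k (conv k' X) t + b2 * conv k (conv k' Y) t).
  move=> kk kk'; have c1 := causal_bounded_conv kk' cX; have c2 := causal_bounded_conv kk' cY.
  rewrite (convD _ kk (causal_boundedZ b0 ch)
    (causal_boundedD (causal_boundedZ b1 c1) (causal_boundedZ b2 c2))).
  by rewrite (convD _ kk (causal_boundedZ b1 c1) (causal_boundedZ b2 c2)) (convZ _ _ kk ch)
    (convZ _ _ kk c1) (convZ _ _ kk c2).
rewrite lin// in EX; rewrite lin// in EY.
have E2 : conv (fker q2) X t = x0 * conv (fker q2) heaviside t +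
    (a11 * conv (fker (q1 + q2)) X t + a12 * conv (fker (q1 + q2)) Y t).
  rewrite {1}(funext EX) (lin3 _ _ _ _ _ k2 k1) (conv_fkerA q20 q10 cX) (conv_fkerA q20 q10 cY).
  by rewrite (addrC q2).
have E1 : conv (fker q1) Y t = y0 * conv (fker q1) heaviside t +
    (a21 * conv (fker (q1 + q2)) X t + a22 * conv (fker (q1 + q2)) Y t).
  by rewrite {1}(funext EY) (lin3 _ _ _ _ _ k1 k2) (conv_fkerA q10 q20 cX) (conv_fkerA q10 q20 cY).
rewrite EX E1 E2.
move: (conv (fker q1) heaviside t) (conv (fker q2) heaviside t) (conv (fker q1) X t)
  (conv (fker q1) Y t) (conv (fker (q1 + q2)) X t) (conv (fker (q1 + q2)) Y t) (heaviside t) => *.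
ring.
Qed.

Lemma volterra_bound (a11 a12 a21 a22 : R) m n : (0 < m)%N -> (0 < n)%N ->
  (forall z : R, 0 <= z ->
    0 < z ^+ (m + n) - a11 * z ^+ n - a22 * z ^+ m + (a11 * a22 - a12 * a21)) ->
  exists N, forall r, (N <= r)%N -> exists2 M, 0 <= M & forall x0 y0 X Y,
    causal_bounded X -> causal_bounded Y ->
    (forall t, X t = x0 * heaviside t +
      conv (fker (m%:R * dyadic r)) (fun s => a11 * X s + a12 * Y s) t) ->
    (forall t, Y t = y0 * heaviside t +
      conv (fker (n%:R * dyadic r)) (fun s => a21 * X s + a22 * Y s) t) ->
    forall t, `|X t| <= M * (`|x0| + `|y0|).
Proof.
move=> m0 n0 pos; have [ss [sss pss rss]] := charpoly_factors m0 n0 pos.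
have [N HN] := bounded_inverse_uniform rss.
exists N => r Nr; have [M M0 HM] := frac_prod_bounded (HN r Nr).
exists (M * (1 + `|a22| + `|a12|)) => [|x0 y0 X Y cX cY EX EY t].
  by rewrite mulr_ge0// !addr_ge0.
have d0 := @dyadic_gt0 R r.
have q10 : 0 < m%:R * dyadic r :> R by rewrite mulr_gt0// ltr0n.
have q20 : 0 < n%:R * dyadic r :> R by rewrite mulr_gt0// ltr0n.
pose F t := ((X t)%:C)%C; pose G t := ((heaviside t : R)%:C)%C.
have cF : ccausal F by exact: ccausal_real.
have ch := @causal_bounded_heaviside R.
have GB T : frac_bounded r 0 T 1 G.
  split=> [|u _]; first exact: ccausal_real.
  rewrite normc_real; have [u0|u0] := leP 0 u; first by rewrite heavisideE// normr1.
  by rewrite heaviside_lt0// normr0.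
(* The coefficient of [z^i] goes with J^(m+n-i): thus [- a11], the coefficient of [z^n], meets J^m,
   the integral of order [q1]. The right-hand side has degree at most [m + n], the number of
   factors. *)
have PE : frac_prod r ss F = (fun t => ((x0%:C)%C * G t + ((- (a22 * x0))%:C)%C * iter n (frac r) G t) +
    ((a12 * y0)%:C)%C * iter m (frac r) G t).
  rewrite frac_prodE// sss; apply/funext => u; rewrite /frac_poly.
  transitivity (((X u - a11 * conv (fker (m%:R * dyadic r)) X u
      - a22 * conv (fker (n%:R * dyadic r)) X u + (a11 * a22 - a12 * a21) *
      conv (fker (m%:R * dyadic r + n%:R * dyadic r)) X u)%:C)%C); last first.
    rewrite (volterra_eliminate u q10 q20 cX cY EX EY) /G !iter_frac_real//.
    move: (conv (fker (m%:R * dyadic r)) heaviside u) (conv (fker (n%:R * dyadic r)) heaviside u) => e1 e2.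
    by rewrite !rmorphD/= !rmorphN/= !rmorphM/=; ring.
  rewrite -mulrDl -natrD.
  have dlt j (K : nat -> C) (c : C) : (j <= m + n)%N ->
      \sum_(i < (m + n).+1) c * ((i : nat) == j)%:R * K i = c * K j.
    move=> jmn; rewrite (bigD1 (Ordinal (jmn : (j < (m + n).+1)%N)))//= eqxx mulr1.
    rewrite big1 ?addr0// => i; rewrite -val_eqE/= => /negbTE ->.
    by rewrite mulr0 mul0r.
  pose K i := iter (m + n - i) (frac r) F u.
  transitivity (\sum_(i < (m + n).+1) (1 * ((i : nat) == (m + n)%N)%:R * K i
     + (- a11%:C)%C * ((i : nat) == n)%:R * K i
     + (- a22%:C)%C * ((i : nat) == m)%:R * K i
     + ((a11 * a22 - a12 * a21)%:C)%C * ((i : nat) == 0%N)%:R * K i)).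
    apply: eq_bigr => i _; rewrite -!mulrDl -/(K i); congr (_ * _).
    apply: etrans (pss i) _; rewrite !rmorphD/= !rmorphN/= !rmorphM/= !rmorph_nat; ring.
  rewrite !big_split/= !dlt// ?leq_addl ?leq_addr// /K subnn subn0 addnK addKn.
  have mn0 : (0 < m + n)%N by rewrite addn_gt0 m0.
  rewrite /F (iter_frac_real r m0 cX) (iter_frac_real r n0 cX) (iter_frac_real r mn0 cX)/=.
  move: (conv (fker (m%:R * dyadic r)) X u) (conv (fker (n%:R * dyadic r)) X u)
    (conv (fker ((m + n)%:R * dyadic r)) X u) => e1 e2 e3.
  rewrite !rmorphD/= !rmorphN/= !rmorphM/=. ring.
rewrite -normc_real -/(F t) -mulrA; apply: (HM t) => //.
rewrite PE sss.
have B1 := frac_boundedZ (x0%:C)%C (frac_bounded_leq ler01 (leq0n (m + n)) (GB t)).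
have B2 := frac_boundedZ ((- (a22 * x0))%:C)%C
  (frac_bounded_leq ler01 (leq_addl m n) (frac_bounded_iter n ler01 (GB t))).
have B3 := frac_boundedZ ((a12 * y0)%:C)%C
  (frac_bounded_leq ler01 (leq_addr n m) (frac_bounded_iter m ler01 (GB t))).
apply: frac_bounded_le (frac_boundedD (frac_boundedD B1 B2) B3).
rewrite !normc_real !mulr1 normrN !normrM.
have h1 : 0 <= `|a22| * `|y0| by rewrite mulr_ge0.
have h2 : 0 <= `|a12| * `|x0| by rewrite mulr_ge0.
have h3 : 0 <= `|y0| by [].
by move: `|_| `|_| `|_| `|_| h1 h2 h3 => u1 u2 u3 u4 *; lra.
Qed.

End commensurate_systems.

(** * Exponents making the characteristic function positive *)

Section positive_trinomials.
Context {R : realType}.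
Implicit Types (a b d t x y z : R) (m n : nat).

Lemma nat_ratio_between x y : 0 <= x -> x < y ->
  exists m n, [/\ (0 < m)%N, (0 < n)%N, x * n%:R < m%:R & m%:R < y * n%:R].
Proof.
move=> x0 xy; have d0 : 0 < y - x by rewrite subr_gt0.
pose n := Num.bound (y - x)^-1; pose m := (Num.truncn (x * n%:R)).+1.
have nb : (y - x)^-1 < n%:R by apply: archi_boundP; rewrite invr_ge0 ltW.
have n0 : 0 < n%:R :> R by apply: le_lt_trans nb; rewrite invr_ge0 ltW.
have xn0 : 0 <= x * n%:R by rewrite mulr_ge0.
exists m, n; split => //.
- by have /andP[] := truncn_itv xn0.
- have /andP[h _] := truncn_itv xn0.
  have : 1 < (y - x) * n%:R by rewrite mulrC -ltr_pdivrMr// mul1r.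
  by rewrite /m -natr1 mulrBl; move: h; lra.
Qed.

(** The tangent inequality of the exponential bounds each power from below by
    [z^k (1 + (l - k) ln z)]; the hypothesis says that [k] is the weighted mean of the exponents, so
    the terms in [ln z] cancel. *)
Lemma weighted_amgm (c1 c2 c3 z : R) (i j k : nat) : 0 <= c1 -> 0 <= c2 -> 0 <= c3 -> 0 < z ->
  c1 * i%:R + c2 * j%:R = (c1 + c2 + c3) * k%:R ->
  (c1 + c2 + c3) * z ^+ k <= c1 * z ^+ i + c2 * z ^+ j + c3.
Proof.
move=> c10 c20 c30 z0 E; pose x := ln z.
have zE l : z ^+ l = expR (l%:R * x) by rewrite expRM_natl lnK.
have tangent l : z ^+ k * (1 + (l%:R - k%:R) * x) <= z ^+ l.
  have -> : z ^+ l = z ^+ k * expR ((l%:R - k%:R) * x).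
    by rewrite !zE -expRD -mulrDl subrKC.
  by rewrite ler_wpM2l ?exprn_ge0 ?(ltW z0)// expR_ge1Dx.
have t1 := ler_wpM2l c10 (tangent i); have t2 := ler_wpM2l c20 (tangent j).
have t3 := ler_wpM2l c30 (tangent 0%N); rewrite expr0 in t3.
rewrite mulr1 in t3; apply: le_trans (lerD (lerD t1 t2) t3).
rewrite le_eqVlt; apply/orP; left; apply/eqP.
have E' : c1 * i%:R = (c1 + c2 + c3) * k%:R - c2 * j%:R by rewrite -E addrK.
transitivity (z ^+ k * ((c1 + c2 + c3) + (c1 * i%:R + c2 * j%:R - (c1 + c2 + c3) * k%:R) * x)).
  by rewrite E subrr mul0r addr0 mulrC.
ring.
Qed.

Definition positive_trinomial a b d := exists m n, [/\ (0 < m)%N, (0 < n)%N &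
  forall z, 0 <= z -> 0 < z ^+ (m + n) - a * z ^+ n - b * z ^+ m + d].

Lemma positive_trinomialC a b d : positive_trinomial a b d -> positive_trinomial b a d.
Proof.
move=> [m [n [m0 n0 pos]]]; exists n, m; split=> // z z0.
by have := pos z z0; rewrite addnC addrAC; congr (0 < _); ring.
Qed.

Lemma positive_trinomial0 a b d m n z : 0 < d -> (0 < m)%N -> (0 < n)%N -> 0 <= z ->
  (0 < z -> 0 < z ^+ (m + n) - a * z ^+ n - b * z ^+ m + d) ->
  0 < z ^+ (m + n) - a * z ^+ n - b * z ^+ m + d.
Proof.
move=> d0 m0 n0; rewrite le_eqVlt => /orP[/eqP <- _|z0 H]; last exact: H.
by rewrite !expr0n addn_eq0 !gtn_eqF// !mulr0 !subr0 add0r.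
Qed.

Lemma positive_trinomial_neg a b d : 0 < d -> a <= 0 -> b <= 0 -> positive_trinomial a b d.
Proof.
move=> d0 a0 b0; exists 1%N, 1%N; split=> // z z0; rewrite expr1.
have h1 : 0 <= z ^+ 2 by rewrite sqr_ge0.
have h2 : a * z <= 0 by rewrite mulr_le0_ge0.
have h3 : b * z <= 0 by rewrite mulr_le0_ge0.
by rewrite addn1; move: (z ^+ 2) (a * z) (b * z) h1 h2 h3 => *; lra.
Qed.

(* The ratio [m / n] is chosen so that, for some [d' < d], the exponents [m + n], [m] and
   0 with weights 1, [- b] and [d'] have mean [n]. *)
Lemma positive_trinomial_mixed a b d : 0 < d -> a + b < d + 1 -> 0 < a -> b <= 0 ->
  positive_trinomial a b d.
Proof.
(* With [e = (1 - b) m / n] the weights 1, [- b], [e + b] have total [1 + e]. Needed are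
   [e + b >= 0], [1 + e >= a] and [e + b < d], that is [e] between [lo] and [hi]. *)
move=> d0 abd a0 b0; pose lo := Num.max (- b) (a - 1); pose hi := d - b.
have s0 : 0 < 1 - b by lra.
have lo0 : 0 <= lo by rewrite /lo le_max oppr_ge0 b0.
have lohi : lo < hi by rewrite /lo /hi gt_max; apply/andP; split; lra.
have [m [n [m0 n0 h1 h2]]] : exists m n, [/\ (0 < m)%N, (0 < n)%N,
    lo / (1 - b) * n%:R < m%:R & m%:R < hi / (1 - b) * n%:R].
  by apply: nat_ratio_between; [rewrite divr_ge0// ltW|rewrite ltr_pM2r// invr_gt0].
have nR : 0 < n%:R :> R by rewrite ltr0n.
pose e := (1 - b) * m%:R / n%:R.
have loe : lo < e by rewrite /e ltr_pdivlMr// mulrC; move: h1; rewrite mulrAC ltr_pdivrMr// (mulrC m%:R) (mulrC lo).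
have ehi : e < hi by rewrite /e ltr_pdivrMr//; move: h2; rewrite mulrAC ltr_pdivlMr// (mulrC m%:R).
have be : - b < e by apply: le_lt_trans loe; rewrite /lo le_max lexx.
have ae : a - 1 < e by apply: le_lt_trans loe; rewrite /lo le_max lexx orbT.
exists m, n; split=> // z z0; apply: positive_trinomial0 => // zp.
have := @weighted_amgm 1 (- b) (e + b) z (m + n) m n ler01.
rewrite oppr_ge0 b0 => /(_ isT); have eb0 : 0 <= e + b by lra.
move=> /(_ eb0 zp) H.
have {}H := H _.
have zn : 0 < z ^+ n by rewrite exprn_gt0.
have {H} : (1 - b + (e + b)) * z ^+ n <= 1 * z ^+ (m + n) + - b * z ^+ m + (e + b).
  by apply: H; rewrite natrD /e; field; rewrite gt_eqF.
have : a * z ^+ n <= (1 - b + (e + b)) * z ^+ n by rewrite ler_pM2r//; lra.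
have : e + b < d by move: ehi; rewrite /hi; lra.
by rewrite mul1r mulNr; move: ((1 - b + (e + b)) * z ^+ n) (a * z ^+ n) (b * z ^+ m) (z ^+ (m + n)) => *; lra.
Qed.

(** The means of [z^(m+n)] and 1 bound [(m + n) z^n] by [n z^(m+n) + m] and [(m + n) z^m] by
    [m z^(m+n) + n]. Adding them with factors [a] and [b] leaves two linear conditions on the ratio
    of [m] and [n]. *)
Lemma positive_trinomial_convex a b d : 0 < a -> a <= b -> a < 1 -> a < d -> a + b < d + 1 ->
  positive_trinomial a b d.
Proof.
move=> a0 ab a1 ad abd.
suff [m [n [m0 n0 h1 h2]]] : exists m n, [/\ (0 < m)%N, (0 < n)%N,
    a * n%:R + b * m%:R <= (m + n)%:R :> R &
    a * m%:R + b * n%:R < d * (m + n)%:R].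
  exists m, n; split=> // z z0; apply: positive_trinomial0 => //; first by lra.
  move=> zp; have mn0 : 0 < (m + n)%:R :> R by rewrite ltr0n addn_gt0 m0.
  have e1 := @weighted_amgm n%:R 0 m%:R z (m + n) 0 n (ler0n _ _) (lexx _) (ler0n _ _) zp.
  have e2 := @weighted_amgm m%:R 0 n%:R z (m + n) 0 m (ler0n _ _) (lexx _) (ler0n _ _) zp.
  have {}e1 : (m + n)%:R * z ^+ n <= n%:R * z ^+ (m + n) + m%:R.
    have E : n%:R * (m + n)%:R + 0 * 0%:R = (n%:R + 0 + m%:R) * n%:R :> R by rewrite natrD; ring.
    by have := e1 E; rewrite natrD mul0r !addr0 (addrC m%:R).
  have {}e2 : (m + n)%:R * z ^+ m <= m%:R * z ^+ (m + n) + n%:R.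
    have E : m%:R * (m + n)%:R + 0 * 0%:R = (m%:R + 0 + n%:R) * m%:R :> R by rewrite natrD; ring.
    by have := e2 E; rewrite natrD mul0r !addr0.
  have b0 : 0 < b by lra.
  have f1 := ler_wpM2l (ltW a0) e1; have f2 := ler_wpM2l (ltW b0) e2.
  rewrite -(pmulr_rgt0 _ mn0).
  have zmn : 0 <= z ^+ (m + n) by rewrite exprn_ge0.
  have f3 := ler_wpM2r zmn h1.
  move: f1 f2 f3 h2; move: (z ^+ (m + n)) (z ^+ m) (z ^+ n) => Z zm zn.
  rewrite !natrD !mulrDr !mulrDl; lra.
have [E|nE] := eqVneq a b.
  by exists 1%N, 1%N; split => //; rewrite ?natrD ?mulr1 -E; lra.
have {ab nE}ab : 0 < b - a by rewrite subr_gt0 lt_neqAle nE.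
(* Here [N] stands for [m + n]. The two conditions read [m (b - a) <= (1 - a) N] and
   [(b - d) N < m (b - a)]; the minimum with [b - a] also ensures [m < N]. *)
pose lo := Num.max 0 (b - d) / (b - a); pose hi := Num.min (b - a) (1 - a) / (b - a).
have [m [N [m0 N0 h1 h2]]] : exists m N, [/\ (0 < m)%N, (0 < N)%N,
    lo * N%:R < m%:R & m%:R < hi * N%:R].
  apply: nat_ratio_between; first by rewrite divr_ge0 ?(ltW ab)// le_max lexx.
  rewrite ltr_pM2r ?invr_gt0// gt_max !lt_min; apply/andP; split; apply/andP; split; lra.
have NR : 0 < N%:R :> R by rewrite ltr0n.
have k1 : Num.max 0 (b - d) * N%:R < m%:R * (b - a).
  by move: h1; rewrite /lo mulrAC ltr_pdivrMr.
have k2 : m%:R * (b - a) < Num.min (b - a) (1 - a) * N%:R.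
  by move: h2; rewrite /hi mulrAC ltr_pdivlMr.
have mN : (m < N)%N.
  rewrite -(ltr_nat R) -(ltr_pM2r ab) mulrC; apply: lt_le_trans (_ : (b - a) * N%:R <= _); last by rewrite mulrC.
  by rewrite mulrC; apply: lt_le_trans k2 _; rewrite ler_pM2r// ge_min lexx.
exists m, (N - m)%N; rewrite subn_gt0 subnKC ?(ltnW mN)// natrB ?(ltnW mN)//; split => //.
- have : Num.min (b - a) (1 - a) * N%:R <= (1 - a) * N%:R by rewrite ler_pM2r// ge_min lexx orbT.
  by move: k2; rewrite !mulrBr !mulrBl; lra.
- have : (b - d) * N%:R <= Num.max 0 (b - d) * N%:R by rewrite ler_pM2r// le_max lexx orbT.
  by move: k1; rewrite !mulrBr !mulrBl; lra.
Qed.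

(* [z^m - t^m] and [z^n - t^n] have the same sign. *)
Lemma positive_trinomial_pow t a b d m n : 0 <= t -> (0 < m)%N -> (0 < n)%N ->
  a <= t ^+ m -> b <= t ^+ n -> t ^+ m * t ^+ n < d -> positive_trinomial a b d.
Proof.
move=> t0 m0 n0 am bn dd; exists m, n; split=> // z z0.
have h : 0 <= (z ^+ m - t ^+ m) * (z ^+ n - t ^+ n).
  have [zt|/ltW tz] := leP z t; [apply: mulr_le0|apply: mulr_ge0];
    by rewrite ?subr_le0 ?subr_ge0 lerXn2r ?nnegrE.
have h1 : a * z ^+ n <= t ^+ m * z ^+ n by rewrite ler_wpM2r ?exprn_ge0.
have h2 : b * z ^+ m <= t ^+ n * z ^+ m by rewrite ler_wpM2r ?exprn_ge0.
move: h h1 h2 dd; rewrite exprD mulrBl !mulrBr (mulrC (z ^+ m) (t ^+ n)).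
move: (z ^+ m * z ^+ n) (t ^+ m * t ^+ n) (t ^+ n * z ^+ m) (t ^+ m * z ^+ n) => u1 u2 u3 u4; lra.
Qed.

Lemma pow_unbounded t x : 1 < t -> exists m, x < t ^+ m.
Proof.
move=> t1; have e0 : 0 < t - 1 by lra.
have bern m : 1 + m%:R * (t - 1) <= t ^+ m.
  elim: m => [|m IH]; first by rewrite mul0r addr0 expr0.
  have t0 : 0 <= t by lra.
  rewrite exprS; apply: le_trans (ler_wpM2l t0 IH).
  have h : 0 <= m%:R * (t - 1) * (t - 1) by rewrite !mulr_ge0// ltW.
  by rewrite -natr1; move: (m%:R) h => M; lra.
exists (Num.bound (`|x| / (t - 1))); apply: lt_le_trans (bern _).
have : `|x| / (t - 1) < (Num.bound (`|x| / (t - 1)))%:R by apply: archi_boundP; rewrite divr_ge0// ltW.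
rewrite ltr_pdivrMr// => h; apply: le_lt_trans (ler_norm x) _.
by move: (_%:R * _) h => M; lra.
Qed.

Lemma pow_bracket t x : 1 < t -> 1 <= x -> exists m, t ^+ m <= x < t ^+ m.+1.
Proof.
move=> t1 x1; have exm : exists m, x < t ^+ m by exact: pow_unbounded.
have [[|m] xm min] := find_ex_minn exm; first by move: xm; rewrite expr0; lra.
exists m; rewrite xm andbT leNgt; apply/negP => /min; by rewrite ltnn.
Qed.

(** For [t > 1] so close to 1 that [t^2 a b < d], rounding [a] and [b] up to powers of [t] costs a
    factor at most [t] each, and [positive_trinomial_pow] applies. *)
Lemma positive_trinomial_large a b d : 1 <= a -> 1 <= b -> a * b < d -> positive_trinomial a b d.
Proof.
move=> a1 b1 abd.
have ab0 : 0 < a * b by rewrite mulr_gt0//; lra.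
pose s := (1 + d / (a * b)) / 2.
have r1 : 1 < d / (a * b) by rewrite ltr_pdivlMr// mul1r.
have s1 : 1 < s by rewrite /s; lra.
have sd : s * (a * b) < d by rewrite -ltr_pdivlMr// /s; lra.
pose t := Num.sqrt s.
have tt : t * t = s by rewrite -expr2 sqr_sqrtr//; lra.
have t1 : 1 < t by rewrite -[X in X < _]sqrtr1 ltr_sqrt//; lra.
have t0 : 0 < t by lra.
have [m /andP[m1 m2]] := pow_bracket t1 a1.
have [n /andP[n1 n2]] := pow_bracket t1 b1.
apply: (@positive_trinomial_pow t _ _ _ m.+1 n.+1) => //; [exact: ltW..|].
apply: le_lt_trans sd; rewrite !exprS mulrACA tt ler_wpM2l//; first by lra.
by apply: ler_pM => //; rewrite exprn_ge0// ltW.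
Qed.

(** The hypotheses force [a, b < 1], so the rounding up is done to powers of [1 / t]. *)
Lemma positive_trinomial_small a b d : 0 < d -> d <= a -> d <= b -> a * b < d ->
  a + b < d + 1 -> positive_trinomial a b d.
Proof.
move=> d0 da db abd abd1.
have a0 : 0 < a by lra. have b0 : 0 < b by lra.
have ab0 : 0 < a * b by rewrite mulr_gt0.
pose r := d / (a * b).
have r1 : 1 < r by rewrite ltr_pdivlMr// mul1r.
pose s := (1 + r) / 2.
have s1 : 1 < s by rewrite /s; lra.
have sr : s < r by rewrite /s; lra.
pose t := Num.sqrt s.
have tt : t * t = s by rewrite -expr2 sqr_sqrtr//; lra.
have t1 : 1 < t by rewrite -[X in X < _]sqrtr1 ltr_sqrt//; lra.
have t0 : 0 < t by lra.
have ts : t <= s by rewrite -tt ler_peMl ?(ltW t0)// ltW.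
have inv1 c : 0 < c -> c < 1 -> r <= c^-1 -> exists m, [/\ (0 < m)%N, c <= t^-1 ^+ m & t^-1 ^+ m < t * c].
  move=> c0 c1 rc; have c1' : 1 <= c^-1 by rewrite invf_ge1// ltW.
  have [m /andP[m1 m2]] := pow_bracket t1 c1'.
  have tm0 : 0 < t ^+ m by rewrite exprn_gt0.
  exists m; rewrite exprVn; split.
  (* The exponent 0 would mean [1 / c < t], whereas [t <= s < r <= 1 / c]. *)
  - case: m m1 m2 tm0 => // _; rewrite expr1 => h _; lra.
  - by rewrite -[leLHS]invrK lef_pV2 ?posrE ?invr_gt0.
  - move: m2; rewrite exprS -[c^-1]mul1r ltr_pdivrMr// => h.
    by rewrite -[ltLHS]mul1r ltr_pdivrMr// mulrAC.
have [|||m [m0 m1 m2]] := inv1 a => //; first by lra.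
  by rewrite /r ler_pdivrMr// mulKf ?gt_eqF.
have [|||n [n0 n1 n2]] := inv1 b => //; first by lra.
  by rewrite /r ler_pdivrMr// mulrC mulfK ?gt_eqF.
apply: (@positive_trinomial_pow t^-1 _ _ _ m n) => //; first by rewrite invr_ge0 ltW.
apply: lt_trans (_ : s * (a * b) < _); last by rewrite -ltr_pdivlMr.
rewrite -tt mulrACA; apply: ltr_pM => //; by rewrite exprn_ge0// invr_ge0 ltW.
Qed.

Lemma positive_trinomialP a b d : 0 < d -> a + b < d + 1 ->
  ~ [/\ 0 < a, 0 < b & d <= a * b] -> positive_trinomial a b d.
Proof.
move=> d0 abd nP.
have [a0|a0] := leP a 0; have [b0|b0] := leP b 0.
- exact: positive_trinomial_neg.
- by apply: positive_trinomialC; apply: positive_trinomial_mixed => //; rewrite addrC.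
- exact: positive_trinomial_mixed.
have dab : a * b < d by rewrite ltNge; apply/negP => h; exact: nP.
wlog ab : a b abd {nP} a0 b0 dab / a <= b => [H|].
  have [|/ltW] := leP a b; first exact: H.
  by move=> ba; apply: positive_trinomialC; apply: H => //; [rewrite addrC|rewrite mulrC].
have [a1|a1] := leP 1 a; first by apply: positive_trinomial_large => //; lra.
have [da|ad] := leP d a; first by apply: positive_trinomial_small => //; lra.
exact: positive_trinomial_convex.
Qed.

End positive_trinomials.

(** * Stability *)

Section stability.
Context {R : realType}.

Lemma norm2_ge (x y : R) : `|x| <= norm2 x y /\ `|y| <= norm2 x y.
Proof.
by split; rewrite -sqrtr_sqr; apply: ler_wsqrtr; rewrite ?lerDl ?lerDr sqr_ge0.
Qed.

Lemma norm2_le (x y : R) : norm2 x y <= `|x| + `|y|.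
Proof.
rewrite -[leRHS]ger0_norm ?addr_ge0// -sqrtr_sqr; apply: ler_wsqrtr.
rewrite sqrrD -!normrX (ger0_norm (sqr_ge0 x)) (ger0_norm (sqr_ge0 y)).
by rewrite lerD2r lerDl mulrn_wge0// mulr_ge0.
Qed.

Lemma dyadic_le1 (m r : nat) : (m <= r)%N -> (m%:R : R) * dyadic r <= 1.
Proof.
move=> mr; rewrite /dyadic exprVn ler_pdivrMr ?exprn_gt0// mul1r -natrX ler_nat.
exact: leq_trans mr (ltnW (ltn_expl _ _)).
Qed.

Lemma linear_bound_stable (A : 'M[R]_2) q1 q2 M : 0 <= M ->
  (forall x0 y0 x y, is_solution A q1 q2 x0 y0 x y -> forall t, 0 <= t ->
    `|x t| + `|y t| <= M * (`|x0| + `|y0|)) -> stable A q1 q2.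
Proof.
move=> M0 bnd eps eps0; have c0 : 0 < 2 * M + 1 by lra.
(* The 2 comes from [|x0| + |y0| <= 2 * norm2 x0 y0], the 1 from the possibility [M = 0]. *)
exists (eps / (2 * M + 1)); first exact: divr_gt0.
move=> x0 y0 x y sol n0 t t0; apply: le_trans (norm2_le _ _) _.
apply: le_trans (bnd _ _ _ _ sol t t0) _.
have [hx hy] := norm2_ge x0 y0.
have h : `|x0| + `|y0| <= 2 * (eps / (2 * M + 1)) by lra.
apply: le_trans (ler_wpM2l M0 h) _.
by rewrite !mulrA ler_pdivrMr// (_ : M * 2 * eps = eps * (2 * M)) ?mulrDr ?mulr1 ?lerDl ?ltW//; ring.
Qed.

Lemma stable_orders (A : 'M[R]_2) : 0 < \det A -> A 0 0 + A 1 1 < \det A + 1 ->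
  ~ [/\ 0 < A 0 0, 0 < A 1 1 & \det A <= A 0 0 * A 1 1] ->
  exists q1 q2 : R, [/\ 0 < q1 <= 1, 0 < q2 <= 1 & stable A q1 q2].
Proof.
move=> d0 tr nP; have [m [n [m0 n0 pos]]] := positive_trinomialP d0 tr nP.
have [|N1 H1] := @volterra_bound R (A 0 0) (A 0 1) (A 1 0) (A 1 1) m n m0 n0.
  by move=> z z0; rewrite -det_mx2; exact: pos.
(* The second component is bounded by exchanging the two unknowns together with [m] and [n]. *)
have [|N2 H2] := @volterra_bound R (A 1 1) (A 1 0) (A 0 1) (A 0 0) n m n0 m0.
  move=> z z0; have := pos z z0; rewrite det_mx2 (addnC n).
  by congr (0 < _); ring.
(* The terms [m] and [n] make both orders at most 1, since [m <= 2^r] and [n <= 2^r]. *)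
pose r := (N1 + N2 + m + n)%N.
have [|M1 M10 B1] := H1 r; first by rewrite /r -!addnA leq_addr.
have [|M2 M20 B2] := H2 r; first by rewrite /r (addnC N1) -!addnA leq_addr.
have q1P : 0 < (m%:R : R) * dyadic r <= 1.
  by rewrite mulr_gt0 ?ltr0n ?dyadic_gt0// dyadic_le1// /r addnAC leq_addl.
have q2P : 0 < (n%:R : R) * dyadic r <= 1.
  by rewrite mulr_gt0 ?ltr0n ?dyadic_gt0// dyadic_le1// /r leq_addl.
exists (m%:R * dyadic r : R), (n%:R * dyadic r : R); split=> //.
apply: (@linear_bound_stable _ _ _ (M1 + M2)); first exact: addr_ge0.
move=> x0 y0 x y sol t t0.
have [X [Y [cX cY XY EX EY]]] := solution_volterra q1P q2P sol.
have [-> ->] := XY t t0; rewrite mulrDl; apply: lerD; first exact: (B1 x0 y0 X Y).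
rewrite (addrC `|x0|); apply: (B2 y0 x0 Y X) => // u.
- by rewrite EY; congr (_ + conv _ _ _); apply/funext => v; rewrite addrC.
- by rewrite EX; congr (_ + conv _ _ _); apply/funext => v; rewrite addrC.
Qed.

End stability.

Theorem theorem3p1 (R : realType) (A : 'M[R]_2) :
  (\det A < 0 ->
    forall q1 q2 : R, 0 < q1 <= 1 -> 0 < q2 <= 1 -> unstable A q1 q2) /\
  (0 < \det A ->
    ((forall q1 q2 : R, 0 < q1 <= 1 -> 0 < q2 <= 1 -> unstable A q1 q2) <->
     (A 0 0 + A 1 1 >= \det A + 1 \/
      [/\ A 0 0 > 0, A 1 1 > 0 & A 0 0 * A 1 1 >= \det A]))).
Proof.
split=> [d0 q1 q2|d0]; first exact: det_lt0_unstable.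
split=> [unst|H q1 q2]; last exact: det_gt0_unstable.
have [|tr] := leP (\det A + 1) (A 0 0 + A 1 1); [by left|right].
apply: contrapT => nP; have [q1 [q2 [h1 h2 st]]] := stable_orders d0 tr nP.
exact: unst h1 h2 st.
Qed.
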